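(* Let $D>0$ and let $f:\mathbb{R}^2\to\mathbb{R}$ satisfy $f(0,0)=0$ and $|f(u_1,v_1)-f(u_2,v_2)|\le C_f(|u_1-u_2|+|v_1-v_2|)$ for all $(u_1,v_1),(u_2,v_2)\in\mathbb{R}^2$ with a constant $C_f>0$. For any $n\in\mathbb{N}$, radial integral kernel $K\in L^1(\mathbb{R}^n)$, $\epsilon>0$, $\delta>0$ and $T>0$, there exist $N=N(K,n,\epsilon)\in\mathbb{N}$, a reaction-diffusion system with $N+1$ components of the form $$\frac{\partial u}{\partial t}=D\Delta u+f\Big(u,\sum_{j=1}^N\alpha_jv_j\Big),\qquad\frac{\partial v_j}{\partial t}=\frac1\delta(d_j\Delta v_j-v_j+u)\quad(j=1,\ldots,N),\qquad(t>0,\ x\in\mathbb{R}^n)\tag{RD$_\delta$}$$ (with $\alpha_j\in\mathbb{R}$, $d_j>0$), and positive constants $$C_1=C_1(f,D,\{\alpha_j\}_{1\le j\le N},\{d_j\}_{1\le j\le N},T),\qquad C_3=C_3(f,K,T)$$ such that for any $1\le p\le+\infty$, $$\sup_{0\le t\le T}\|u^\delta(t)-u(t)\|_{L^p}\le(C_1\delta+C_3\epsilon)\|u_0\|_{L^p},$$ $$\sup_{0\le t\le T}\|v_j^\delta(t)-(k_j*u)(t)\|_{L^p}\le(C_1\delta+C_3\epsilon)\|u_0\|_{L^p},\quad(j=1,2,\ldots,N),$$ where $u$ is the solution to $$\frac{\partial u}{\partial t}=D\Delta u+f(u,K*u)\quad(t>0,\ x\in\mathbb{R}^n),\qquad u(0,\cdot)=u_0\tag{NP}$$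 with $u_0\in BC(\mathbb{R}^n)\cap L^p(\mathbb{R}^n)$, and $(u^\delta,v_1^\delta,\ldots,v_N^\delta)$ is the solution to (RD$_\delta$) with initial condition $(u,v_1,\ldots,v_N)(0,\cdot)=(u_0,k_1*u_0,\ldots,k_N*u_0)$.
   Context: $BC(\mathbb{R}^n)$ is the set of bounded continuous real-valued functions on $\mathbb{R}^n$; $*$ is convolution in $x$. The notation $C=C(\ldots)$ (and $N=N(\ldots)$) means that the constant depends only on the listed quantities (and the dimension); in particular $C_1,C_3$ do not depend on $\delta$, $p$, $u_0$, and $C_3$ does not depend on $N$ or $\epsilon$. The Green functions are $$k_j(x)=d_j^{-n/2}G\Big(\frac{|x|}{\sqrt{d_j}}\Big),\quad G(r)=\frac{1}{(2\pi)^{n/2}}\Big(\frac1r\Big)^{n/2-1}M_{n/2-1}(r),\quad M_\nu(r)=\int_0^{+\infty}e^{-r\cosh s}\cosh(\nu s)\,ds.$$ ''Solution'' means mild solution with each component in $C([0,T];BC(\mathbb{R}^n)\cap L^p(\mathbb{R}^n))$ (which is moreover classical, i.e. in $C^{1,2}((0,T]\times\mathbb{R}^n)$). With $H(t,x;D)=(4\pi Dt)^{-n/2}e^{-|x|^2/(4Dt)}$, the mild formulations are: for (NP), $u(t)=H(t;D)*u_0+\int_0^tH(t-s;D)*f(u(s),(K*u)(s))\,ds$; for (RD$_\delta$), $u(t)=H(t;D)*u_0+\int_0^tH(t-s;D)*f(u(s),\sum_j\alpha_jv_j(s))\,ds$ and $v_j(t)=e^{-t/\delta}H(t;d_j/\delta)*(k_j*u_0)+\frac1\delta\int_0^te^{-(t-s)/\delta}H(t-s;d_j/\delta)*u(s)\,ds$.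 *)

(* Defs.v *)
From HB Require Import structures.
From mathcomp Require Import all_boot all_order all_algebra.
From mathcomp Require Import all_classical all_reals all_analysis.
Import Order.TTheory GRing.Theory Num.Theory.
Import numFieldNormedType.Exports.

Set Implicit Arguments.
Unset Strict Implicit.
Unset Printing Implicit Defensive.

Local Open Scope classical_set_scope.
Local Open Scope ring_scope.

Definition measure_rV_display : measure_display.
Proof. by constructor. Qed.

(* R^n is 'rV[R]_n, whose topology is the usual one, with the product
   (equivalently Borel) sigma-algebra. *)
Section measurable_rV.
Context (R : realType) (n : nat).

Let coors : 'I_n -> 'rV[R]_n -> measurableTypeR R := fun i x => x ord0 i.

Let rV_set0 : g_sigma_preimage coors set0.
Proof. exact: sigma_algebra0. Qed.

Let rV_setC A : g_sigma_preimage coors A -> g_sigma_preimage coors (~` A).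
Proof. exact: sigma_algebraC. Qed.

Let rV_bigcup (F : _^nat) : (forall i, g_sigma_preimage coors (F i)) ->
  g_sigma_preimage coors (\bigcup_i (F i)).
Proof. exact: sigma_algebra_bigcup. Qed.

HB.instance Definition _ := @isMeasurable.Build measure_rV_display
  'rV[R]_n (g_sigma_preimage coors) rV_set0 rV_setC rV_bigcup.

Lemma measurable_coord (i : 'I_n) :
  measurable_fun setT (fun x : 'rV[R]_n => x ord0 i : measurableTypeR R).
Proof.
move=> _ Y mY; rewrite setTI; apply: sub_sigma_algebra => /=.
rewrite -bigcup_seq/=; exists i => /=; first by rewrite mem_index_enum.
by exists Y => //; rewrite setTI.
Qed.

Lemma measurable_fun_rVP d (T : measurableType d) (f : T -> 'rV[R]_n) :
  (forall i, measurable_fun setT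
     (fun x => f x ord0 i : measurableTypeR R)) ->
  measurable_fun setT f.
Proof.
move=> mf _ A mA; rewrite setTI.
suff : g_sigma_preimage (fun i => coors i \o f) `<=` measurable.
  apply; rewrite g_sigma_preimage_comp.
  by exists A => //; rewrite setTI.
apply: smallest_sub; first exact: sigma_algebra_measurable.
rewrite -bigcup_seq; apply: bigcup_sub => i _ B [C mC <-]; exact: mf.
Qed.

End measurable_rV.

Section lebesgue_rV.
Context (R : realType).

Definition rVcons (n : nat) (x : measurableTypeR R * 'rV[R]_n) : 'rV[R]_n.+1 :=
  row_mx (x.1)%:M x.2.

Lemma rVcons0 n x : @rVcons n x ord0 ord0 = x.1.
Proof.
transitivity (row_mx (x.1)%:M x.2 ord0 (lshift n ord0)).
  by rewrite /rVcons; congr (row_mx _ _ _ _); exact: val_inj.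
by rewrite row_mxEl mxE eqxx mulr1n.
Qed.

Lemma rVconsS n x (i : 'I_n) : @rVcons n x ord0 (lift ord0 i) = x.2 ord0 i.
Proof.
transitivity (row_mx (x.1)%:M x.2 ord0 (rshift 1 i)).
  by rewrite /rVcons; congr (row_mx _ _ _ _); exact: val_inj.
by rewrite row_mxEr.
Qed.

Definition rVuncons (n : nat) (y : 'rV[R]_n.+1) : measurableTypeR R * 'rV[R]_n :=
  (y ord0 ord0, \row_i y ord0 (lift ord0 i)).

Lemma rVconsK n : cancel (@rVcons n) (@rVuncons n).
Proof.
case=> a x; rewrite /rVuncons rVcons0; congr (_, _).
by apply/rowP => i; rewrite mxE rVconsS.
Qed.

Lemma measurable_rVuncons n : measurable_fun setT (@rVuncons n).
Proof.
apply/measurable_fun_pairP; split; first exact: (@measurable_coord R n.+1 ord0).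
apply: measurable_fun_rVP => i /=.
under eq_fun do rewrite mxE.
exact: measurable_coord.
Qed.

Lemma measurable_rVcons n : measurable_fun setT (@rVcons n).
Proof.
apply: measurable_fun_rVP => i.
case: (unliftP ord0 i) => [j ->|->].
  under eq_fun do rewrite rVconsS.
  exact: (measurableT_comp (@measurable_coord R n j) measurable_snd).
under eq_fun do rewrite rVcons0.
exact: measurable_fst.
Qed.

Section step.
Context (n : nat) (mu : {sigma_finite_measure set 'rV[R]_n -> \bar R}).

Definition lebesgue_rVS_fun : set 'rV[R]_n.+1 -> \bar R :=
  pushforward (@lebesgue_measure R \x mu)%E (@rVcons n).

Local Notation nu := lebesgue_rVS_fun.
Let mcons := @measurable_rVcons n.

Let nu0 : nu set0 = 0%E.
Proof. by rewrite /nu /pushforward preimage_set0 measure0. Qed.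

Let nu_ge0 A : (0 <= nu A)%E.
Proof. by rewrite /nu; exact: measure_ge0. Qed.

Let nu_sigma_additive : semi_sigma_additive nu.
Proof. by rewrite /nu; exact: measure_semi_sigma_additive. Qed.

HB.instance Definition _ := isMeasure.Build _ _ _ nu
  nu0 nu_ge0 nu_sigma_additive.

Let nu_sigma_finite : sigma_finite setT nu.
Proof.
have /sigma_finiteP[F [TF ndF Foo]] := sigma_finiteT (@lebesgue_measure R).
have /sigma_finiteP[G [TG ndG Goo]] := sigma_finiteT mu.
exists (fun k => @rVuncons n @^-1` (F k `*` G k)).
  rewrite -preimage_bigcup (_ : \bigcup_i _ = setT) ?preimage_setT//.
  rewrite -setXTT TF TG predeqE => -[x y]; split.
    by move=> [k _ []/= ? ?]; split; exists k.
  move=> [/= [k _ Fkx] [l _ Gly]]; exists (maxn k l) => //; split.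
  - by move: x Fkx; exact/subsetPset/ndF/leq_maxl.
  - by move: y Gly; exact/subsetPset/ndG/leq_maxr.
move=> k; have [? ?] := Foo k; have [? ?] := Goo k; split.
  rewrite -[X in measurable X]setTI; apply: measurable_rVuncons => //.
  exact: measurableX.
rewrite /nu /pushforward -comp_preimage (_ : _ \o _ = id).
  by rewrite preimage_id product_measure1E// lte_mul_pinfty// ge0_fin_numE.
by apply/funext => x /=; rewrite rVconsK.
Qed.

HB.instance Definition _ := Measure_isSigmaFinite.Build _ _ _ nu
  nu_sigma_finite.

Definition lebesgue_rVS : {sigma_finite_measure set 'rV[R]_n.+1 -> \bar R} := nu.

End step.

Fixpoint lebesgue_rV (n : nat) : {sigma_finite_measure set 'rV[R]_n -> \bar R} :=
  if n is m.+1 then lebesgue_rVS (lebesgue_rV m) else \d_(0 : 'rV[R]_0).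

End lebesgue_rV.

(* lebesgue_rV is indeed n-dimensional Lebesgue measure. *)
Lemma lebesgue_rV_box (R : realType) n (A : 'I_n -> set (measurableTypeR R)) :
  (forall i, measurable (A i)) ->
  lebesgue_rV R n [set x | forall i, A i (x ord0 i)] =
  (\prod_(i < n) lebesgue_measure (A i))%E.
Proof.
elim: n A => [|n IH] A mA.
  by rewrite big_ord0 /= diracE mem_set// => -[].
rewrite big_ord_recl -IH; last by move=> i; exact: mA.
have mB : measurable [set x : 'rV[R]_n | forall i, A (lift ord0 i) (x ord0 i)].
  rewrite [X in measurable X](_ : _ = \bigcap_(i in [set: 'I_n])
    ((fun x : 'rV[R]_n => x ord0 i : measurableTypeR R) @^-1` A (lift ord0 i))).
    apply: fin_bigcap_measurable => // i _.
    by rewrite -[X in measurable X]setTI; exact: measurable_coord.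
  by apply/seteqP; split=> [x Ax i _|x Ax i]; [exact: Ax|exact: (Ax i I)].
rewrite -product_measure1E//=.
rewrite -[LHS]/((@lebesgue_measure R \x lebesgue_rV R n)%E
  (@rVcons R n @^-1` [set x | forall i, A i (x ord0 i)])).
congr (product_measure1 _ _ _); apply/seteqP; split=> -[a x] /=.
  move=> Ax; split => /=; first by have := Ax ord0; rewrite rVcons0.
  by move=> i; have := Ax (lift ord0 i); rewrite rVconsS.
move=> [/= Aa Ax] i; case: (unliftP ord0 i) => [j ->|->].
  by rewrite rVconsS.
by rewrite rVcons0.
Qed.

Section kernels.
Context (R : realType) (n : nat).
Implicit Types (x : 'rV[R]_n) (g h K : 'rV[R]_n -> R).

Definition enorm x : R := Num.sqrt (\sum_(i < n) x ord0 i ^+ 2).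

Definition convolution g h x : R := \int[lebesgue_rV R n]_y (g (x - y) * h y).

Definition radial K := forall x y, enorm x = enorm y -> K x = K y.

Definition cosh (s : R) : R := (expR s + expR (- s)) / 2.

Definition besselM (nu r : R) : R :=
  \int[lebesgue_measure]_(s in `[0, +oo[) (expR (- (r * cosh s)) * cosh (nu * s)).

(* For n = 1 the order n / 2 - 1 is negative, whence real powers; the value at
   r = 0 is irrelevant since green is only used under an integral. *)
Definition greenG (r : R) : R :=
  ((2 * pi) `^ (n%:R / 2))^-1 * r^-1 `^ (n%:R / 2 - 1) * besselM (n%:R / 2 - 1) r.

Definition green (d : R) x : R :=
  d `^ (- (n%:R / 2)) * greenG (enorm x / Num.sqrt d).

Definition heat (t D : R) x : R :=
  (4 * pi * D * t) `^ (- (n%:R / 2)) * expR (- (enorm x ^+ 2 / (4 * D * t))).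

End kernels.

Section solutions.
Context (R : realType) (n : nat).
Implicit Types (p : \bar R) (g : 'rV[R]_n -> R) (w : R -> 'rV[R]_n -> R).

Definition Lpnorm p g : \bar R := 'N[lebesgue_rV R n]_p [EFin \o g].

Definition supnorm g : \bar R := ereal_sup (range (fun x => `|g x|%:E)).

Definition BC_Lp p g :=
  [/\ continuous g, (supnorm g < +oo)%E & (Lpnorm p g < +oo)%E].

Definition BC_Lp_norm p g : \bar R := (supnorm g + Lpnorm p g)%E.

(* Curves [0,T] -> BC /\ L^p that are bounded, and continuous on ]0,T], for the
   norm of BC /\ L^p.  This contains C([0,T]; BC /\ L^p), with which it coincides
   on mild solutions whose initial data make t |-> H(t) * u0 norm-continuous at
   t = 0.  Norm continuity at t = 0 is not imposed because H(t) * u0 -> u0 in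
   sup norm fails for every u0 in BC that is not uniformly continuous; the
   behaviour at t = 0 is governed by the mild formulation. *)
Definition BC_Lp_curve p (T : R) w :=
  [/\ forall t, 0 <= t <= T -> BC_Lp p (w t),
      exists M : R, forall t, 0 <= t <= T -> (BC_Lp_norm p (w t) <= M%:E)%E &
      forall t, 0 < t <= T ->
        BC_Lp_norm p (w s \- w t) @[s --> within `[0, T] (nbhs t)] --> 0%E].

(* (\int_0^t H(t - s; D) * F(s) ds)(x) *)
Definition duhamel (D : R) (F : R -> 'rV[R]_n -> R) (t : R) (x : 'rV[R]_n) : R :=
  \int[lebesgue_measure]_(s in `[0, t]) convolution (heat (t - s) D) (F s) x.

(* In both definitions t = 0 is separate because H(0; D) is the identity, which
   the formula for the heat kernel does not give. *)
Definition mild_NP (D : R) (f : R -> R -> R) (K : 'rV[R]_n -> R)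
    (u0 : 'rV[R]_n -> R) p (T : R) (u : R -> 'rV[R]_n -> R) :=
  [/\ BC_Lp_curve p T u, u 0 = u0 &
      forall t x, 0 < t <= T ->
        u t x = convolution (heat t D) u0 x
              + duhamel D (fun s y => f (u s y) (convolution K (u s) y)) t x].

Definition mild_RD (D : R) (f : R -> R -> R) (delta : R) (N : nat)
    (alpha d : 'I_N -> R) (u0 : 'rV[R]_n -> R) (v0 : 'I_N -> 'rV[R]_n -> R)
    p (T : R) (u : R -> 'rV[R]_n -> R) (v : 'I_N -> R -> 'rV[R]_n -> R) :=
  [/\ BC_Lp_curve p T u /\ u 0 = u0,
      forall j, BC_Lp_curve p T (v j) /\ v j 0 = v0 j,
      forall t x, 0 < t <= T ->
        u t x = convolution (heat t D) u0 x
              + duhamel D (fun s y => f (u s y) (\sum_j alpha j * v j s y)) t x &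
      forall j t x, 0 < t <= T ->
        v j t x = expR (- (t / delta)) * convolution (heat t (d j / delta)) (v0 j) x
          + delta^-1 * \int[lebesgue_measure]_(s in `[0, t])
              (expR (- ((t - s) / delta)) * convolution (heat (t - s) (d j / delta)) (u s) x)].

Definition sup_Lpnorm p (T : R) w : \bar R :=
  ereal_sup [set Lpnorm p (w t) | t in `[0, T]].

End solutions.

(* Main.v *)
(* Green functions are mixtures of heat kernels: k_d is the integral over
   tau > 0 of exp(- tau / d) / d times the heat kernel at time tau.  Polynomials
   in z = exp(- |x|^2) (resp. z = exp(- tau)) are dense in the weighted L^1
   spaces of functions of z, so Gaussians span the radial L^1 functions and
   combinations of exponentials approximate Dirac masses in tau; hence
   combinations of the k_j approximate K in L^1.
   By Duhamel's formula and the semigroup law, v_j - k_j * u is an explicit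
   integral against exp(- (t - s) / delta), of L^p norm O(delta).  The nonlinear
   terms are then compared by a Gronwall argument in the norm
   sup_t exp(- lambda t) |.|_p, where choosing lambda twice the Lipschitz constant
   of the source turns the Duhamel term into a contraction by 1/2. *)
Require Import Defs.
From mathcomp Require Import all_boot all_order all_algebra.
From mathcomp Require Import all_classical all_reals all_analysis.
From mathcomp Require Import measurable_realfun ess_sup_inf ring lra.
Import Order.TTheory GRing.Theory Num.Def Num.Theory.
Import numFieldNormedType.Exports.

Set Implicit Arguments.
Unset Strict Implicit.
Unset Printing Implicit Defensive.

Local Open Scope classical_set_scope.
Local Open Scope ring_scope.


(** * Parametric integrals and Minkowski's integral inequality *)

(** The obstacle is the independence of [C3] from [N]: the sum [A] of the [|alpha_j|] is not
    controlled as [eps] shrinks, so it may multiply only terms carrying a factor [delta]. The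
    coupling error is therefore regrouped before norms are taken: relaxation errors weighted by the
    [alpha_j], plus [K_N] convolved with [u^delta - u], plus [K_N - K] convolved with [u], where
    [K_N] is the sum of the [alpha_j k_j]. The Gronwall rate then involves only the L^1 norm of
    [K_N], at most [A] and also at most [1 + |K|_1], since [K] is approximated within [min(eps, 1)];
    the first bound serves the [delta] term, the second the [eps] term. No regularity in space is
    used for [v_j - k_j * u^delta]: with [m(r)] the value of [k_j * H(r) * g] at a point, the
    equation of the Green function becomes the scalar equation [m' = (m - H(r) * g) / d_j] in the
    heat time, integrated along a segment. The [d_j] are fixed in advance as [1 / (j + 1)]: their
    mixing densities are multiples of the powers [z^(j+1)] of [z = exp(- r)], so choosing the
    [alpha_j] amounts to choosing a polynomial. *)

Section product_integrals.
Context d1 d2 (Z1 : measurableType d1) (Z2 : measurableType d2) (R : realType).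
Variables (m1 : {sigma_finite_measure set Z1 -> \bar R})
          (m2 : {sigma_finite_measure set Z2 -> \bar R}).

Lemma measurable_integral_param (f : Z1 -> Z2 -> \bar R) :
  measurable_fun setT (fun z => f z.1 z.2) ->
  measurable_fun setT (fun x => \int[m2]_y f x y)%E.
Proof.
move=> mf; under eq_fun do rewrite integralE.
apply: emeasurable_funB.
- rewrite (_ : (fun x => _) = fubini_F m2 (funepos (fun z => f z.1 z.2))).
    apply: measurable_fun_fubini_tonelli_F; last by move=> ?; exact: funepos_ge0.
    exact: measurable_funepos.
  by apply/funext => x; apply: eq_integral => y _; rewrite !funeposE.
- rewrite (_ : (fun x => _) = fubini_F m2 (funeneg (fun z => f z.1 z.2))).
    apply: measurable_fun_fubini_tonelli_F; last by move=> ?; exact: funeneg_ge0.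
    exact: measurable_funeneg.
  by apply/funext => x; apply: eq_integral => y _; rewrite !funenegE.
Qed.

Lemma measurable_Rintegral_param (f : Z1 -> Z2 -> R) :
  measurable_fun setT (fun z => f z.1 z.2) ->
  measurable_fun setT (fun x => \int[m2]_y f x y).
Proof.
move=> mf; rewrite /Rintegral.
apply: (measurableT_comp (fine_measurable measurableT)).
apply: (measurable_integral_param (f := fun x y => (f x y)%:E)).
exact/measurable_EFinP.
Qed.

Lemma measurable_section1 (f : Z1 -> Z2 -> R) (x : Z1) :
  measurable_fun setT (fun z => f z.1 z.2) -> measurable_fun setT (f x).
Proof. by move=> mf; exact: (measurableT_comp mf (measurable_pair1 x)). Qed.

Lemma measurable_section2 (f : Z1 -> Z2 -> R) (y : Z2) :
  measurable_fun setT (fun z => f z.1 z.2) -> measurable_fun setT (f ^~ y).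
Proof. by move=> mf; exact: (measurableT_comp mf (measurable_pair2 y)). Qed.

(** [Rintegral] applies [fine], which turns infinite inner integrals into 0. Integrability on the
    product confines such [x] to a null set, so nested real integrals fall under the Fubini theorem
    for extended reals. *)
Lemma fine_integral_ae (f : Z1 -> Z2 -> R) :
  measurable_fun setT (fun z => f z.1 z.2) ->
  (\int[m1]_x \int[m2]_y `|f x y|%:E < +oo)%E ->
  (\int[m1]_x (\int[m2]_y f x y)%:E = \int[m1]_x \int[m2]_y (f x y)%:E)%E.
Proof.
move=> mf foo.
have mF : measurable_fun setT (fun z => (f z.1 z.2)%:E) by exact/measurable_EFinP.
have /ae_integrable1 fi : (m1 \x m2)%E.-integrable setT (fun z => (f z.1 z.2)%:E).
  exact/integrable12ltyP.
apply: ae_eq_integral => //.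
- by apply/measurable_EFinP; exact: measurable_Rintegral_param.
- exact: measurable_integral_param.
- apply: filterS fi => x fx _; rewrite /Rintegral fineK//.
  exact: integrable_fin_num.
Qed.

End product_integrals.

Section Rintegral_swap.
Context d1 d2 (Z1 : measurableType d1) (Z2 : measurableType d2) (R : realType).
Variables (m1 : {sigma_finite_measure set Z1 -> \bar R})
          (m2 : {sigma_finite_measure set Z2 -> \bar R}).

Lemma measurable_uncurry_swap (f : Z1 -> Z2 -> R) :
  measurable_fun setT (fun z => f z.1 z.2) ->
  measurable_fun setT (fun z : Z2 * Z1 => f z.2 z.1).
Proof. by move=> mf; exact: (measurableT_comp (f := fun z : Z1 * Z2 => f z.1 z.2) mf (@measurable_swap _ _ Z2 Z1)). Qed.

Lemma Rintegral_swap (f : Z1 -> Z2 -> R) :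
  measurable_fun setT (fun z => f z.1 z.2) ->
  (\int[m1]_x \int[m2]_y `|f x y|%:E < +oo)%E ->
  \int[m1]_x \int[m2]_y f x y = \int[m2]_y \int[m1]_x f x y.
Proof.
move=> mf foo; rewrite {1}/Rintegral fine_integral_ae//.
rewrite [in RHS]/Rintegral (fine_integral_ae (f := fun y x => f x y)).
- congr fine; apply: (@Fubini _ _ _ _ _ m1 m2 (fun z => (f z.1 z.2)%:E)).
  by apply/integrable12ltyP => //; exact/measurable_EFinP.
- exact: measurable_uncurry_swap.
- rewrite -(@fubini_tonelli _ _ _ _ _ m1 m2 (fun z => `|f z.1 z.2|%:E))//.
  by apply/measurable_EFinP; exact: measurableT_comp.
Qed.

End Rintegral_swap.

Lemma measurable_fun_powR d (Z : measurableType d) (R : realType) (f : Z -> R) r :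
  measurable_fun setT f -> measurable_fun setT (fun z => f z `^ r).
Proof. exact: (@measurableT_comp _ _ _ _ _ _ (@powR R ^~ r)). Qed.

Section Rintegral_bounds.
Context d (Z : measurableType d) (R : realType) (m : {measure set Z -> \bar R}).

Lemma le_abse_Rintegral (f : Z -> R) : measurable_fun setT f ->
  (`|\int[m]_z f z|%:E <= \int[m]_z `|f z|%:E)%E.
Proof.
move=> mf; have mF : measurable_fun setT (EFin \o f) by exact/measurable_EFinP.
have := le_abse_integral m measurableT mF; apply: le_trans.
rewrite /Rintegral; case: (\int[m]_z _)%E => [r| |] //=; by rewrite normr0 ?leey.
Qed.

End Rintegral_bounds.

Section minkowski_integral.
Context d1 d2 (X : measurableType d1) (Z : measurableType d2) (R : realType).
Variables (mu : {sigma_finite_measure set X -> \bar R})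
          (m : {sigma_finite_measure set Z -> \bar R}).

(** Jensen's inequality in weighted form: Hoelder with exponents [r] and [q = r / (r - 1)] for the
    factorisation of [|g|] into [b^(-1/q) |g|] and [b^(1/q)]. That [g] vanishes where [b] does makes
    the factorisation exact everywhere. The case [r = 1] is apart, since [q] would be infinite. *)
Lemma jensen_weight (g b : Z -> R) (r : R) : 1 <= r ->
  measurable_fun setT g -> measurable_fun setT b -> (forall z, 0 <= b z) ->
  (forall z, b z = 0 -> g z = 0) ->
  ((\int[m]_z `|g z|%:E) `^ r <= (\int[m]_z (b z)%:E) `^ (r - 1) *
     \int[m]_z (b z `^ (1 - r) * `|g z| `^ r)%:E)%E.
Proof.
move=> r1 mg mb b0 bg.
have r0 : 0 < r by exact: lt_le_trans r1.
move: r1; rewrite le_eqVlt => /predU1P[<-|r1].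
  rewrite subrr poweRe0 mul1e poweRe1 ?integral_ge0//.
  by under [leRHS]eq_integral do rewrite powRr0 mul1r powRr1//.
pose q := r / (r - 1).
have q0 : 0 < q by rewrite divr_gt0// subr_gt0.
have rq : r^-1 + q^-1 = 1.
  by rewrite /q invf_div; field; rewrite gt_eqF.
pose F z := b z `^ (- q^-1) * `|g z|.
pose H z := b z `^ q^-1.
have mF : measurable_fun setT F.
  apply: measurable_funM; last exact: measurableT_comp.
  apply: measurable_fun_powR => //.
have mH : measurable_fun setT H by exact: measurable_fun_powR.
have := hoelder m mF mH r0 q0 rq.
rewrite Lnorm1.
have -> : (\int[m]_x `|(EFin \o (F \* H)%R) x| = \int[m]_z `|g z|%:E)%E.
  apply: eq_integral => z _ /=; congr (_%:E).
  have [bz|bz] := eqVneq (b z) 0; first by rewrite bg// /F bg// normr0 mulr0 mul0r normr0.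
  rewrite normrM ger0_norm ?mulr_ge0 ?powR_ge0// ger0_norm ?powR_ge0// /F /H mulrAC -powRD.
    by rewrite addNr powRr0 mul1r.
  by rewrite bz implybT.
move=> /(gt0_ler_poweR (ltW r0)) => /(_ _ _)/le_trans; apply.
- by rewrite in_itv/= leey andbT integral_ge0.
- by rewrite in_itv/= leey andbT mule_ge0 ?Lnorm_ge0.
rewrite poweRM ?Lnorm_ge0// poweR_Lnorm ?gt_eqF// muleC.
have -> : ('N[m]_q%:E[EFin \o H] `^ r = (\int[m]_z (b z)%:E) `^ (r - 1))%E.
  rewrite unlock -poweRrM; congr (poweR _ _).
    apply: eq_integral => z _ /=.
    by rewrite ger0_norm ?powR_ge0// /H -powRrM mulVf ?gt_eqF// powRr1.
  by rewrite /q invf_div mulrC mulrA mulrAC divff ?mul1r ?gt_eqF.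
apply: lee_wpmul2l; first exact: poweR_ge0.
apply: ge0_le_integral => //=.
- apply/measurable_EFinP; apply: measurable_fun_powR => //.
  exact: measurableT_comp.
- apply/measurable_EFinP; apply: measurable_funM.
    apply: measurable_fun_powR => //.
  apply: measurable_fun_powR => //.
  exact: measurableT_comp.
- move=> z _; rewrite lee_fin ger0_norm ?mulr_ge0 ?powR_ge0//.
  rewrite /F powRM ?powR_ge0// -powRrM mulNr /q invf_div.
  by rewrite divfK ?gt_eqF// opprB.
Qed.

(** Minkowski's integral inequality, in terms of a majorant [b] of the norms. For finite [p],
    [jensen_weight] with weight [b] is applied at each [x], and Tonelli concludes because
    [b^(1-r) b^r = b]. For infinite [p] the exceptional null set depends on [z], and Tonelli is what
    converts it into a null set of [x]. *)
Lemma Lnorm_Rintegral_le (G : Z -> X -> R) (b : Z -> R) (W : R) (p : \bar R) :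
  (1 <= p)%E -> measurable_fun setT (fun z => G z.1 z.2) ->
  measurable_fun setT b -> (forall z, 0 <= b z) ->
  (forall z x, b z = 0 -> G z x = 0) ->
  (forall z, 'N[mu]_p[EFin \o G z] <= (b z)%:E)%E ->
  (\int[m]_z (b z)%:E <= W%:E)%E ->
  ('N[mu]_p[EFin \o (fun x => \int[m]_z G z x)%R] <= W%:E)%E.
Proof.
move=> p1 mG mb b0 bG NG bW.
have W0 : 0 <= W.
  by rewrite -lee_fin; apply: le_trans bW; apply: integral_ge0 => z _; rewrite lee_fin.
have mGn : measurable_fun setT (fun z => `|G z.1 z.2|) by exact: measurableT_comp.
case: p p1 NG => [r| |]//.
- rewrite lee_fin => r1 NG.
  have r0 : 0 < r by exact: lt_le_trans r1.
  have NGr z : (\int[mu]_x (`|G z x| `^ r)%:E <= (b z `^ r)%:E)%E.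
    have := NG z; rewrite -(poweR_EFin (b z)).
    move=> /(gt0_ler_poweR (ltW r0)) => /(_ _ _).
    by rewrite poweR_Lnorm ?gt_eqF//; apply; rewrite in_itv/= leey andbT ?lee_fin ?Lnorm_ge0.
  rewrite unlock.
  have -> : W%:E = ((W `^ r)%:E `^ r^-1)%E.
    by rewrite poweR_EFin -powRrM mulfV ?gt_eqF// powRr1.
  apply: gt0_ler_poweR; rewrite ?invr_ge0 ?(ltW r0)//.
  + by rewrite in_itv/= leey andbT integral_ge0// => x _; exact: poweR_ge0.
  + by rewrite in_itv/= leey andbT lee_fin powR_ge0.
  have mGr : measurable_fun setT (fun z : X * Z => b z.2 `^ (1 - r) * `|G z.2 z.1| `^ r).
    apply: measurable_funM.
      apply: measurable_fun_powR => //.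
      exact: (measurableT_comp mb measurable_snd).
    apply: measurable_fun_powR => //.
    exact: (measurable_uncurry_swap (f := fun z x => `|G z x|)).
  apply: (@le_trans _ _ ((\int[m]_z (b z)%:E) `^ (r - 1) *
     \int[mu]_x \int[m]_z (b z `^ (1 - r) * `|G z x| `^ r)%:E)%E).
    rewrite -ge0_integralZl//; last 3 first.
    + apply: measurable_integral_param; exact/measurable_EFinP.
    + by move=> x _; apply: integral_ge0 => z _; rewrite lee_fin mulr_ge0 ?powR_ge0.
    + exact: poweR_ge0.
    apply: ge0_le_integral => //=.
    + apply/measurable_EFinP; apply: measurable_fun_powR => //.
      apply: measurableT_comp => //.
      apply: (measurable_Rintegral_param m (f := fun x z => G z x)).
      exact: measurable_uncurry_swap.
    + apply: emeasurable_funM => //.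
      apply: measurable_integral_param; exact/measurable_EFinP.
    + move=> x _.
      have mGx : measurable_fun setT (G ^~ x) by exact: measurable_section2.
      apply: le_trans (jensen_weight r1 mGx mb b0 _) => /=; last by move=> z; exact: bG.
      rewrite -poweR_EFin; apply: gt0_ler_poweR; first exact: ltW.
      * by rewrite in_itv/= leey andbT.
      * by rewrite in_itv/= leey andbT integral_ge0.
      exact: le_abse_Rintegral.
  rewrite (@fubini_tonelli _ _ _ _ _ mu m (fun z => (b z.2 `^ (1 - r) * `|G z.2 z.1| `^ r)%:E))//; last 2 first.
  + exact/measurable_EFinP.
  + by move=> z; rewrite lee_fin mulr_ge0 ?powR_ge0.
  apply: (@le_trans _ _ ((W%:E `^ (r - 1)) * W%:E)%E); last first.
    rewrite poweR_EFin -EFinM lee_fin -{2}(powRr1 W0) -powRD ?subrK//.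
    by rewrite gt_eqF.
  apply: lee_pmul.
  + exact: poweR_ge0.
  + apply: integral_ge0 => z _; apply: integral_ge0 => x _.
    by rewrite lee_fin mulr_ge0 ?powR_ge0.
  + apply: gt0_ler_poweR; rewrite ?subr_ge0//.
    * by rewrite in_itv/= leey andbT integral_ge0// => z _; rewrite lee_fin.
    * by rewrite in_itv/= leey andbT lee_fin.
  apply: le_trans bW; apply: ge0_le_integral => //=.
  + move=> z _; apply: integral_ge0 => x _; by rewrite lee_fin mulr_ge0 ?powR_ge0.
  + apply: measurable_integral_param; apply/measurable_EFinP.
    exact: (measurable_uncurry_swap (f := fun x z => b z `^ (1 - r) * `|G z x| `^ r)).
  + exact/measurable_EFinP.
  + move=> z _; under eq_integral do rewrite EFinM.
    rewrite ge0_integralZl//; last 2 first.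
    * apply/measurable_EFinP; apply: measurable_fun_powR => //.
      by apply: measurableT_comp => //; exact: measurable_section1.
    * by rewrite lee_fin powR_ge0.
    apply: (@le_trans _ _ ((b z `^ (1 - r))%:E * (b z `^ r)%:E)%E).
      by apply: lee_wpmul2l; rewrite ?lee_fin ?powR_ge0.
    rewrite -EFinM lee_fin -powRD ?subrK ?powRr1//.
    by rewrite oner_eq0.
- move=> _ NG; rewrite unlock; case: ifPn => // muT.
  have Gb z : {ae mu, forall x, (`|G z x|%:E <= (b z)%:E)%E}.
    by have := NG z; rewrite unlock muT => /ess_supP.
  (* The excess of [|G z x|] over its bound: it integrates to 0 in [x] for every [z], hence, by
     Tonelli, in [z] for almost every [x]. *)
  pose H z x := maxr (`|G z x| - b z) 0.
  have H0 z x : 0 <= H z x by rewrite /H le_max lexx orbT.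
  have mH : measurable_fun setT (fun z => H z.1 z.2).
    apply: measurable_maxr => //; apply: measurable_funB => //.
    exact: (measurableT_comp mb measurable_fst).
  have Hz z : (\int[mu]_x (H z x)%:E = 0)%E.
    rewrite (ae_eq_integral (cst 0%E))//; first by rewrite integral0.
    - by apply/measurable_EFinP; exact: measurable_section1.
    - apply: filterS (Gb z) => x Gx _ /=; congr (_%:E).
      by apply/max_idPr; rewrite subr_le0 -lee_fin.
  have := @fubini_tonelli _ _ _ _ _ m mu (fun z => (H z.1 z.2)%:E).
  have mHE : measurable_fun setT (fun z => (H z.1 z.2)%:E) by exact/measurable_EFinP.
  move=> /(_ mHE (fun z => _))/=; under eq_integral do rewrite Hz.
  rewrite integral0 => /(_ _)/esym HH.
  have {}HH : (\int[mu]_x \int[m]_z (H z x)%:E = 0)%E by apply: HH => z; rewrite lee_fin.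
  have mHx : measurable_fun setT (fun x => \int[m]_z (H z x)%:E)%E.
    apply: (measurable_integral_param m (f := fun x z => (H z x)%:E)).
    by apply/measurable_EFinP; exact: measurable_uncurry_swap.
  have : (\int[mu]_x `|\int[m]_z (H z x)%:E| = 0)%E.
    by rewrite -[RHS]HH; apply: eq_integral => x _; rewrite gee0_abs// integral_ge0// => z _; rewrite lee_fin.
  move=> /(ae_eq_integral_abs _ measurableT mHx) Hx.
  apply/ess_supP; apply: filterS Hx => x /(_ I) /= Hx.
  have mGx : measurable_fun setT (G ^~ x) by exact: measurable_section2.
  apply: le_trans (le_abse_Rintegral m mGx) _.
  apply: le_trans bW.
  have -> : (\int[m]_z (b z)%:E = \int[m]_z ((b z)%:E + (H z x)%:E))%E.
    rewrite ge0_integralD// ?Hx ?adde0//.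
    - by move=> z _; rewrite lee_fin.
    - exact/measurable_EFinP.
    - by move=> z _; rewrite lee_fin.
    - by apply/measurable_EFinP; exact: measurable_section2.
  apply: ge0_le_integral => //=.
  - by apply/measurable_EFinP; exact: measurableT_comp.
  - apply: emeasurable_funD; first exact/measurable_EFinP.
    by apply/measurable_EFinP; exact: measurable_section2.
  - by move=> z _; rewrite -EFinD lee_fin /H -lerBlDl le_max lexx.
Qed.

End minkowski_integral.

(** * Joint measurability, Lebesgue measure and heat kernels on R^n *)

Section caratheodory_functions.
Context d (Z : measurableType d) (R : realType).

(** Freezing the parameter on a grid of mesh [1/(k+1)] leaves countably many measurable rectangles,
    one for each value of the floor. *)
Lemma measurable_floor_approx (g : R -> Z -> R) (k : nat) :
  (forall s, measurable_fun setT (g s)) ->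
  measurable_fun setT (fun sz : measurableTypeR R * Z =>
    g ((Num.floor (sz.1 * k.+1%:R))%:~R / k.+1%:R) sz.2).
Proof.
move=> mg _ Y mY; rewrite setTI.
rewrite (_ : _ @^-1` _ = \bigcup_(i : int)
   (`[i%:~R / k.+1%:R, (i + 1)%:~R / k.+1%:R[%classic `*` (g (i%:~R / k.+1%:R) @^-1` Y))).
  apply: countable_bigcupT_measurable; first exact: countableP.
  move=> i; apply: measurableX; first exact: measurable_itv.
  by rewrite -[X in measurable X]setTI; exact: mg.
have k0 : 0 < k.+1%:R :> R by [].
apply/seteqP; split => -[s z] /=.
  move=> Ygz; exists (Num.floor (s * k.+1%:R)) => //; split => //=.
  by rewrite in_itv/= ler_pdivrMr// ltr_pdivlMr// floor_le floorD1_gt.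
move=> [i _ /= []]; rewrite in_itv/= ler_pdivrMr// ltr_pdivlMr// => /andP[is_ si].
suff -> : Num.floor (s * k.+1%:R) = i by [].
by apply/floor_def; rewrite is_ si.
Qed.

(** Caratheodory's argument: by continuity in [s], the grid discretisations converge pointwise. *)
Lemma measurable_cont_param (g : R -> Z -> R) :
  (forall s, measurable_fun setT (g s)) -> (forall z, continuous (g ^~ z)) ->
  measurable_fun setT (fun sz : measurableTypeR R * Z => g sz.1 sz.2).
Proof.
move=> mg cg.
apply: (measurable_fun_cvg (fun k => measurable_floor_approx k mg)) => -[s z] _ /=.
apply: (@cvg_comp _ _ _ (fun k : nat => (Num.floor (s * k.+1%:R))%:~R / k.+1%:R : R)
  (g ^~ z) _ (nbhs (s : R)) _ _ (cg z s)).
apply/cvgrPdist_le => e e0; near=> k.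
have k0 : 0 < k.+1%:R :> R by [].
have : `|s - (Num.floor (s * k.+1%:R))%:~R / k.+1%:R| <= k.+1%:R^-1.
  rewrite ger0_norm; last by rewrite subr_ge0 ler_pdivrMr// floor_le.
  rewrite lerBlDr -[X in _ <= X + _]div1r -mulrDl ler_pdivlMr// addrC.
  by have := floorD1_gt (s * k.+1%:R); rewrite intrD => /ltW.
move/le_trans; apply; rewrite -(invrK e) lef_pV2 ?posrE ?invr_gt0//.
apply: (@le_trans _ _ k%:R); last by rewrite ler_nat.
by near: k; exact: nbhs_infty_ger.
Unshelve. all: by end_near. Qed.

(** The substitution of [expR r] for [s] carries the half-line onto the real line, where
    [measurable_cont_param] applies. Heat kernels need this form, being continuous in time only at
    positive times. *)
Lemma measurable_cont_param_gt0 (g : R -> Z -> R) :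
  (forall s, measurable_fun setT (g s)) ->
  (forall z s, 0 < s -> {for s, continuous (g ^~ z)}) ->
  measurable_fun setT (fun sz : measurableTypeR R * Z =>
    if 0 < sz.1 then g sz.1 sz.2 else 0).
Proof.
move=> mg cg.
pose G s := g (expR s).
have mG : measurable_fun setT (fun sz : measurableTypeR R * Z => G sz.1 sz.2).
  apply: measurable_cont_param => [s|z s]; first exact: mg.
  apply: (@continuous_comp _ _ _ expR (g ^~ z)); first exact: continuous_expR.
  by apply: cg; exact: expR_gt0.
have -> : (fun sz : measurableTypeR R * Z => if 0 < sz.1 then g sz.1 sz.2 else 0) =
          (fun sz => if 0 < sz.1 then G (ln sz.1) sz.2 else 0).
  by apply/funext => -[s z] /=; case: ifPn => // s0; rewrite /G lnK.
apply: measurable_fun_ifT => //.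
  apply: (measurableT_comp (f := fun x : measurableTypeR R => 0 < x)) => //.
  exact: measurable_fun_ltr.
have mp : measurable_fun setT
    (fun t : measurableTypeR R * Z => (ln t.1 : measurableTypeR R, t.2)).
  apply/measurable_fun_pairP; split; last exact: measurable_snd.
  exact: (measurableT_comp (@measurable_ln R) measurable_fst).
exact: (measurableT_comp mG mp).
Qed.

End caratheodory_functions.

Section rV_measurability.
Context (R : realType).

Lemma rVunconsK n : cancel (@rVuncons R n) (@rVcons R n).
Proof.
move=> x; apply/rowP => i; case: (unliftP ord0 i) => [j ->|->].
  by rewrite rVconsS mxE.
by rewrite rVcons0.
Qed.

Lemma ball_rVcons n a b (x y : 'rV[R]_n) (e : R) :
  ball (a : R) e b -> ball x e y -> ball (rVcons (a, x)) e (rVcons (b, y)).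
Proof.
move=> ab [e0 xy]; split => // i j; rewrite (ord1 i).
case: (unliftP ord0 j) => [k ->|->]; first by rewrite !rVconsS; exact: xy.
by rewrite !rVcons0.
Qed.

Lemma continuous_rVcons1 n (x : 'rV[R]_n) : continuous (fun a : R => rVcons (a, x)).
Proof.
move=> a; apply/cvg_ballP => e e0; apply/nbhs_ballP; exists e => //= b ab.
by apply: ball_rVcons => //; exact: ballxx.
Qed.

Lemma continuous_rVcons2 n (a : R) : continuous (fun x : 'rV[R]_n => rVcons (a, x)).
Proof.
move=> x A /nbhs_ballP[e/= e0 eA]; apply/nbhs_ballP; exists e => //= y xy.
by apply: eA; apply: ball_rVcons => //; exact: ballxx.
Qed.

(** The sigma-algebra on row vectors is generated by the coordinates and not by the open sets,
    whence an induction on [n]: once the first coordinate is split off, the function is continuous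
    in it and, by induction, measurable in the others. *)
Lemma continuous_measurable_rV n (f : 'rV[R]_n -> R) :
  continuous f -> measurable_fun setT f.
Proof.
elim: n f => [|n IH] f cf.
  by rewrite (_ : f = cst (f 0))//; apply/funext => x; rewrite /= (thinmx0 x).
have -> : f = (fun z => f (rVcons (z.1, z.2))) \o @rVuncons R n.
  by apply/funext => x /=; rewrite -{1}(rVunconsK x).
apply: measurableT_comp; last exact: measurable_rVuncons.
apply: (measurable_cont_param (g := fun a x => f (rVcons (a, x)))).
- move=> a; apply: IH => x; apply: continuous_comp; first exact: continuous_rVcons2.
  exact: cf.
- move=> x a; apply: continuous_comp; first exact: continuous_rVcons1.
  exact: cf.
Qed.

Lemma measurable_rV_sub n d (T : measurableType d) (f g : T -> 'rV[R]_n) :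
  measurable_fun setT f -> measurable_fun setT g ->
  measurable_fun setT (fun x => f x - g x).
Proof.
move=> mf mg; apply: measurable_fun_rVP => i.
under eq_fun do rewrite !mxE.
by apply: measurable_funB; [exact: (measurableT_comp (measurable_coord i) mf)
                           |exact: (measurableT_comp (measurable_coord i) mg)].
Qed.

Lemma enorm_sqr n (x : 'rV[R]_n) : enorm x ^+ 2 = \sum_(i < n) x ord0 i ^+ 2.
Proof. by rewrite sqr_sqrtr// sumr_ge0// => i _; rewrite sqr_ge0. Qed.

Lemma measurable_enorm_sqr n : measurable_fun setT (fun x : 'rV[R]_n => enorm x ^+ 2).
Proof.
under eq_fun do rewrite enorm_sqr.
apply: measurable_sum => i.
by apply: measurable_funX; exact: measurable_coord.
Qed.

End rV_measurability.

(** * Reflection and translation invariance of Lebesgue measure on R^n *)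

Section lebesgue_invariance.
Context (R : realType).

Lemma ge0_integral_lebesgue_rVS n (F : 'rV[R]_n.+1 -> \bar R) :
  measurable_fun setT F -> (forall x, 0 <= F x)%E ->
  (\int[lebesgue_rV R n.+1]_x F x =
   \int[@lebesgue_measure R]_a \int[lebesgue_rV R n]_x F (rVcons (a, x)))%E.
Proof.
move=> mF F0; rewrite /= /lebesgue_rVS_fun ge0_integral_pushforward//; last exact: measurable_rVcons.
have mFc : measurable_fun setT (F \o @rVcons R n).
  by apply: measurableT_comp => //; exact: measurable_rVcons.
have Fc0 x : (0 <= (F \o @rVcons R n) x)%E by exact: F0.
have := @fubini_tonelli1 _ _ _ _ R (@lebesgue_measure R) (lebesgue_rV R n) _ mFc Fc0.
by rewrite preimage_setT.
Qed.

(** By uniqueness of Lebesgue measure it is enough to compare half-open intervals; reflection moves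
    the closed end to the other side. *)
Lemma lebesgue_measure_reflect (c : R) (A : set (measurableTypeR R)) :
  measurable A -> lebesgue_measure ((fun a => c - a) @^-1` A) = lebesgue_measure A.
Proof.
move=> mA.
have mf : measurable_fun setT (fun a : measurableTypeR R => c - a : measurableTypeR R).
  by apply: measurable_funB.
apply/esym; apply: (@lebesgue_measure_unique R (measure_function_pushforward__canonical__measure_function_Measure lebesgue_measure mf)) => //.
move=> _ [[a b] _ <-] /=; rewrite /pushforward.
rewrite (_ : _ @^-1` _ = `[c - b, c - a[%classic); last first.
  apply/seteqP; split => x /=; rewrite !in_itv/= => /andP[? ?]; apply/andP; split; lra.
rewrite !lebesgue_measure_itv/= !lte_fin.
have -> : (c - b < c - a) = (a < b) by apply/idP/idP; lra.
by case: ifP => // _; rewrite -!EFinD; congr (_%:E); lra.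
Qed.

End lebesgue_invariance.

Section lebesgue_invariance2.
Context (R : realType).

Lemma ge0_integral_reflect_1d (c : R) (F : measurableTypeR R -> \bar R) :
  measurable_fun setT F -> (forall x, 0 <= F x)%E ->
  (\int[@lebesgue_measure R]_a F (c - a)%R = \int[@lebesgue_measure R]_a F a)%E.
Proof.
move=> mF F0.
have mf : measurable_fun setT (fun a : measurableTypeR R => c - a : measurableTypeR R).
  by apply: measurable_funB.
rewrite [RHS](eq_measure_integral
  (measure_function_pushforward__canonical__measure_function_Measure lebesgue_measure mf)); last first.
  by move=> A mA _; rewrite -[LHS](lebesgue_measure_reflect c mA).
by rewrite ge0_integral_pushforward// preimage_setT.
Qed.

Lemma ge0_integral_rV_reflect n (c : 'rV[R]_n) (F : 'rV[R]_n -> \bar R) :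
  measurable_fun setT F -> (forall x, 0 <= F x)%E ->
  (\int[lebesgue_rV R n]_x F (c - x)%R = \int[lebesgue_rV R n]_x F x)%E.
Proof.
elim: n c F => [|n IH] c F mF F0.
  by apply: eq_integral => x _; rewrite (thinmx0 x) (thinmx0 (c - 0)).
have mFc : measurable_fun setT (fun x : 'rV[R]_n.+1 => F (c - x)%R).
  by apply: (measurableT_comp mF); exact: measurable_rV_sub.
rewrite [LHS](ge0_integral_lebesgue_rVS mFc (fun x => F0 _)) [RHS](ge0_integral_lebesgue_rVS mF F0).
have mG : measurable_fun setT (fun z : measurableTypeR R * 'rV[R]_n => F (rVcons (z.1, z.2))).
  apply: (measurableT_comp mF); under eq_fun do rewrite -surjective_pairing.
  exact: measurable_rVcons.
rewrite -[RHS](ge0_integral_reflect_1d (c ord0 ord0)); last 2 first.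
- exact: (measurable_integral_param (lebesgue_rV R n) (f := fun a x => F (rVcons (a, x)))).
- by move=> a; exact: integral_ge0.
apply: eq_integral => a _.
rewrite -[RHS](IH (\row_i c ord0 (lift ord0 i))); last 2 first.
- exact: (measurableT_comp mG (measurable_pair1 (c ord0 ord0 - a))).
- by move=> x; exact: F0.
apply: eq_integral => x _; congr F; apply/rowP => i.
rewrite mxE [X in _ + X = _]mxE; case: (unliftP ord0 i) => [j ->|->].
  by rewrite !rVconsS/= !mxE.
by rewrite !rVcons0.
Qed.

Lemma integral_rV_reflect n (c : 'rV[R]_n) (F : 'rV[R]_n -> \bar R) :
  measurable_fun setT F ->
  (\int[lebesgue_rV R n]_x F (c - x)%R = \int[lebesgue_rV R n]_x F x)%E.
Proof.
move=> mF; rewrite [LHS]integralE [RHS]integralE.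
rewrite -(ge0_integral_rV_reflect c (F := F^\+%E)) ?funepos_ge0//; last exact: measurable_funepos.
rewrite -(ge0_integral_rV_reflect c (F := F^\-%E)) ?funeneg_ge0//; last exact: measurable_funeneg.
by congr (_ - _)%E; apply: eq_integral => x _; rewrite ?funeposE ?funenegE.
Qed.

(** A translation is the composite of the two reflections [c - x] and [0 - x]. *)
Lemma integral_rV_translate n (c : 'rV[R]_n) (F : 'rV[R]_n -> \bar R) :
  measurable_fun setT F ->
  (\int[lebesgue_rV R n]_x F (x - c)%R = \int[lebesgue_rV R n]_x F x)%E.
Proof.
move=> mF.
have mG : measurable_fun setT (fun x : 'rV[R]_n => F (0 - x)%R).
  by apply: (measurableT_comp mF); exact: measurable_rV_sub.
rewrite -[RHS](integral_rV_reflect 0)// -(integral_rV_reflect c mG).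
by apply: eq_integral => x _; rewrite sub0r opprB.
Qed.

Lemma Rintegral_rV_reflect n (c : 'rV[R]_n) (F : 'rV[R]_n -> R) :
  measurable_fun setT F ->
  \int[lebesgue_rV R n]_x F (c - x) = \int[lebesgue_rV R n]_x F x.
Proof.
move=> mF; congr fine; apply: (integral_rV_reflect c (F := EFin \o F)).
exact/measurable_EFinP.
Qed.

End lebesgue_invariance2.

Section heat_kernel.
Context (R : realType).

Lemma heat_time n (t D : R) : @heat R n t D = heat (D * t) 1.
Proof. by apply/funext => x; rewrite /heat !mulr1 !mulrA. Qed.

Lemma heat_ge0 n (t D : R) (x : 'rV[R]_n) : 0 <= heat t D x.
Proof. by rewrite mulr_ge0 ?powR_ge0 ?expR_ge0. Qed.

Lemma heatN n (t D : R) (x : 'rV[R]_n) : heat t D (- x) = heat t D x.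
Proof.
suff e : enorm (- x) ^+ 2 = enorm x ^+ 2 by rewrite /heat e.
rewrite (enorm_sqr (- x)) (enorm_sqr x).
by apply: eq_bigr => i _; rewrite mxE sqrrN.
Qed.

Lemma enorm_sqr_rVcons n a (x : 'rV[R]_n) :
  enorm (rVcons (a, x)) ^+ 2 = a ^+ 2 + enorm x ^+ 2.
Proof.
rewrite enorm_sqr big_ord_recl rVcons0/= (enorm_sqr x); congr (_ + _).
by apply: eq_bigr => i _; rewrite rVconsS.
Qed.

(** Each further dimension contributes a centred normal density of variance [2 * t], so the mass of
    the heat kernel follows from that of the normal law by induction on [n]. *)
Lemma heat_rVcons n (t : R) a (x : 'rV[R]_n) : 0 < t ->
  heat t 1 (rVcons (a, x)) = normal_pdf 0 (Num.sqrt (2 * t)) a * heat t 1 x.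
Proof.
move=> t0; have t20 : 0 < 2 * t by rewrite mulr_gt0.
have pt0 : 0 < 4 * pi * t by rewrite !mulr_gt0// pi_gt0.
rewrite normal_pdfE ?gt_eqF ?sqrtr_gt0// /normal_peak /normal_fun.
rewrite sqr_sqrtr ?ltW// subr0 /heat !mulr1 enorm_sqr_rVcons.
rewrite (mulrDl (a ^+ 2)) opprD expRD [RHS]mulrACA.
have -> : 2 * t * pi *+ 2 = 4 * pi * t by ring.
rewrite -powR12_sqrt ?(ltW pt0)// -powRN -powRD; last by rewrite (gt_eqF pt0) implybT.
congr (_ `^ _ * (expR _ * _)); first by rewrite -[in LHS]natr1; field.
by rewrite mulNr; congr (- (_ / _)); ring.
Qed.

Lemma measurable_heat1 n (t : R) : measurable_fun setT (fun x : 'rV[R]_n => heat t 1 x).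
Proof.
apply: measurable_funM => //.
apply: (measurableT_comp (@measurable_expR R)).
by apply: measurable_funN; apply: measurable_funM => //; exact: measurable_enorm_sqr.
Qed.

Lemma integral_heat n (t : R) : 0 < t ->
  (\int[lebesgue_rV R n]_x (heat t 1 x)%:E = 1)%E.
Proof.
move=> t0; elim: n => [|n IH].
  rewrite [LHS]integral_dirac//; last by apply/measurable_EFinP; exact: measurable_heat1.
  rewrite diracE mem_set// mul1e /heat /enorm big_ord0 sqrtr0.
  by rewrite mul0r oppr0 powRr0 expr0n/= mul0r oppr0 expR0 mulr1.
rewrite [LHS]ge0_integral_lebesgue_rVS; last 2 first.
- by apply/measurable_EFinP; exact: measurable_heat1.
- by move=> x; rewrite lee_fin heat_ge0.
rewrite -[RHS](integral_normal_pdf 0 (Num.sqrt (2 * t))).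
apply: eq_integral => a _.
under eq_integral do rewrite heat_rVcons// EFinM.
rewrite ge0_integralZl//; last 3 first.
- by apply/measurable_EFinP; exact: measurable_heat1.
- by move=> x _; rewrite lee_fin heat_ge0.
- by rewrite lee_fin normal_pdf_ge0.
by rewrite IH mule1.
Qed.

(** Completion of the square, that is, the semigroup law before integration: as a function of [y]
    the product is a Gaussian centred at [t / (s + t) *: x], with reduced time [s * t / (s + t)]. *)
Lemma heat_mul n (s t : R) (x y : 'rV[R]_n) : 0 < s -> 0 < t ->
  heat s 1 (x - y) * heat t 1 y =
  heat (s + t) 1 x * heat (s * t / (s + t)) 1 (y - (t / (s + t)) *: x).
Proof.
move=> s0 t0; have st0 : 0 < s + t by exact: addr_gt0.
have q0 : 0 < s * t / (s + t) by rewrite divr_gt0// mulr_gt0.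
have pi0 : 0 < pi :> R by exact: pi_gt0.
rewrite /heat !mulr1 mulrACA [RHS]mulrACA; congr (_ * _).
  have p4 (r : R) : 0 < r -> 0 <= 4 * pi * r.
    by move=> r0; apply: mulr_ge0; [apply: mulr_ge0; rewrite // ltW|exact: ltW].
  rewrite -[LHS]powRM ?p4// -[RHS]powRM ?p4//.
  by congr (_ `^ _); field; rewrite gt_eqF.
rewrite -!expRD; congr expR.
rewrite (enorm_sqr (x - y)) (enorm_sqr y) (enorm_sqr x) (enorm_sqr (y - _)).
rewrite -!opprD; congr (- _).
rewrite !mulr_suml -!big_split/=; apply: eq_bigr => i _; rewrite !mxE.
by field; rewrite !gt_eqF.
Qed.

Lemma continuous_heat_time n (x : 'rV[R]_n) (t : R) : 0 < t ->
  {for t, continuous (fun t => heat t 1 x)}.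
Proof.
move=> t0; apply: continuousM.
  apply: (@continuous_comp _ _ _ (fun t => 4 * pi * 1 * t) (fun a => a `^ _)).
    by apply: continuousM; [exact: cst_continuous|exact: cvg_id].
  have c0 : 0 < 4 * pi * 1 * t by rewrite !mulr_gt0 ?pi_gt0.
  apply: differentiable_continuous; apply/derivable1_diffP.
  by apply: derivable_powR; rewrite in_itv/= andbT.
apply: (@continuous_comp _ _ _ (fun s : R => - (enorm x ^+ 2 / (4 * 1 * s)) : R) (@expR R)); last exact: continuous_expR.
apply: continuousN; apply: continuousM; first exact: cst_continuous.
apply: continuousV; first by rewrite !mulf_neq0 ?gt_eqF.
by apply: continuousM; [exact: cst_continuous|exact: cvg_id].
Qed.

End heat_kernel.

Section dominated_swap.
Context d1 d2 (Z1 : measurableType d1) (Z2 : measurableType d2) (R : realType).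
Variables (m1 : {sigma_finite_measure set Z1 -> \bar R})
          (m2 : {sigma_finite_measure set Z2 -> \bar R}).

(** The form in which integrability on a product is usually checked below: an integrable weight in
    one variable times a kernel whose mass in the other is uniformly bounded. *)
Lemma dominated_integral_lty (f k : Z1 -> Z2 -> R) (w : Z1 -> R) (C : R) :
  measurable_fun setT (fun z => f z.1 z.2) ->
  measurable_fun setT (fun z => k z.1 z.2) ->
  m1.-integrable setT (EFin \o w) -> (forall z, 0 <= w z) ->
  (forall z y, 0 <= k z y) -> (forall z, \int[m2]_y (k z y)%:E <= C%:E)%E ->
  (forall z y, `|f z y| <= w z * k z y) ->
  (\int[m1]_x \int[m2]_y `|f x y|%:E < +oo)%E.
Proof.
move=> mf mk iw w0 k0 kC fwk.
have [mw woo] := integrableP _ _ _ iw.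
have C0 (z : Z1) : (0 <= C%:E)%E.
  by apply: le_trans (kC z); apply: integral_ge0 => y _; rewrite lee_fin.
apply: (@le_lt_trans _ _ (\int[m1]_x (C%:E * (w x)%:E)))%E.
  apply: ge0_le_integral => //.
  - by move=> x _; apply: integral_ge0 => y _; rewrite lee_fin.
  - apply: (measurable_integral_param m2 (f := fun x y => `|f x y|%:E)).
    by apply/measurable_EFinP; exact: measurableT_comp.
  - by apply: emeasurable_funM.
  - move=> x _; rewrite muleC.
    apply: (@le_trans _ _ (\int[m2]_y ((w x)%:E * (k x y)%:E))%E).
      apply: ge0_le_integral => //.
      + by apply/measurable_EFinP; apply: measurableT_comp => //; exact: measurable_section1.
      + by apply: emeasurable_funM => //; apply/measurable_EFinP; exact: measurable_section1.
      + by move=> y _; rewrite -EFinM lee_fin.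
    rewrite ge0_integralZl//.
    + by apply: lee_wpmul2l; rewrite ?lee_fin.
    + by apply/measurable_EFinP; exact: measurable_section1.
    + by move=> y _; rewrite lee_fin.
    + by rewrite lee_fin.
(* The sign of [C] is read off from the bound at some point of [Z1], whence a separate case for an
   empty [Z1]. *)
have [z0|nZ] := pselect (exists z : Z1, True).
  case: z0 => z _; rewrite ge0_integralZl//; last 2 first.
  - by move=> x _; rewrite lee_fin.
  - exact: (C0 z).
  apply: lte_mul_pinfty => //; first exact: (C0 z).
  rewrite (_ : (\int[m1]_x (w x)%:E)%E = (\int[m1]_x `|(EFin \o w) x|)%E)//.
  by apply: eq_integral => x _; rewrite /= ger0_norm.
rewrite (_ : [set: Z1] = set0) ?integral_set0//.
by apply/seteqP; split => // x _; case: nZ; exists x.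
Qed.

Lemma dominated_Rintegral_swap (f k : Z1 -> Z2 -> R) (w : Z1 -> R) (C : R) :
  measurable_fun setT (fun z => f z.1 z.2) ->
  measurable_fun setT (fun z => k z.1 z.2) ->
  m1.-integrable setT (EFin \o w) -> (forall z, 0 <= w z) ->
  (forall z y, 0 <= k z y) -> (forall z, \int[m2]_y (k z y)%:E <= C%:E)%E ->
  (forall z y, `|f z y| <= w z * k z y) ->
  \int[m1]_x \int[m2]_y f x y = \int[m2]_y \int[m1]_x f x y.
Proof.
move=> mf mk iw w0 k0 kC fwk; apply: Rintegral_swap => //.
exact: (dominated_integral_lty (k := k) (w := w) (C := C)).
Qed.

End dominated_swap.

Section bounded_weight.
Context d (Z : measurableType d) (R : realType) (m : {measure set Z -> \bar R}).

Lemma integrable_weight_bounded (w g : Z -> R) (B : R) :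
  m.-integrable setT (EFin \o w) -> measurable_fun setT g ->
  (forall z, `|g z| <= B) -> m.-integrable setT (EFin \o (fun z => w z * g z)).
Proof.
move=> iw mg gB; apply: (le_integrable measurableT (g := fun z => (B%:E * (w z)%:E)%E)).
- apply/measurable_EFinP; apply: measurable_funM => //.
  by apply/measurable_EFinP; exact: (measurable_int _ iw).
- move=> z _; rewrite -EFinM lee_fin mulrC !normrM ler_wpM2r//.
  by apply: le_trans (gB z) _; exact: ler_norm.
- exact: integrableZl.
Qed.

Lemma Rintegral_weight_bound (w g : Z -> R) (B C : R) :
  measurable_fun setT w -> measurable_fun setT g ->
  0 <= B -> (forall z, `|g z| <= B) -> (\int[m]_z `|w z|%:E <= C%:E)%E ->
  `|\int[m]_z (w z * g z)| <= C * B.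
Proof.
move=> mw mg B0 gB wC; rewrite -lee_fin.
apply: le_trans (le_abse_Rintegral _ _) _; first exact: measurable_funM.
apply: (@le_trans _ _ (\int[m]_z (B%:E * `|w z|%:E))%E).
  apply: ge0_le_integral => //.
  - by apply/measurable_EFinP; apply: measurableT_comp => //; exact: measurable_funM.
  - by apply: emeasurable_funM => //; apply/measurable_EFinP; exact: measurableT_comp.
  - by move=> z _; rewrite -EFinM lee_fin normrM mulrC ler_wpM2r.
rewrite ge0_integralZl//; first by rewrite muleC EFinM; apply: lee_wpmul2r; rewrite ?lee_fin.
by apply/measurable_EFinP; exact: measurableT_comp.
Qed.

End bounded_weight.

Lemma continuous_powR_gt0 (R : realType) (a x : R) : 0 < x ->
  {for x, continuous (fun y => y `^ a)}.
Proof.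
move=> x0; apply: differentiable_continuous; apply/derivable1_diffP.
by apply: derivable_powR; rewrite in_itv/= andbT.
Qed.

(** * The heat semigroup on bounded measurable functions *)

Section heat_semigroup.
Context (R : realType) (n : nat).
Local Notation E := ('rV[R]_n).
Local Notation mu := (lebesgue_rV R n).
Local Notation M := (measurableTypeR R).

(* Cutting the kernel off at nonpositive times makes it jointly measurable and
   bounded in L^1 without side conditions. *)
Definition hk (t : R) (x : E) : R := if 0 < t then heat t 1 x else 0.

Definition hop (t : R) (g : E -> R) (x : E) : R := convolution (hk t) g x.

Lemma hk_ge0 t x : 0 <= hk t x.
Proof. by rewrite /hk; case: ifP => // _; exact: heat_ge0. Qed.

Lemma hkN t x : hk t (- x) = hk t x.
Proof. by rewrite /hk heatN. Qed.

(** At time 0 the heat formula contains zero raised to the power [- n / 2]; this exponent is nonzero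
    in positive dimension, so the formula gives 0, which is the cut-off value. *)
Lemma heat_hk (t D : R) : (0 < n)%N -> 0 < D -> 0 <= t -> heat t D = hk (D * t) :> (E -> R).
Proof.
move=> n0 D0 t0; rewrite heat_time /hk; apply/funext => x.
rewrite pmulr_rgt0//; case: ifPn => //; rewrite -leNgt => t0'.
have -> : t = 0 by apply/eqP; rewrite eq_le t0 t0'.
rewrite /heat !mulr0 powR0 ?mul0r// oppr_eq0 mulf_neq0// ?invr_eq0 ?pnatr_eq0//.
by rewrite -lt0n.
Qed.

Lemma measurable_hk : measurable_fun setT (fun z : M * E => hk z.1 z.2).
Proof.
apply: (measurable_cont_param_gt0 (g := fun t x => heat t 1 x)).
  exact: measurable_heat1.
by move=> x t t0; exact: continuous_heat_time.
Qed.

Lemma measurable_hk_comp d (Z : measurableType d) (t : Z -> R) (x : Z -> E) :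
  measurable_fun setT t -> measurable_fun setT x ->
  measurable_fun setT (fun z => hk (t z) (x z)).
Proof.
move=> mt mx.
have mp : measurable_fun setT (fun z => (t z : M, x z)) by apply/measurable_fun_pairP.
exact: (measurableT_comp measurable_hk mp).
Qed.

Lemma integral_hk t : 0 < t -> (\int[mu]_x (hk t x)%:E = 1)%E.
Proof. by move=> t0; rewrite /hk t0; exact: integral_heat. Qed.

Lemma integral_hk_le1 t : (\int[mu]_x (hk t x)%:E <= 1)%E.
Proof.
have [/integral_hk->//|t0] := boolP (0 < t).
by rewrite /hk (negbTE t0) integral0.
Qed.

Lemma integral_hk_sub_le1 t x : (\int[mu]_y (hk t (x - y))%:E <= 1)%E.
Proof.
rewrite (integral_rV_reflect x (F := fun y => (hk t y)%:E)) ?integral_hk_le1//.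
by apply/measurable_EFinP; exact: measurable_hk_comp.
Qed.

Lemma integrable_hk_sub t x : mu.-integrable setT (EFin \o (fun y => hk t (x - y))).
Proof.
apply/integrableP; split.
  apply/measurable_EFinP; apply: measurable_hk_comp => //.
  exact: measurable_rV_sub.
under eq_integral do rewrite /= ger0_norm ?hk_ge0//.
by apply: le_lt_trans (integral_hk_sub_le1 t x) _; rewrite ltry.
Qed.

Lemma measurable_hop d (Z : measurableType d) (t : Z -> R) (g : Z -> E -> R) (x : Z -> E) :
  measurable_fun setT t -> measurable_fun setT (fun z => g z.1 z.2) ->
  measurable_fun setT x ->
  measurable_fun setT (fun z => hop (t z) (g z) (x z)).
Proof.
move=> mt mg mx.
apply: (measurable_Rintegral_param mu (f := fun z y => hk (t z) (x z - y) * g z y)).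
apply: measurable_funM => //; apply: measurable_hk_comp.
  exact: (measurableT_comp mt measurable_fst).
apply: measurable_rV_sub; last exact: measurable_snd.
exact: (measurableT_comp mx measurable_fst).
Qed.

Lemma measurable_hop1 t (g : E -> R) : measurable_fun setT g -> measurable_fun setT (hop t g).
Proof.
move=> mg; apply: (measurable_hop (g := fun=> g)) => //.
exact: (measurableT_comp mg measurable_snd).
Qed.

Lemma hop_bound t (g : E -> R) (B : R) x : measurable_fun setT g ->
  (forall y, `|g y| <= B) -> `|hop t g x| <= B.
Proof.
move=> mg gB; rewrite -[leRHS]mul1r; apply: Rintegral_weight_bound => //.
- by apply: measurable_hk_comp => //; exact: measurable_rV_sub.
- exact: le_trans (gB x).
- under eq_integral do rewrite ger0_norm ?hk_ge0//.
  exact: integral_hk_sub_le1.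
Qed.

Lemma integrable_hop t (g : E -> R) (B : R) x : measurable_fun setT g ->
  (forall y, `|g y| <= B) ->
  mu.-integrable setT (EFin \o (fun y => hk t (x - y) * g y)).
Proof.
by move=> mg gB; exact: (integrable_weight_bounded (integrable_hk_sub t x) mg gB).
Qed.

Lemma hk_semigroup s t (x : E) : 0 < s -> 0 < t ->
  \int[mu]_y (hk s (x - y) * hk t y) = hk (s + t) x.
Proof.
move=> s0 t0; rewrite /hk s0 t0 addr_gt0//.
under eq_Rintegral do rewrite heat_mul//.
rewrite RintegralZl//; last first.
  have := integrable_hk_sub (s * t / (s + t)) ((t / (s + t)) *: x).
  apply: eq_integrable => // y _ /=; rewrite -hkN opprB /hk ifT//.
  by rewrite divr_gt0 ?addr_gt0 ?mulr_gt0.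
rewrite -[RHS]mulr1; congr (_ * _).
rewrite /Rintegral (integral_rV_translate _ (F := fun y => (heat (s * t / (s + t)) 1 y)%:E)).
  by rewrite integral_heat// divr_gt0 ?addr_gt0 ?mulr_gt0.
by apply/measurable_EFinP; exact: measurable_heat1.
Qed.

Lemma hop_hop s t (g : E -> R) (B : R) x : 0 < s -> 0 < t ->
  measurable_fun setT g -> (forall y, `|g y| <= B) ->
  hop s (hop t g) x = hop (s + t) g x.
Proof.
move=> s0 t0 mg gB; rewrite /hop /convolution.
have B0 : 0 <= B by exact: le_trans (gB 0).
have m1 : measurable_fun setT (fun y : E => hk s (x - y)).
  by apply: measurable_hk_comp => //; exact: measurable_rV_sub.
have m2 : measurable_fun setT (fun z : E * E => hk t (z.1 - z.2)).
  by apply: measurable_hk_comp => //; apply: measurable_rV_sub;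
    [exact: measurable_fst|exact: measurable_snd].
transitivity (\int[mu]_y \int[mu]_z (hk s (x - y) * (hk t (y - z) * g z))).
  apply: eq_Rintegral => y _; rewrite RintegralZl//.
  exact: integrable_hop gB.
rewrite (dominated_Rintegral_swap (k := fun y z : E => hk t (y - z))
   (w := fun y : E => B * hk s (x - y)) (C := 1)).
- apply: eq_Rintegral => z _.
  (* Centring the inner variable at [z] exhibits the convolution of two heat kernels, evaluated at
     [x - z]. *)
  transitivity (\int[mu]_y (hk s (x - z - (y - z)) * hk t (y - z) * g z)).
    apply: eq_Rintegral => y _; rewrite mulrA.
    by have -> : x - z - (y - z) = x - y by rewrite opprB addrA subrK.
  have mh : measurable_fun setT (fun y : E => hk s (x - z - y) * hk t y * g z).
    apply: measurable_funM => //; apply: measurable_funM.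
      by apply: measurable_hk_comp => //; exact: measurable_rV_sub.
    exact: measurable_hk_comp.
  rewrite /Rintegral (integral_rV_translate z (F := fun y => (hk s (x - z - y) * hk t y * g z)%:E)).
    rewrite -/(Rintegral mu setT (fun y : E => hk s (x - z - y) * hk t y * g z)).
    rewrite RintegralZr ?hk_semigroup//.
    apply: (integrable_weight_bounded (B := (4 * pi * t) `^ (- (n%:R / 2))) (integrable_hk_sub _ _)).
      exact: measurable_hk_comp.
    move=> y; rewrite ger0_norm ?hk_ge0// /hk t0 /heat mulr1 -[leRHS]mulr1.
    rewrite ler_wpM2l ?powR_ge0// -expR0 ler_expR oppr_le0 divr_ge0 ?sqr_ge0// !mulr_ge0//.
    exact: ltW.
  exact/measurable_EFinP.
- apply: measurable_funM; first exact: (measurableT_comp m1 measurable_fst).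
  apply: measurable_funM => //; exact: (measurableT_comp mg measurable_snd).
- exact: m2.
- by have := integrableZl measurableT B (integrable_hk_sub s x); apply: eq_integrable.
- by move=> z; rewrite mulr_ge0 ?hk_ge0.
- by move=> y z; exact: hk_ge0.
- by move=> y; exact: integral_hk_sub_le1.
- move=> y z; rewrite normrM (ger0_norm (hk_ge0 _ _)) normrM (ger0_norm (hk_ge0 _ _)).
  rewrite (mulrC B) -mulrA (mulrC B).
  by apply: ler_wpM2l; rewrite ?hk_ge0//; apply: ler_wpM2l; rewrite ?hk_ge0.
Qed.

(** The factor is exactly the ratio of the two normalising constants; the remaining exponential
    increases with time. *)
Lemma heat_time_le t0 t (x : E) : 0 < t0 -> t0 <= t ->
  (t0 / t) `^ (n%:R / 2) * heat t0 1 x <= heat t 1 x.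
Proof.
move=> t00 t0t; have t_0 : 0 < t by exact: lt_le_trans t0t.
have p0 : 0 < 4 * pi :> R by rewrite mulr_gt0// pi_gt0.
rewrite /heat !mulr1 mulrA.
have -> : (t0 / t) `^ (n%:R / 2) * (4 * pi * t0) `^ (- (n%:R / 2)) = (4 * pi * t) `^ (- (n%:R / 2)).
  have pr (r : R) : 0 < r -> (4 * pi * r) `^ (- (n%:R / 2)) = (4 * pi) `^ (- (n%:R / 2)) * r `^ (- (n%:R / 2)).
    by move=> r0; rewrite powRM// ltW.
  rewrite !pr// mulrCA; congr (_ * _).
  rewrite powRM ?invr_ge0 ?ltW// mulrAC -powRD; last by rewrite (gt_eqF t00) implybT.
  by rewrite subrr powRr0 mul1r -(powR_inv1 (ltW t_0)) -powRrM mulN1r.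
rewrite ler_wpM2l ?powR_ge0// ler_expR lerN2 ler_wpM2l ?sqr_ge0//.
by rewrite lef_pV2 ?posrE ?mulr_gt0// ler_wpM2l.
Qed.

(** With [c] the ratio of [heat_time_le], the difference of the two kernels is at most
    [(hk t - c hk t0) + (1 - c) hk t0], a sum of two nonnegative functions of mass [1 - c] each. In
    the proof [c] is added to both sides, which avoids subtracting extended integrals. *)
Lemma hk_L1_dist t0 t : 0 < t0 -> t0 <= t ->
  (\int[mu]_x `|hk t x - hk t0 x|%:E <= (2 * (1 - (t0 / t) `^ (n%:R / 2)))%:E)%E.
Proof.
move=> t00 t0t; have t_0 : 0 < t by exact: lt_le_trans t0t.
set c := (t0 / t) `^ _.
have c0 : 0 <= c by exact: powR_ge0.
have c1 : c <= 1.
  apply: (@le_trans _ _ (1 `^ (n%:R / 2))); last by rewrite powR1.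
  apply: ge0_ler_powR => //.
  - by rewrite nnegrE divr_ge0// ltW.
  - by rewrite nnegrE.
  - by rewrite ler_pdivrMr// mul1r.
have mh s : measurable_fun setT (fun x : E => (hk s x)%:E).
  by apply/measurable_EFinP; exact: measurable_hk_comp.
rewrite -(leeD2rE (x := c%:E))//.
have := integral_hk t00; have := integral_hk t_0 => It It0.
apply: (@le_trans _ _ (\int[mu]_x ((hk t x)%:E + (1 - c)%:E * (hk t0 x)%:E))%E).
  have -> : (\int[mu]_x `|hk t x - hk t0 x|%:E + c%:E =
     \int[mu]_x (`|hk t x - hk t0 x|%:E + c%:E * (hk t0 x)%:E))%E.
    rewrite ge0_integralD//.
    - rewrite ge0_integralZl//.
      + by rewrite It0 mule1.
      + by move=> x _; rewrite lee_fin hk_ge0.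
    - apply/measurable_EFinP; apply: measurableT_comp => //.
      by apply: measurable_funB; exact: measurable_hk_comp.
    - by move=> x _; rewrite -EFinM lee_fin mulr_ge0 ?hk_ge0.
    - exact: emeasurable_funM.
  apply: ge0_le_integral => //.
  - by move=> x _; rewrite -EFinM -EFinD lee_fin addr_ge0// mulr_ge0 ?hk_ge0.
  - apply: emeasurable_funD; last exact: emeasurable_funM.
    apply/measurable_EFinP; apply: measurableT_comp => //.
    by apply: measurable_funB; exact: measurable_hk_comp.
  - by apply: emeasurable_funD => //; exact: emeasurable_funM.
  - move=> x _; rewrite -!EFinM -!EFinD lee_fin -lerBrDr.
    have : c * hk t0 x <= hk t x by rewrite /hk t00 t_0 heat_time_le.
    have : 0 <= (1 - c) * hk t0 x by rewrite mulr_ge0 ?hk_ge0// subr_ge0.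
    have := hk_ge0 t0 x.
    by move=> ? ? ?; rewrite ler_norml; apply/andP; split; nra.
rewrite ge0_integralD//.
- rewrite ge0_integralZl//.
  + by rewrite It It0 mule1 -!EFinD lee_fin; nra.
  + by move=> x _; rewrite lee_fin hk_ge0.
  + by rewrite lee_fin subr_ge0.
- by move=> x _; rewrite lee_fin hk_ge0.
- by move=> x _; rewrite -EFinM lee_fin mulr_ge0 ?hk_ge0// subr_ge0.
- exact: emeasurable_funM.
Qed.

Lemma hk_L1_sub t0 t x : (\int[mu]_y `|hk t (x - y) - hk t0 (x - y)|%:E =
   \int[mu]_y `|hk t y - hk t0 y|%:E)%E.
Proof.
rewrite (integral_rV_reflect x (F := fun y => `|hk t y - hk t0 y|%:E))//.
apply/measurable_EFinP; apply: measurableT_comp => //.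
by apply: measurable_funB; exact: measurable_hk_comp.
Qed.

Lemma hop_time_dist t0 t (g : E -> R) (B : R) x : 0 < t0 -> t0 <= t ->
  measurable_fun setT g -> (forall y, `|g y| <= B) ->
  `|hop t g x - hop t0 g x| <= 2 * (1 - (t0 / t) `^ (n%:R / 2)) * B.
Proof.
move=> t00 t0t mg gB; rewrite /hop /convolution -RintegralB//; last 2 first.
- exact: integrable_hop gB.
- exact: integrable_hop gB.
under eq_Rintegral do rewrite -mulrBl.
apply: Rintegral_weight_bound => //.
- by apply: measurable_funB; apply: measurable_hk_comp => //; exact: measurable_rV_sub.
- exact: le_trans (gB x).
- by rewrite hk_L1_sub hk_L1_dist.
Qed.

(** [hop_time_dist] starts from the earlier of two times, whence the two moduli [c1] and [c2]. The
    continuity comes from the kernel in L^1, so [g] may be merely bounded; it is what makes the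
    fundamental theorem of calculus available in the heat time. *)
Lemma continuous_hop_time (g : E -> R) (B : R) x t : 0 < t ->
  measurable_fun setT g -> (forall y, `|g y| <= B) ->
  {for t, continuous (fun t => hop t g x)}.
Proof.
move=> t_0 mg gB; have B0 : 0 <= B by exact: le_trans (gB 0).
set a : R := n%:R / 2.
pose c1 (s : R) := 2 * (1 - (t / s) `^ a) * B.
pose c2 (s : R) := 2 * (1 - (s / t) `^ a) * B.
have tt1 : t / t = 1 by rewrite divff// gt_eqF.
have c1t : c1 t = 0 by rewrite /c1 tt1 powR1 subrr mulr0 mul0r.
have c2t : c2 t = 0 by rewrite /c2 tt1 powR1 subrr mulr0 mul0r.
have cvgc (r : R -> R) : r s @[s --> t] --> (1 : R) ->
    2 * (1 - r s `^ a) * B @[s --> t] --> (0 : R).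
  move=> r1; rewrite -[X in _ --> X](_ : 2 * (1 - 1 `^ a) * B = 0); last first.
    by rewrite powR1 subrr mulr0 mul0r.
  apply: cvgM; last exact: cvg_cst.
  apply: cvgM; first exact: cvg_cst.
  apply: cvgB; first exact: cvg_cst.
  apply: (@cvg_comp _ _ _ r (fun x => x `^ a) _ (nbhs (1 : R))) => //.
  exact: continuous_powR_gt0.
have cc1 : c1 s @[s --> t] --> (0 : R).
  apply: cvgc; rewrite -tt1; apply: cvgM; first exact: cvg_cst.
  by apply: cvgV; [rewrite gt_eqF|exact: cvg_id].
have cc2 : c2 s @[s --> t] --> (0 : R).
  by apply: cvgc; rewrite -tt1; apply: cvgM; [exact: cvg_id|exact: cvg_cst].
apply/cvgrPdist_le => e e0.
have /cvgrPdist_le/(_ e e0) n1 := cc1.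
have /cvgrPdist_le/(_ e e0) n2 := cc2.
near=> s.
have s0 : 0 < s by near: s; exact: (cvgr_gt t cvg_id).
have [ts|/ltW st] := leP t s.
  rewrite distrC; apply: le_trans (hop_time_dist x t_0 ts mg gB) _.
  apply: le_trans (ler_norm _) _; rewrite -normrN -sub0r.
  by near: s; exact: n1.
apply: le_trans (hop_time_dist x s0 st mg gB) _.
apply: le_trans (ler_norm _) _; rewrite -normrN -sub0r.
by near: s; exact: n2.
Unshelve. all: by end_near. Qed.

End heat_semigroup.

(** * Green functions as mixtures of heat kernels *)

Section exponential_substitution.
Context (R : realType).
Local Notation leb := (@lebesgue_measure R).

(** The divergent case is included: [fine] sends an infinite integral to 0, and likewise its
    multiple by a nonzero [c]. It occurs for Green functions, whose integral over heat times may
    diverge at the origin. *)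
Lemma ge0_Rintegral_scale d (Z : measurableType d) (m : {measure set Z -> \bar R})
    (f : Z -> R) (c : R) :
  measurable_fun setT f -> (forall z, 0 <= f z) ->
  \int[m]_z (f z * c) = (\int[m]_z f z) * c.
Proof.
move=> mf f0; rewrite /Rintegral.
have mF : measurable_fun setT (EFin \o f) by exact/measurable_EFinP.
have pos b : 0 <= b -> fine (\int[m]_z (f z * b)%:E) = fine (\int[m]_z (f z)%:E) * b.
  move=> b0; under eq_integral do rewrite mulrC EFinM.
  rewrite ge0_integralZl//; last by move=> z _; rewrite lee_fin.
  have : (0 <= \int[m]_z (f z)%:E)%E by apply: integral_ge0 => z _; rewrite lee_fin.
  case: (\int[m]_z (f z)%:E)%E => [r _|_|//] /=; first by rewrite mulrC.
  rewrite mul0r; move: b0; rewrite le_eqVlt => /predU1P[<-|b0]; first by rewrite mul0e.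
  by rewrite gt0_muley.
have [c0|c0] := leP 0 c; first exact: pos.
have nc0 : 0 <= - c by rewrite oppr_ge0 ltW.
rewrite -[c]opprK mulrN -pos// -fineN; congr fine.
rewrite -integral_ge0N; last by move=> z _; rewrite lee_fin mulr_ge0.
by apply: eq_integral => z _; rewrite -EFinN mulrN.
Qed.

Lemma derive_cexp (c s : R) : is_derive s 1 (fun s => c * expR s) (c * expR s).
Proof.
exact: (@is_deriveZ R _ _ (@expR R) c s 1 _ (is_derive_expR s)).
Qed.

(** Change of variable on the compact intervals [[c exp(-k), c exp(k)]] and [[-k, k]], then monotone
    convergence on both sides. *)
Lemma ge0_integral_exp_subst (G : R -> R) (c : R) : 0 < c ->
  (forall t, 0 < t -> 0 <= G t) -> (forall t, 0 < t -> {for t, continuous G}) ->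
  measurable_fun setT G ->
  (\int[leb]_(t in `]0%R, +oo[) (G t)%:E =
   \int[leb]_s (G (c * expR s) * (c * expR s))%:E)%E.
Proof.
move=> c0 G0 cG mG.
pose I (k : nat) : set R := `[c * expR (- k%:R), c * expR k%:R]%classic.
pose J (k : nat) : set R := `[- k%:R, k%:R]%classic.
have UI : \bigcup_k I k = `]0, +oo[%classic.
  apply/seteqP; split => x /=.
    move=> [k _]; rewrite /I/= !in_itv/= andbT => /andP[+ _].
    by apply: lt_le_trans; rewrite mulr_gt0 ?expR_gt0.
  rewrite in_itv/= andbT => x0.
  exists (Num.truncn `|ln (x / c)|).+1 => //; rewrite /I/= in_itv/=.
  have : `|ln (x / c)| <= (Num.truncn `|ln (x / c)|).+1%:R by rewrite ltW// truncnS_gt.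
  rewrite ler_norml => /andP[l1 l2].
  have xE : x = c * expR (ln (x / c)).
    by rewrite lnK ?posrE ?divr_gt0// mulrC divfK// gt_eqF.
  by rewrite [X in _ <= X <= _]xE !ler_pM2l// !ler_expR l1 l2.
have UJ : \bigcup_k J k = setT.
  apply/seteqP; split => x //= _.
  exists (Num.truncn `|x|).+1 => //; rewrite /J/= in_itv/= -ler_norml ltW//.
  by rewrite truncnS_gt.
have IJ k : (\int[leb]_(t in I k) (G t)%:E =
    \int[leb]_(s in J k) (G (c * expR s) * (c * expR s))%:E)%E.
  have dF : (fun s => c * expR s)^`()%classic = (fun s => c * expR s).
    by apply/funext => s; rewrite derive1E; have [] := derive_cexp c s.
  have cF : continuous (fun s : R => c * expR s).
    by move=> s; apply: continuousM; [exact: cst_continuous|exact: continuous_expR].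
  rewrite /I (@integration_by_substitution_increasing R (fun s => c * expR s) G).
  - by rewrite dF.
  - by rewrite (le_trans _ (ler0n _ _))// oppr_le0.
  - by move=> x y _ _ xy; rewrite ltr_pM2l// ltr_expR.
  - by rewrite dF => x _; exact: cF.
  - by rewrite dF; apply/cvg_ex; exists (c * expR (- k%:R)); apply: cvg_at_right_filter; exact: cF.
  - by rewrite dF; apply/cvg_ex; exists (c * expR k%:R); apply: cvg_at_left_filter; exact: cF.
  - split.
    + by move=> x _; have [] := derive_cexp c x.
    + by apply: cvg_at_right_filter; exact: cF.
    + by apply: cvg_at_left_filter; exact: cF.
  - apply: continuous_in_subspaceT => x; rewrite inE/= in_itv/= => /andP[cx _].
    by apply: cG; apply: lt_le_trans cx; rewrite mulr_gt0 ?expR_gt0.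
have HI : (\int[leb]_(t in I k) (G t)%:E)%E @[k --> \oo] -->
    (\int[leb]_(t in `]0%R, +oo[) (G t)%:E)%E.
  rewrite -UI; apply: ge0_nondecreasing_set_cvg_integral.
  - move=> i j ij; apply/subsetPset => x; rewrite /I/= !in_itv/= => /andP[xi ix].
    have ijR : i%:R <= j%:R :> R by rewrite ler_nat.
    rewrite (le_trans _ xi) ?(le_trans ix)//.
      by rewrite ler_pM2l// ler_expR.
    by rewrite ler_pM2l// ler_expR lerN2.
  - by move=> i; exact: measurable_itv.
  - by move=> i; apply: measurable_funTS; exact/measurable_EFinP.
  - move=> i x; rewrite /I/= in_itv/= => /andP[xi _]; rewrite lee_fin G0//.
    by apply: lt_le_trans xi; rewrite mulr_gt0 ?expR_gt0.
have HJ : (\int[leb]_(s in J k) (G (c * expR s) * (c * expR s))%:E)%E @[k --> \oo] -->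
    (\int[leb]_s (G (c * expR s) * (c * expR s))%:E)%E.
  rewrite -UJ; apply: ge0_nondecreasing_set_cvg_integral.
  - move=> i j ij; apply/subsetPset => x; rewrite /J/= !in_itv/= -!ler_norml => /le_trans; apply.
    by rewrite ler_nat.
  - by move=> i; exact: measurable_itv.
  - move=> i; apply: measurable_funTS; apply/measurable_EFinP.
    have me : measurable_fun setT (fun s : R => c * expR s) by apply: measurable_funM.
    apply: measurable_funM => //; exact: measurableT_comp.
  - move=> i x _; rewrite lee_fin mulr_ge0 ?G0 ?mulr_gt0 ?expR_gt0//.
    by rewrite ltW// mulr_gt0 ?expR_gt0.
have := @cvg_unique _ (@ereal_hausdorff R) _ _ _ _ HI; apply => /=.
by rewrite (_ : (fun k => _) = (fun k => (\int[leb]_(s in J k) (G (c * expR s) * (c * expR s))%:E)%E))//; apply/funext.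
Qed.

(** By reflection, [f] has the same integral as its even part, and an even function integrates to
    twice its integral over the half-line. *)
Lemma ge0_integral_symmetrize (f : R -> R) :
  continuous f -> (forall s, 0 <= f s) ->
  (\int[leb]_s (f s)%:E = \int[leb]_(s in `[0%R, +oo[) (f s + f (- s))%:E)%E.
Proof.
move=> cf f0.
have mf : measurable_fun setT f by exact: continuous_measurable_fun.
have cfN : continuous (fun s : R => f (- s)).
  by move=> s; apply: (@continuous_comp _ _ _ -%R f); [exact: opp_continuous|exact: cf].
have mfN : measurable_fun setT (fun s : R => f (- s)) by exact: continuous_measurable_fun.
pose g (s : R) := 2^-1 * (f s + f (- s)).
have g0 s : 0 <= g s by rewrite mulr_ge0// addr_ge0.
have cg : continuous g.
  move=> s; apply: (@continuousM _ _ (cst (2^-1 : R)) (fun s => f s + f (- s))); first exact: cst_continuous.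
  by apply: continuousD; [exact: cf|exact: cfN].
have mF : measurable_fun setT (EFin \o f) by exact/measurable_EFinP.
have mFN : measurable_fun setT (EFin \o (fun s => f (- s))) by exact/measurable_EFinP.
have h0 : (0 <= 2^-1%:E :> \bar R)%E by rewrite lee_fin.
transitivity (\int[leb]_s (g s)%:E)%E.
  under [RHS]eq_integral do rewrite /g EFinM EFinD.
  rewrite ge0_integralZl//; last 2 first.
  - exact: emeasurable_funD.
  - by move=> s _; rewrite adde_ge0// lee_fin.
  rewrite ge0_integralD//; last 2 first.
  - by move=> s _; rewrite lee_fin.
  - by move=> s _; rewrite lee_fin.
  have -> : (\int[leb]_s (f (- s))%:E = \int[leb]_s (f s)%:E)%E.
    rewrite -[RHS](@ge0_integral_reflect_1d R 0 (EFin \o f) mF (fun x => f0 x)).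
    by apply: eq_integral => s _ /=; rewrite sub0r.
  have If : (0 <= \int[leb]_s (f s)%:E)%E by apply: integral_ge0 => s _; rewrite lee_fin.
  rewrite ge0_muleDr// -ge0_muleDl// -EFinD (_ : 2^-1 + 2^-1 = 1) ?mul1e//; lra.
rewrite ge0_symfun_integralT//; last by move=> s; rewrite /g/= opprK addrC.
rewrite (_ : [set x | 0 <= x] = `[0, +oo[%classic); last first.
  by apply/seteqP; split => x /=; rewrite in_itv/= andbT.
rewrite -[LHS]ge0_integralZl//; last 2 first.
- by apply: measurable_funTS; apply/measurable_EFinP; exact: continuous_measurable_fun.
- by move=> x _; rewrite lee_fin.
by apply: eq_integral => s _; rewrite -EFinM /g mulrA divff ?mul1r.
Qed.

End exponential_substitution.

Lemma continuous_mulf (R : realType) (f g : R -> R) :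
  continuous f -> continuous g -> continuous (fun s => f s * g s).
Proof. by move=> cf cg s; exact: continuousM (cf s) (cg s). Qed.

(** Matching of constants for [green_gm], with [a = n / 2]: on the left, twice the constant [cst0]
    produced there by the substitution; on the right, the prefactor of the Bessel integral in
    [green]. *)
Lemma green_const (R : realType) (a d q : R) : 0 < d -> 0 < q ->
  2 * (d^-1 * (q * d / 2) * (4 * pi * (q * d / 2)) `^ (- a)) =
  d `^ (- a) * ((2 * pi) `^ a)^-1 * q^-1 `^ (a - 1).
Proof.
move=> d0 q0.
have p2 : 0 < 2 * pi :> R by rewrite mulr_gt0// pi_gt0.
have -> : 4 * pi * (q * d / 2) = 2 * pi * (q * d) by field.
have -> : q^-1 `^ (a - 1) = q * q `^ (- a).
  rewrite -{1}(powR_inv1 (ltW q0)) -powRrM mulN1r -{2}(powRr1 (ltW q0)) -powRD.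
    by congr (_ `^ _); ring.
  by rewrite (gt_eqF q0) implybT.
rewrite (powRM _ (ltW p2)) ?mulr_ge0 ?(ltW q0) ?(ltW d0)// (powRM _ (ltW q0) (ltW d0)).
rewrite (powRN (2 * pi)); field.
by rewrite !gt_eqF// powR_gt0.
Qed.

Lemma continuous_hk_time (R : realType) n (x : 'rV[R]_n) (t : R) : 0 < t ->
  {for t, continuous (fun r => hk r x)}.
Proof.
move=> t0; have h := continuous_heat_time (x := x) t0.
have e : hk t x = heat t 1 x by rewrite /hk t0.
rewrite /prop_for /continuous_at e; apply: cvg_trans h.
apply: near_eq_cvg; near=> r; rewrite /hk ifT//.
by near: r; exact: (cvgr_gt t cvg_id).
Unshelve. all: by end_near. Qed.

Section green_kernel.
Context (R : realType) (n : nat).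
Local Notation E := ('rV[R]_n).
Local Notation mu := (lebesgue_rV R n).
Local Notation M := (measurableTypeR R).
Local Notation leb := (@lebesgue_measure R).

(** The law of the heat time in the mixture, exponential with mean [d]. Its vanishing at nonpositive
    [r] ensures that only times admissible in the semigroup law contribute. *)
Definition rho (d r : R) : R := if 0 < r then exponential_pdf d^-1 r else 0.

Lemma rho_ge0 d r : 0 < d -> 0 <= rho d r.
Proof.
by move=> d0; rewrite /rho; case: ifP => // _; apply: exponential_pdf_ge0; rewrite invr_ge0 ltW.
Qed.

Lemma measurable_gt0 : measurable_fun setT (fun r : M => 0 < r).
Proof. exact: measurable_fun_ltr. Qed.

Lemma measurable_rho d : measurable_fun setT (rho d : M -> R).
Proof.
apply: measurable_fun_ifT => //; first exact: measurable_gt0.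
exact: measurable_exponential_pdf.
Qed.

Lemma integral_rho_le1 d : 0 < d -> (\int[leb]_r (rho d r)%:E <= 1)%E.
Proof.
move=> d0; rewrite -(@integral_exponential_pdf R d^-1) ?invr_gt0//.
apply: ge0_le_integral => //.
- by move=> r _; rewrite lee_fin rho_ge0.
- by apply/measurable_EFinP; exact: measurable_rho.
- by apply/measurable_EFinP; exact: measurable_exponential_pdf.
- move=> r _; rewrite lee_fin /rho; case: ifP => // _.
  by apply: exponential_pdf_ge0; rewrite invr_ge0 ltW.
Qed.

Lemma integrable_rho d : 0 < d -> leb.-integrable setT (EFin \o rho d).
Proof.
move=> d0; apply/integrableP; split; first by apply/measurable_EFinP; exact: measurable_rho.
under eq_integral do rewrite /= ger0_norm ?rho_ge0//.
by apply: le_lt_trans (integral_rho_le1 d0) _; rewrite ltry.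
Qed.

(* green d coincides with gm d away from 0; at x = 0 the integral may diverge,
   in which case gm d 0 = 0. *)
Definition gm (d : R) (x : E) : R := \int[leb]_r (rho d r * hk r x).

Lemma rho_gt0E d r : 0 < r -> rho d r = d^-1 * expR (- (r / d)).
Proof.
by move=> r0; rewrite /rho r0 exponential_pdfE ?(ltW r0)// mulNr (mulrC d^-1 r).
Qed.

Lemma measurable_rho_hk d :
  measurable_fun setT (fun z : E * M => rho d z.2 * hk z.2 z.1).
Proof.
apply: measurable_funM; first exact: (measurableT_comp (measurable_rho d) measurable_snd).
by apply: measurable_hk_comp; [exact: measurable_snd|exact: measurable_fst].
Qed.

Lemma measurable_gm d : measurable_fun setT (gm d).
Proof. exact: (measurable_Rintegral_param leb (measurable_rho_hk d)). Qed.

(** Substituting [c * expR s] for [r] in the mixture turns [r / d + |x|^2 / (4 r)] into [q * cosh s]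
    and the powers of [r] into [expR (- (nu * s))] up to a constant; symmetrising in [s] then gives
    the integral that defines [besselM]. *)
Lemma green_gm d x : 0 < d -> x != 0 -> green d x = gm d x.
Proof.
move=> d0 x0.
have ex0 : 0 < enorm x.
  rewrite lt_neqAle sqrtr_ge0 andbT eq_sym; apply/eqP => ex.
  move/eqP : x0; apply; apply/rowP => i; rewrite mxE; apply/eqP.
  have : enorm x ^+ 2 = 0 by rewrite ex expr0n.
  rewrite enorm_sqr => /eqP; rewrite psumr_eq0; last by move=> j _; rewrite sqr_ge0.
  by move=> /allP/(_ i (mem_index_enum _)); rewrite sqrf_eq0.
set q : R := enorm x / Num.sqrt d.
have sd0 : 0 < Num.sqrt d by rewrite sqrtr_gt0.
have q0 : 0 < q by rewrite divr_gt0.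
pose nu : R := n%:R / 2 - 1.
(* The heat time at which [r / d] and [|x|^2 / (4 r)] coincide, both being [q / 2]. *)
pose c : R := q * d / 2.
have c0 : 0 < c by rewrite divr_gt0// mulr_gt0.
have ex2 : enorm x ^+ 2 = q ^+ 2 * d.
  by rewrite /q expr_div_n (sqr_sqrtr (ltW d0)) divfK// gt_eqF.
pose G (r : R) := d^-1 * expR (- (r / d)) * heat r 1 x.
have mh : measurable_fun setT (fun r : M => hk r x) by exact: measurable_hk_comp.
have mrh : measurable_fun setT (fun r : M => rho d r * hk r x).
  by apply: measurable_funM => //; exact: measurable_rho.
have step1 : (\int[leb]_r (rho d r * hk r x)%:E = \int[leb]_(r in `]0%R, +oo[) (d^-1 * expR (- (r / d)) * hk r x)%:E)%E.
  rewrite [RHS]integral_mkcond; apply: eq_integral => r _; rewrite patchE.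
  case: ifPn; rewrite ?inE/= ?notin_setE/= in_itv/= andbT.
    by move=> r0; rewrite rho_gt0E.
  by move=> /negP r0; rewrite /hk (negbTE r0) mulr0.
pose cst0 : R := d^-1 * c * (4 * pi * c) `^ (- (n%:R / 2)).
have p4c : 0 < 4 * pi * c by exact: mulr_gt0 (mulr_gt0 _ (pi_gt0 R)) c0.
have cosh0 s : 0 <= cosh s :> R by rewrite divr_ge0// addr_ge0// expR_ge0.
have Gs s : d^-1 * expR (- (c * expR s / d)) * hk (c * expR s) x * (c * expR s) =
    cst0 * (expR (- (q * cosh s)) * expR (- (nu * s))).
  have ces : 0 < c * expR s by rewrite mulr_gt0 ?expR_gt0.
  rewrite /hk ces /heat !mulr1 (mulrA _ c) powRM ?expR_ge0 ?(ltW p4c)//.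
  have -> : expR s `^ (- (n%:R / 2)) = expR (- (n%:R / 2) * s).
    by rewrite /powR gt_eqF ?expR_gt0// expRK.
  have -> : expR (- (q * cosh s)) = expR (- (c * expR s / d)) * expR (- (enorm x ^+ 2 / (4 * (c * expR s)))).
    rewrite -expRD; congr expR; rewrite ex2 /cosh /c expRN.
    by field; rewrite !gt_eqF ?expR_gt0.
  have -> : expR (- (nu * s)) = expR (- (n%:R / 2) * s) * expR s.
    by rewrite -expRD; congr expR; rewrite /nu; ring.
  by rewrite /cst0; ring.
have step2 : (\int[leb]_(r in `]0%R, +oo[) (d^-1 * expR (- (r / d)) * hk r x)%:E =
   \int[leb]_s (cst0 * (expR (- (q * cosh s)) * expR (- (nu * s))))%:E)%E.
  rewrite (ge0_integral_exp_subst (G := fun r => d^-1 * expR (- (r / d)) * hk r x) c0).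
  - by apply: eq_integral => s _; rewrite Gs.
  - by move=> t t0; rewrite !mulr_ge0 ?expR_ge0 ?hk_ge0 ?invr_ge0 ?(ltW d0).
  - move=> t t0.
    have ch := continuous_hk_time (x := x) t0.
    apply: continuousM => //; apply: continuousM; first exact: cst_continuous.
    apply: (@continuous_comp _ _ _ (fun r : R => - (r / d) : R) (@expR R)); last exact: continuous_expR.
    apply: continuousN; apply: continuousM; [exact: cvg_id|exact: cst_continuous].
  - apply: measurable_funM => //; apply: measurable_funM => //.
    apply: (measurableT_comp (@measurable_expR R)).
    by apply: measurable_funN; apply: measurable_funM.
have cst00 : 0 <= cst0.
  by apply: mulr_ge0 (powR_ge0 _ _); apply: mulr_ge0 (ltW c0); rewrite invr_ge0 ltW.
have ccosh : continuous (@cosh R).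
  apply: continuous_mulf; last exact: cst_continuous.
  move=> s; apply: continuousD; first exact: continuous_expR.
  by apply: (@continuous_comp _ _ _ -%R (@expR R)); [exact: opp_continuous|exact: continuous_expR].
have clin (a : R) : continuous (fun s : R => expR (- (a * s))).
  move=> s; apply: (@continuous_comp _ _ _ (fun r : R => - (a * r) : R) (@expR R)); last exact: continuous_expR.
  by apply: continuousN; apply: continuousM; [exact: cst_continuous|exact: cvg_id].
have cec : continuous (fun s : R => expR (- (q * cosh s))).
  by move=> s; apply: (@continuous_comp _ _ _ (@cosh R) (fun r : R => expR (- (q * r)))); [exact: ccosh|exact: clin].
have step3 : (\int[leb]_s (cst0 * (expR (- (q * cosh s)) * expR (- (nu * s))))%:E =
   \int[leb]_(s in `[0%R, +oo[) ((2 * cst0) * (expR (- (q * cosh s)) * cosh (nu * s)))%:E)%E.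
  rewrite (@ge0_integral_symmetrize R (fun s => cst0 * (expR (- (q * cosh s)) * expR (- (nu * s))))).
  - apply: eq_integral => s _; congr (_%:E).
    have -> : cosh (- s) = cosh s by rewrite /cosh opprK addrC.
    by rewrite mulrN opprK /cosh; field.
  - apply: continuous_mulf; first exact: cst_continuous.
    by apply: continuous_mulf; [exact: cec|exact: clin].
  - by move=> s; apply: mulr_ge0 => //; rewrite mulr_ge0 ?expR_ge0.
have -> : gm d x = besselM nu q * (2 * cst0).
  rewrite /gm /Rintegral step1 step2 step3 /besselM.
  rewrite -/(Rintegral leb `[0, +oo[%classic (fun s => 2 * cst0 * (expR (- (q * cosh s)) * cosh (nu * s)))).
  rewrite [LHS](Rintegral_mkcond leb) [in RHS](Rintegral_mkcond leb).
  rewrite -ge0_Rintegral_scale.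
  - apply: eq_Rintegral => s _; rewrite !patchE; case: ifP => _; last by rewrite mul0r.
    by rewrite mulrC.
  - apply/(measurable_restrictT _ (measurable_itv _)).
    apply: measurable_funTS; apply: continuous_measurable_fun.
    apply: continuous_mulf; first exact: cec.
    move=> s; apply: (@continuous_comp _ _ _ (fun r : R => nu * r : R) (@cosh R)); last exact: ccosh.
    by apply: continuousM; [exact: cst_continuous|exact: cvg_id].
  - by move=> s; rewrite patchE; case: ifP => // _; rewrite mulr_ge0 ?expR_ge0.
rewrite /green /greenG -/q -/nu (green_const (n%:R / 2) d0 q0) -/nu.
by ring.
Qed.

End green_kernel.

Lemma is_derive_affine (R : realType) (a c s : R) : is_derive s 1 (fun s => a * s + c) a.
Proof.
have h := is_deriveD (@is_deriveZ R _ _ (@idfun R) a s 1 _ (is_derive_id _ _)) (is_derive_cst c s 1).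
by move: h; rewrite addr0 /GRing.scale/= mulr1; exact.
Qed.

(** * The resolvent equation integrated along a segment of heat times *)

Section resolvent_identity.
Context (R : realType).
Local Notation M := (measurableTypeR R).
Local Notation leb := (@lebesgue_measure R).

Lemma Rintegral_translate_1d (c : R) (f : M -> R) : measurable_fun setT f ->
  \int[leb]_r f (c + r) = \int[leb]_r f r.
Proof.
move=> mf.
have mF : measurable_fun setT (EFin \o f) by exact/measurable_EFinP.
have refl (b : R) (g : M -> R) : measurable_fun setT g ->
    (\int[leb]_r (g (b - r)%R)%:E = \int[leb]_r (g r)%:E)%E.
  move=> mg; have mG : measurable_fun setT (EFin \o g) by exact/measurable_EFinP.
  rewrite [LHS]integralE [RHS]integralE.
  rewrite -(ge0_integral_reflect_1d b (F := (EFin \o g)^\+%E)) ?funepos_ge0//; last exact: measurable_funepos.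
  rewrite -(ge0_integral_reflect_1d b (F := (EFin \o g)^\-%E)) ?funeneg_ge0//; last exact: measurable_funeneg.
  by congr (_ - _)%E; apply: eq_integral => x _; rewrite ?funeposE ?funenegE.
rewrite /Rintegral -[in RHS](refl c)//; congr fine.
rewrite -(refl 0 (fun r => f (c - r))); last first.
  by apply: (measurableT_comp mf); exact: measurable_funB.
by apply: eq_integral => r _; rewrite sub0r opprK.
Qed.

Variables (d : R) (Th : R -> R) (B : R).
Hypotheses (d0 : 0 < d) (mTh : measurable_fun setT (Th : M -> R))
  (ThB : forall r, `|Th r| <= B)
  (cTh : forall r, 0 < r -> {for r, continuous Th}).

(** With [Th r] the value of [H(r) * g] at a point, [m t] is that of [k_d * H(t) * g], and the
    expected equation is [m' = (m - Th) / d]. Up to the factor [expR (t / d) / d], [e] is the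
    integrand of [m t] after shifting [r] by [t]. *)
Let m (t : R) := \int[leb]_r (rho d r * Th (t + r)).
Let e (r : R) := expR (- (r / d)) * Th r.

Let me_ : measurable_fun setT (e : M -> R).
Proof.
apply: measurable_funM => //; apply: (measurableT_comp (@measurable_expR R)).
by apply: measurable_funN; exact: measurable_funM.
Qed.

Let e_integrable t1 : 0 < t1 -> leb.-integrable `[t1, +oo[%classic (EFin \o e).
Proof.
move=> t10.
have mI : measurable (`[t1, +oo[%classic : set M) by exact: measurable_itv.
apply: (le_integrable mI (g := fun r => ((B * d)%:E * (rho d r)%:E)%E)).
- by apply: measurable_funTS; exact/measurable_EFinP.
- move=> r /=; rewrite in_itv/= andbT => t1r.
  have r0 : 0 < r by exact: lt_le_trans t1r.
  rewrite lee_fin /e normrM (ger0_norm (expR_ge0 _)) rho_gt0E//.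
  rewrite (_ : B * d * (d^-1 * expR (- (r / d))) = expR (- (r / d)) * B); last first.
    by field; rewrite gt_eqF.
  rewrite normrM (ger0_norm (expR_ge0 _)).
  by apply: ler_wpM2l; rewrite ?expR_ge0//; apply: le_trans (ThB r) (ler_norm _).
- apply: integrableZl; first exact: measurable_itv.
  exact: (integrableS measurableT mI (@subsetT _ _) (integrable_rho d0)).
Qed.

Section local_formula.
Variables (t1 : R) (t10 : 0 < t1).
Let C := \int[leb]_(r in `[t1, +oo[) e r.
Let H (t : R) := \int[leb]_(r in `[t1, t]) e r.
(** A formula for [m] through a primitive of [e], from which its derivative can be read. The base
    point [t1] is positive because [Th] need not be continuous at time 0. *)
Let mm (t : R) := d^-1 * (expR (t / d) * (C - H t)).

Let mmE t : t1 <= t -> m t = mm t.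
Proof.
move=> t1t; rewrite /m /mm.
have t_0 : 0 < t by exact: lt_le_trans t1t.
have -> : C - H t = \int[leb]_(r in `]t, +oo[) e r.
  by rewrite /C /H Rintegral_itvB//; exact: e_integrable.
rewrite [in RHS](Rintegral_mkcond leb).
pose f (r : M) : R := (e \_ `]t, +oo[%classic) r * (expR (t / d) * d^-1).
have ie : leb.-integrable `]t, +oo[%classic (EFin \o e).
  apply: (integrableS _ _ _ (e_integrable t10)); try exact: measurable_itv.
  by apply: subset_itvr; rewrite bnd_simp.
have mer : measurable_fun setT (e \_ `]t, +oo[%classic).
  by apply/(measurable_restrictT _ (measurable_itv _)); exact: measurable_funTS.
transitivity (\int[leb]_r f r); last first.
  rewrite /f RintegralZr//; first by ring.
  have mI : measurable (`]t, +oo[%classic : set M) by exact: measurable_itv.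
  have := (@integrable_mkcond _ _ _ leb _ (EFin \o e) mI).1 ie.
  by apply: eq_integrable => // r _; rewrite /= !patchE; case: ifP.
rewrite -(Rintegral_translate_1d t (f := f)); last exact: measurable_funM.
apply: eq_Rintegral => r _; rewrite /f [in RHS]patchE.
case: ifPn; rewrite ?inE ?notin_setE/= in_itv/= andbT ltrDl.
  move=> r0; rewrite rho_gt0E// /e mulrDl opprD expRD.
  rewrite [RHS](_ : _ = expR (- (t / d)) * expR (t / d) * (d^-1 * expR (- (r / d)) * Th (t + r))).
    by rewrite -expRD addNr expR0 mul1r.
  by ring.
by move=> /negP r0; rewrite /rho (negbTE r0) !mul0r.
Qed.

Let H_derive t : t1 < t -> is_derive t 1 H (e t).
Proof.
move=> t1t.
have ce : {for t, continuous e}.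
  apply: continuousM; last by apply: cTh; exact: lt_trans t1t.
  apply: (@continuous_comp _ _ _ (fun r : R => - (r / d) : R) (@expR R)); last exact: continuous_expR.
  by apply: continuousN; apply: continuousM; [exact: cvg_id|exact: cst_continuous].
have := @continuous_FTC1 R e (BLeft t1) t (t + 1) _ _ _ ce.
case.
- by rewrite ltrDl.
- apply: (integrableS _ _ _ (e_integrable t10)); try exact: measurable_itv.
  by apply: subset_itvl; rewrite bnd_simp.
- by first [rewrite ltBSide/= ltW|rewrite ltBSide|exact: ltW|exact: t1t].
- by move=> dH eH; apply: DeriveDef; rewrite -?derive1E.
Qed.

Let mm_derive t : t1 < t -> is_derive t 1 mm ((mm t - Th t) / d).
Proof.
move=> t1t; have dH := H_derive t1t.
have dE : is_derive t 1 (fun t => expR (t / d)) (expR (t / d) * d^-1).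
  apply: is_derive1_comp.
  rewrite (_ : (fun t => t / d) = (fun t => d^-1 * t + 0)); first exact: is_derive_affine.
  by apply/funext => r; rewrite addr0 mulrC.
have dC : is_derive t 1 (fun t => C - H t) (0 - e t).
  exact: (is_deriveB (is_derive_cst C t 1) dH).
have := is_deriveM dE dC => dP.
have := @is_deriveZ R _ _ _ d^-1 t 1 _ dP.
rewrite (_ : (mm t - Th t) / d = d^-1 *: (expR (t / d) *: (0 - e t) + (C - H t) *: (expR (t / d) * d^-1))); first exact.
apply/esym; rewrite /GRing.scale/= /mm /e sub0r.
rewrite [LHS](_ : _ = d^-1 * ((C - H t) * (expR (t / d) * d^-1) - (expR (t / d) * expR (- (t / d))) * Th t)); last by ring.
by rewrite -expRD subrr expR0 mul1r; ring.
Qed.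

(** The fundamental theorem of calculus for [expR (- (a * (t - s))) * m (p s)], where the heat time
    [p s] runs from [a * d * t] to [D * t]. Its derivative contains [a * m + (D - a * d) * m'];
    inserting [m' = (m - Th) / d] cancels the terms in [a * m] and leaves
    [D / d * (m - Th) + a * Th]. *)
Lemma resolvent_identity_local (a D t : R) : 0 < a -> 0 < D -> 0 < t ->
  t1 < a * d * t -> t1 < D * t ->
  m (D * t) - expR (- (a * t)) * m (a * d * t) =
  \int[leb]_(s in `[0, t]) (expR (- (a * (t - s))) *
     (D / d * (m (a * d * (t - s) + D * s) - Th (a * d * (t - s) + D * s))
      + a * Th (a * d * (t - s) + D * s))).
Proof.
move=> a0 D0 t_0 tb tD.
pose b := a * d; pose p s := b * (t - s) + D * s.
have pt s : 0 <= s <= t -> t1 < p s.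
  move=> /andP[s0 st]; rewrite /p.
  have [bD|Db] := leP b D.
    apply: lt_le_trans tb _; rewrite -/b mulrBr -addrA lerDl.
    by rewrite addrC -mulrBl mulr_ge0// subr_ge0.
  apply: lt_le_trans tD _.
  have : 0 <= (b - D) * (t - s) by rewrite mulr_ge0// subr_ge0// ltW.
  by lra.
pose q s := expR (- (a * (t - s))) * mm (p s).
pose f s := expR (- (a * (t - s))) * (D / d * (mm (p s) - Th (p s)) + a * Th (p s)).
have dp (s : R) : is_derive s 1 p (D - b).
  have -> : p = (fun s => (D - b) * s + b * t) by apply/funext => r; rewrite /p; ring.
  exact: is_derive_affine.
have dl (s : R) : is_derive s 1 (fun s => - (a * (t - s))) a.
  have -> : (fun s => - (a * (t - s))) = (fun s => a * s + (- (a * t))) by apply/funext => r; ring.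
  exact: is_derive_affine.
have dq (s : R) : 0 <= s <= t -> is_derive s 1 q (f s).
  move=> st.
  have d1 := is_derive1_comp (is_derive_expR _) (dl s).
  have d2 := is_derive1_comp (mm_derive (pt s st)) (dp s).
  have := is_deriveM d1 d2.
  set v := (X in is_derive _ _ _ X -> _); rewrite (_ : f s = v); first exact.
  by rewrite /v /GRing.scale/= /f /b; field; rewrite gt_eqF.
have cder (g : R -> R) (s v : R) : is_derive s 1 g v -> {for s, continuous g}.
  by move=> dg; apply: differentiable_continuous; apply/derivable1_diffP; exact: ex_derive.
have cf s : 0 <= s <= t -> {for s, continuous f}.
  move=> st.
  have cp := cder _ _ _ (dp s).
  have cmm : {for s, continuous (fun s => mm (p s))}.
    by apply: (@continuous_comp _ _ _ p mm) => //; exact: cder (mm_derive (pt s st)).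
  have cth : {for s, continuous (fun s => Th (p s))}.
    by apply: (@continuous_comp _ _ _ p Th) => //; apply: cTh; exact: lt_trans (pt s st).
  apply: continuousM; first exact: cder (is_derive1_comp (is_derive_expR _) (dl s)).
  apply: continuousD; last by apply: continuousM => //; exact: cst_continuous.
  by apply: continuousM; [exact: cst_continuous|exact: continuousB].
have := @continuous_FTC2 R f q 0 t t_0 _ _ _.
have z0 : (0 : R) <= 0 <= t by rewrite lexx ltW.
have tt : (0 : R) <= t <= t by rewrite lexx ltW.
move=> FTC; have {FTC} : (\int[leb]_(x in `[0%R, t]) (f x)%:E = (q t)%:E - (q 0%R)%:E)%E.
  apply: FTC.
  - by apply: continuous_in_subspaceT => x; rewrite inE/= in_itv/= => xt; exact: cf.
  - split.
    + move=> x; rewrite in_itv/= => /andP[x0 xt]; have xx : 0 <= x <= t by rewrite !ltW.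
      by have [] := dq _ xx.
    + by apply: cvg_at_right_filter; exact: cder (dq _ z0).
    + by apply: cvg_at_left_filter; exact: cder (dq _ tt).
  - move=> x; rewrite in_itv/= => /andP[x0 xt]; have xx : 0 <= x <= t by rewrite !ltW.
    by rewrite derive1E; have [] := dq _ xx.
have mpE s : 0 <= s <= t -> m (p s) = mm (p s) by move=> st; apply: mmE; exact/ltW/pt.
move=> FTC.
have -> : m (D * t) = q t.
  rewrite /q subrr mulr0 oppr0 expR0 mul1r -mpE//; congr m.
  by rewrite /p subrr mulr0 add0r.
have -> : expR (- (a * t)) * m (a * d * t) = q 0.
  rewrite /q subr0 -mpE//; congr (_ * m _).
  by rewrite /p subr0 mulr0 addr0.
have -> : q t - q 0 = fine ((q t)%:E - (q 0%R)%:E)%E by [].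
rewrite -FTC; apply: eq_Rintegral => s; rewrite inE/= in_itv/= => st.
by rewrite /f -mpE.
Qed.

End local_formula.

Lemma resolvent_identity (a D t : R) : 0 < a -> 0 < D -> 0 < t ->
  m (D * t) - expR (- (a * t)) * m (a * d * t) =
  \int[leb]_(s in `[0, t]) (expR (- (a * (t - s))) *
     (D / d * (m (a * d * (t - s) + D * s) - Th (a * d * (t - s) + D * s))
      + a * Th (a * d * (t - s) + D * s))).
Proof.
move=> a0 D0 t_0.
have h0 : 0 < a * d * t by rewrite !mulr_gt0.
have h1 : 0 < D * t by rewrite mulr_gt0.
(* Any positive base point below both ends of the segment would do. *)
apply: (@resolvent_identity_local (Num.min (a * d * t) (D * t) / 2)) => //.
- by rewrite divr_gt0// lt_min h0.
- by rewrite ltr_pdivrMr// gt_min (_ : a * d * t < a * d * t * 2)//; lra.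
- by rewrite ltr_pdivrMr// gt_min orbC (_ : D * t < D * t * 2)//; lra.
Qed.

End resolvent_identity.

Section weights_swap.
Context d1 d2 (Z1 : measurableType d1) (Z2 : measurableType d2) (R : realType).
Variables (m1 : {sigma_finite_measure set Z1 -> \bar R})
          (m2 : {sigma_finite_measure set Z2 -> \bar R}).

Lemma Rintegral_weights_swap (w1 : Z1 -> R) (w2 : Z2 -> R) (h : Z1 -> Z2 -> R) (B : R) :
  m1.-integrable setT (EFin \o w1) -> m2.-integrable setT (EFin \o w2) ->
  measurable_fun setT (fun z => h z.1 z.2) -> (forall a b, `|h a b| <= B) ->
  \int[m1]_a (w1 a * \int[m2]_b (w2 b * h a b)) =
  \int[m2]_b (w2 b * \int[m1]_a (w1 a * h a b)).
Proof.
move=> i1 i2 mh hB.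
have mw1 : measurable_fun setT w1 by apply/measurable_EFinP; exact: measurable_int i1.
have mw2 : measurable_fun setT w2 by apply/measurable_EFinP; exact: measurable_int i2.
transitivity (\int[m1]_a \int[m2]_b (w1 a * (w2 b * h a b))).
  apply: eq_Rintegral => a _; rewrite RintegralZl//.
  by apply: (integrable_weight_bounded (B := B)) => //; exact: measurable_section1.
transitivity (\int[m2]_b \int[m1]_a (w1 a * (w2 b * h a b))); last first.
  apply: eq_Rintegral => b _; rewrite -RintegralZl//.
    by apply: eq_Rintegral => a _; rewrite mulrCA.
  by apply: (integrable_weight_bounded (B := B)) => //; exact: measurable_section2.
pose C := fine (\int[m2]_b `|w2 b|%:E)%E.
have Cfin : (\int[m2]_b `|w2 b|%:E)%E \is a fin_num.
  by have := integrable_fin_num measurableT (integrable_norm i2).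
have B0 (a : Z1) (b : Z2) : 0 <= B by apply: le_trans (hB a b).
apply: (dominated_Rintegral_swap (k := fun _ b => `|w2 b|) (w := fun a => `|B| * `|w1 a|) (C := C)).
- apply: measurable_funM; first exact: (measurableT_comp mw1 measurable_fst).
  by apply: measurable_funM => //; exact: (measurableT_comp mw2 measurable_snd).
- by apply: measurableT_comp => //; exact: (measurableT_comp mw2 measurable_snd).
- exact: (integrableZl measurableT `|B| (integrable_norm i1)).
- by move=> a; rewrite mulr_ge0.
- by [].
- by move=> _; rewrite /C fineK.
- move=> a b; rewrite !normrM mulrA [leRHS]mulrC mulrA [leRHS]mulrAC ler_pM ?mulr_ge0//.
    by rewrite mulrC.
  by apply: le_trans (hB a b) (ler_norm _).
Qed.

End weights_swap.

Section operators.
Context (R : realType) (n : nat).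
Local Notation E := ('rV[R]_n).
Local Notation mu := (lebesgue_rV R n).
Local Notation M := (measurableTypeR R).
Local Notation leb := (@lebesgue_measure R).
Implicit Types (g : E -> R) (x : E).

Lemma hopD t g1 g2 (B1 B2 : R) x : measurable_fun setT g1 -> measurable_fun setT g2 ->
  (forall y, `|g1 y| <= B1) -> (forall y, `|g2 y| <= B2) ->
  hop t (fun y => g1 y + g2 y) x = hop t g1 x + hop t g2 x.
Proof.
move=> m1 m2 b1 b2; rewrite /hop /convolution -RintegralD//.
- by under eq_Rintegral do rewrite mulrDr.
- exact: integrable_hop b1.
- exact: integrable_hop b2.
Qed.

Lemma hop_Rintegral d (Z : measurableType d) (m : {sigma_finite_measure set Z -> \bar R})
    (w : Z -> R) (G : Z -> E -> R) (B : R) t x :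
  m.-integrable setT (EFin \o w) -> measurable_fun setT (fun z => G z.1 z.2) ->
  (forall z y, `|G z y| <= B) ->
  hop t (fun y => \int[m]_z (w z * G z y)) x = \int[m]_z (w z * hop t (G z) x).
Proof.
move=> iw mG GB; rewrite /hop /convolution.
apply: (Rintegral_weights_swap (w1 := fun y : E => hk t (x - y)) (h := fun (y : E) (z : Z) => G z y) (B := B)) => //.
  exact: integrable_hk_sub.
exact: measurable_uncurry_swap.
Qed.

(* The value of k_d * H(t) * g at x; contrary to gm, this integral over heat
   times converges at every point when g is bounded. *)
Definition Qop d t g x : R := \int[leb]_r (rho d r * hop (t + r) g x).

Lemma measurable_Qop dz (Z : measurableType dz) d (t : Z -> R) (g : Z -> E -> R) (x : Z -> E) :
  measurable_fun setT t -> measurable_fun setT (fun z => g z.1 z.2) ->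
  measurable_fun setT x ->
  measurable_fun setT (fun z => Qop d (t z) (g z) (x z)).
Proof.
move=> mt mg mx.
apply: (measurable_Rintegral_param leb (f := fun z r => rho d r * hop (t z + r) (g z) (x z))).
apply: measurable_funM; first exact: (measurableT_comp (measurable_rho d) measurable_snd).
apply: (measurable_hop (t := fun z : Z * M => t z.1 + z.2) (g := fun z : Z * M => g z.1) (x := fun z : Z * M => x z.1)).
- apply: measurable_funD; first exact: (measurableT_comp mt measurable_fst).
  exact: measurable_snd.
- have mp : measurable_fun setT (fun z : (Z * M) * E => (z.1.1, z.2)).
    apply/measurable_fun_pairP; split; last exact: measurable_snd.
    exact: (measurableT_comp measurable_fst measurable_fst).
  exact: (measurableT_comp mg mp).
- exact: (measurableT_comp mx measurable_fst).
Qed.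

Lemma measurable_Qop1 d t g : measurable_fun setT g -> measurable_fun setT (Qop d t g).
Proof.
move=> mg; apply: (measurable_Qop d (t := fun=> t) (g := fun=> g) (x := id)) => //.
exact: (measurableT_comp mg measurable_snd).
Qed.

Lemma measurable_hop_time g x t : measurable_fun setT g ->
  measurable_fun setT (fun r : M => hop (t + r) g x).
Proof.
move=> mg; apply: (measurable_hop (t := fun r : M => t + r) (g := fun=> g) (x := fun=> x)) => //.
  exact: measurable_funD.
exact: (measurableT_comp mg measurable_snd).
Qed.

Lemma integrable_Qop d t g (B : R) x : 0 < d -> measurable_fun setT g ->
  (forall y, `|g y| <= B) ->
  leb.-integrable setT (EFin \o (fun r => rho d r * hop (t + r) g x)).
Proof.
move=> d0 mg gB; apply: (integrable_weight_bounded (B := B)).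
- exact: integrable_rho.
- exact: measurable_hop_time.
- by move=> r; exact: hop_bound.
Qed.

Lemma Qop_bound d t g (B : R) x : 0 < d -> measurable_fun setT g ->
  (forall y, `|g y| <= B) -> `|Qop d t g x| <= B.
Proof.
move=> d0 mg gB; rewrite -[leRHS]mul1r; apply: Rintegral_weight_bound.
- exact: measurable_rho.
- exact: measurable_hop_time.
- exact: le_trans (gB x).
- by move=> r; exact: hop_bound.
- under eq_integral do rewrite ger0_norm ?rho_ge0//.
  exact: integral_rho_le1.
Qed.

Lemma QopD d t g1 g2 (B1 B2 : R) x : 0 < d -> measurable_fun setT g1 -> measurable_fun setT g2 ->
  (forall y, `|g1 y| <= B1) -> (forall y, `|g2 y| <= B2) ->
  Qop d t (fun y => g1 y + g2 y) x = Qop d t g1 x + Qop d t g2 x.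
Proof.
move=> d0 m1 m2 b1 b2; rewrite /Qop -RintegralD//.
- by apply: eq_Rintegral => r _; rewrite (hopD _ _ m1 m2 b1 b2) mulrDr.
- exact: integrable_Qop b1.
- exact: integrable_Qop b2.
Qed.

Lemma Qop_Rintegral dz (Z : measurableType dz) (m : {sigma_finite_measure set Z -> \bar R})
    d (w : Z -> R) (G : Z -> E -> R) (B : R) t x : 0 < d ->
  m.-integrable setT (EFin \o w) -> measurable_fun setT (fun z => G z.1 z.2) ->
  (forall z y, `|G z y| <= B) ->
  Qop d t (fun y => \int[m]_z (w z * G z y)) x = \int[m]_z (w z * Qop d t (G z) x).
Proof.
move=> d0 iw mG GB; rewrite /Qop.
rewrite -(Rintegral_weights_swap (m1 := leb) (w1 := rho d : M -> R) (h := fun (r : M) (z : Z) => hop (t + r) (G z) x) (B := B))//.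
- by apply: eq_Rintegral => r _; rewrite (hop_Rintegral _ _ iw mG GB).
- exact: integrable_rho.
- apply: (measurable_hop (t := fun z : M * Z => t + z.1) (g := fun z : M * Z => G z.2) (x := fun=> x)) => //.
    by apply: measurable_funD => //; exact: measurable_fst.
  have mp : measurable_fun setT (fun z : (M * Z) * E => (z.1.2, z.2)).
    apply/measurable_fun_pairP; split; last exact: measurable_snd.
    exact: (measurableT_comp measurable_snd measurable_fst).
  exact: (measurableT_comp mG mp).
- move=> r z; apply: hop_bound => //; exact: measurable_section1.
Qed.

Lemma hop_Qop d s t g (B : R) x : 0 < d -> 0 < s -> 0 <= t ->
  measurable_fun setT g -> (forall y, `|g y| <= B) ->
  hop s (Qop d t g) x = Qop d (s + t) g x.
Proof.
move=> d0 s0 t0 mg gB; rewrite /Qop.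
rewrite (hop_Rintegral (m := leb) (w := rho d : M -> R) (G := fun (r : M) y => hop (t + r) g y) (B := B)).
- apply: eq_Rintegral => r _; rewrite /rho; case: ifPn => r0; last by rewrite !mul0r.
  by rewrite (hop_hop _ _ _ mg gB) ?addrA// ltr_wpDl.
- exact: integrable_rho.
- apply: (measurable_hop (t := fun z : M * E => t + z.1) (g := fun=> g) (x := fun z => z.2)).
  + by apply: measurable_funD => //; exact: measurable_fst.
  + exact: (measurableT_comp mg measurable_snd).
  + exact: measurable_snd.
- by move=> r y; exact: hop_bound.
Qed.

Lemma Qop0_hop d t g (B : R) x : 0 < t ->
  measurable_fun setT g -> (forall y, `|g y| <= B) ->
  Qop d 0 (hop t g) x = Qop d t g x.
Proof.
move=> t0 mg gB; apply: eq_Rintegral => r _; rewrite /rho.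
case: ifPn => r0; last by rewrite !mul0r.
by rewrite add0r (hop_hop _ r0 t0 mg gB) addrC.
Qed.

Lemma enorm_sqr_le0 x : (enorm x ^+ 2 <= 0) = (x == 0).
Proof.
apply/idP/eqP => [|->]; last first.
  by rewrite enorm_sqr big1// => i _; rewrite mxE expr0n.
rewrite enorm_sqr => h; apply/rowP => i; rewrite mxE; apply/eqP.
have : \sum_(i < n) x ord0 i ^+ 2 == 0.
  by rewrite eq_le h sumr_ge0// => j _; rewrite sqr_ge0.
rewrite psumr_eq0; last by move=> j _; rewrite sqr_ge0.
by move=> /allP/(_ i (mem_index_enum _)); rewrite sqrf_eq0.
Qed.

Lemma lebesgue_rV_set1 x : (0 < n)%N -> mu [set x] = 0%E.
Proof.
move=> n0.
have -> : [set x] = [set y | forall i, [set x ord0 i] (y ord0 i)].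
  by apply/seteqP; split => y /= => [->//|xy]; apply/rowP => i; exact: xy.
rewrite (@lebesgue_rV_box R n (fun i => [set x ord0 i])); last by move=> i; exact: measurable_set1.
by rewrite (bigD1 (Ordinal n0))//= lebesgue_measure_set1 mul0e.
Qed.

Lemma measurable_rV_set1 x : measurable [set x].
Proof.
have -> : [set x] = [set y : E | true] `&` (fun y : E => enorm (y - x) ^+ 2) @^-1` `]-oo, 0].
  apply/seteqP; split => y /=; first by move=> ->; rewrite in_itv/= enorm_sqr_le0 subrr.
  by rewrite in_itv/= enorm_sqr_le0 subr_eq0 => -[_ /eqP].
have -> : [set y : E | true] = setT by apply/seteqP; split.
apply: (measurableT_comp (@measurable_enorm_sqr R n)) => //.
exact: measurable_rV_sub.
Qed.

Lemma measurable_green d : 0 < d -> measurable_fun setT (green d : E -> R).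
Proof.
move=> d0.
have -> : (green d : E -> R) = (fun x : E => if enorm x ^+ 2 <= 0 then green d (0 : E) else gm d x).
  by apply/funext => x; rewrite enorm_sqr_le0; case: eqVneq => [->//|x0]; exact: green_gm.
apply: measurable_fun_ifT => //; last exact: measurable_gm.
apply: measurable_fun_ler => //; exact: measurable_enorm_sqr.
Qed.

Lemma convolution_gm d g (B : R) x : 0 < d ->
  measurable_fun setT g -> (forall y, `|g y| <= B) ->
  convolution (gm d) g x = Qop d 0 g x.
Proof.
move=> d0 mg gB; rewrite /convolution.
have B0 : 0 <= B by exact: le_trans (gB 0).
have msub : measurable_fun setT (fun y : E => x - y) by exact: measurable_rV_sub.
transitivity (\int[mu]_y \int[leb]_r (rho d r * (hk r (x - y) * g y))).
  (* The factor [g y] enters the integral over heat times even at a point where that integral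
     diverges. *)
  apply: eq_Rintegral => y _; rewrite /gm -ge0_Rintegral_scale.
  - by under eq_Rintegral do rewrite -mulrA.
  - apply: measurable_funM; first exact: measurable_rho.
    exact: measurable_hk_comp.
  - by move=> r; rewrite mulr_ge0 ?rho_ge0 ?hk_ge0.
rewrite -(dominated_Rintegral_swap (f := fun (r : M) (y : E) => rho d r * (hk r (x - y) * g y))
   (k := fun (r : M) (y : E) => hk r (x - y)) (w := fun r : M => B * rho d r) (C := 1)).
- apply: eq_Rintegral => r _; rewrite add0r RintegralZl//.
  exact: integrable_hop gB.
- apply: measurable_funM; first exact: (measurableT_comp (measurable_rho d) measurable_fst).
  apply: measurable_funM; last exact: (measurableT_comp mg measurable_snd).
  apply: measurable_hk_comp; first exact: measurable_fst.
  exact: (measurableT_comp msub measurable_snd).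
- apply: measurable_hk_comp; first exact: measurable_fst.
  exact: (measurableT_comp msub measurable_snd).
- exact: (integrableZl measurableT B (integrable_rho d0)).
- by move=> r; rewrite mulr_ge0// rho_ge0.
- by move=> r y; exact: hk_ge0.
- by move=> r; exact: integral_hk_sub_le1.
- move=> r y; rewrite normrM (ger0_norm (rho_ge0 _ _))// normrM (ger0_norm (hk_ge0 _ _)).
  rewrite (mulrC B) -mulrA; apply: ler_wpM2l; first exact: rho_ge0.
  by rewrite mulrC; apply: ler_wpM2r; rewrite ?hk_ge0.
Qed.

(** [green d] and [gm d] can differ only at the origin, hence the integrands only at [y = x], and a
    point is a null set in positive dimension. *)
Lemma convolution_green d g (B : R) x : (0 < n)%N -> 0 < d ->
  measurable_fun setT g -> (forall y, `|g y| <= B) ->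
  convolution (green d) g x = Qop d 0 g x.
Proof.
move=> n0 d0 mg gB; rewrite -(convolution_gm x d0 mg gB) /convolution.
have msub : measurable_fun setT (fun y : E => x - y) by exact: measurable_rV_sub.
congr fine; apply: ae_eq_integral => //.
- apply/measurable_EFinP; apply: measurable_funM => //.
  exact: (measurableT_comp (measurable_green d0) msub).
- apply/measurable_EFinP; apply: measurable_funM => //.
  exact: (measurableT_comp (@measurable_gm R n d) msub).
- exists [set x]; split.
  + exact: measurable_rV_set1.
  + exact: lebesgue_rV_set1.
  + move=> y /= h; apply/eqP/negP => /negP yx; apply: h => _.
    by rewrite green_gm// subr_eq0 eq_sym.
Qed.

End operators.

(** * Variation of constants *)

Section time_integrals.
Context (R : realType).
Local Notation M := (measurableTypeR R).
Local Notation leb := (@lebesgue_measure R).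

(* Integrals over `[0, t] are rewritten with this indicator, which is jointly
   measurable in (t, s). *)
Definition ind (t s : R) : R := if 0 < s then if s < t then 1 else 0 else 0.

Lemma indE t s : ind t s = ((0 < s) && (s < t))%:R.
Proof. by rewrite /ind; case: (0 < s) => //=; case: (s < t). Qed.

Lemma ind_ge0 t s : 0 <= ind t s.
Proof. by rewrite indE. Qed.

(** Both sides describe the triangle [0 < r < s < t]. The right one is suited to integrating in [s]
    first: after a shift by [r], the variable runs over the elapsed time [t - r]. *)
Lemma ind_shift t s r : ind t s * ind s r = ind t r * ind (t - r) (s - r).
Proof.
rewrite !indE -!natrM !mulnb; congr (_%:R); congr nat_of_bool.
by apply/idP/idP => /andP[/andP[? ?] /andP[? ?]]; do !(apply/andP; split); lra.
Qed.

Lemma measurable_ind d (Z : measurableType d) (t s : Z -> R) :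
  measurable_fun setT t -> measurable_fun setT s ->
  measurable_fun setT (fun z => ind (t z) (s z)).
Proof.
move=> mt ms; apply: measurable_fun_ifT => //.
  exact: measurable_fun_ltr.
by apply: measurable_fun_ifT => //; exact: measurable_fun_ltr.
Qed.

Lemma ind_patch t (f : R -> R) s : ind t s * f s = (f \_ `]0, t[%classic) s.
Proof.
rewrite patchE indE mem_setE in_itv/=.
by case: (_ && _); rewrite ?mul1r ?mul0r.
Qed.

Lemma integral_ind_le t : (\int[leb]_s (ind t s)%:E <= `|t|%:E)%E.
Proof.
have -> : (\int[leb]_s (ind t s)%:E = \int[leb]_(s in `]0%R, t[) (cst 1%R s)%:E)%E.
  rewrite [RHS]integral_mkcond; apply: eq_integral => s _.
  by rewrite restrict_EFin/= -ind_patch mulr1.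
have mi : measurable (`]0, t[%classic : set M) by exact: measurable_itv.
rewrite (integral_cst leb mi 1%E) mul1e.
rewrite [X in (X <= _)%E]lebesgue_measure_itv/= lte_fin.
by case: ifP => t0; rewrite ?oppr0 ?adde0 lee_fin ?ler_norm.
Qed.

Lemma integrable_ind t : leb.-integrable setT (EFin \o (ind t : M -> R)).
Proof.
apply/integrableP; split; first by apply/measurable_EFinP; exact: measurable_ind.
under eq_integral do rewrite /= ger0_norm ?ind_ge0//.
by apply: le_lt_trans (integral_ind_le t) _; rewrite ltry.
Qed.

Lemma indP t s : (0 < s < t /\ ind t s = 1) \/ ind t s = 0.
Proof. by rewrite indE; case: (boolP ((0 < s) && (s < t))); [left|right]. Qed.

Lemma ind_mul s t q : 0 < s < t -> ind t q * ind s q = ind s q.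
Proof.
move=> /andP[_ st]; case: (indP s q) => [[/andP[q0 qs] ->]|->]; last by rewrite mulr0.
by rewrite mulr1 indE q0 (lt_trans qs st).
Qed.

Lemma integrable_ind_bounded t (k : M -> R) C : measurable_fun setT k ->
  (forall s, 0 < s < t -> `|k s| <= C) ->
  leb.-integrable setT (EFin \o (fun s : M => ind t s * k s)).
Proof.
move=> mk kC; apply: (le_integrable measurableT (g := fun s : M => (C%:E * (ind t s)%:E)%E)).
- by apply/measurable_EFinP; apply: measurable_funM => //; exact: measurable_ind.
- move=> s _; rewrite -EFinM lee_fin.
  case: (indP t s) => [[st ->]|->]; last by rewrite mul0r mulr0.
  by rewrite mul1r mulr1; apply: le_trans (kC _ st) _; exact: ler_norm.
- by apply: integrableZl => //; exact: integrable_ind.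
Qed.

Lemma Rintegral_ind_bound t (k : M -> R) C : measurable_fun setT k -> 0 <= C ->
  (forall s, 0 < s < t -> `|k s| <= C) -> `|\int[leb]_s (ind t s * k s)| <= `|t| * C.
Proof.
move=> mk C0 kC.
have -> : \int[leb]_s (ind t s * k s) = \int[leb]_s (ind t s * (ind t s * k s)).
  apply: eq_Rintegral => s _.
  by case: (indP t s) => [[_ ->]|->]; rewrite ?mul1r ?mul0r.
apply: Rintegral_weight_bound => //.
- exact: measurable_ind.
- by apply: measurable_funM => //; exact: measurable_ind.
- move=> s; case: (indP t s) => [[st ->]|->]; first by rewrite mul1r; exact: kC.
  by rewrite mul0r normr0.
- under eq_integral do rewrite ger0_norm ?ind_ge0//.
  exact: integral_ind_le.
Qed.

(** Agreement is asked only inside the interval: the endpoints carry no mass, and there the formulas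
    for heat kernels and solutions may take default values. *)
Lemma Rintegral_ind t (f g : R -> R) : measurable_fun setT (g : M -> R) ->
  (forall s, 0 < s < t -> f s = g s) ->
  \int[leb]_(s in `[0, t]) f s = \int[leb]_s (ind t s * g s).
Proof.
move=> mg fg.
have mo : measurable_fun (`]0, t[%classic : set R) (EFin \o f).
  apply: (eq_measurable_fun (EFin \o g)).
    by move=> s; rewrite inE/= in_itv/= => st; rewrite fg.
  by apply: measurable_funTS; exact/measurable_EFinP.
transitivity (\int[leb]_(s in `]0, t[) f s).
  by rewrite /Rintegral; congr fine; exact: integral_itv_bndoo.
rewrite (Rintegral_mkcond leb); apply: eq_Rintegral => s _.
rewrite ind_patch !patchE; case: ifPn => //; rewrite inE/= in_itv/= => st.
exact: fg.
Qed.

End time_integrals.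

Ltac mr := repeat first
  [ exact: measurable_cst | exact: measurable_fst | exact: measurable_snd | exact: measurable_id
  | assumption
  | apply: measurable_ind | apply: measurable_funB | apply: measurable_funD
  | apply: measurable_funN | apply: measurable_funM
  | apply: (measurableT_comp (@measurable_expR _)) ].

Section variation_of_constants.
Local Opaque hop Qop.
Context (R : realType) (n : nat).
Local Notation E := ('rV[R]_n).
Local Notation mu := (lebesgue_rV R n).
Local Notation M := (measurableTypeR R).
Local Notation leb := (@lebesgue_measure R).
Implicit Types (g : E -> R) (x : E).

Definition duh (D t : R) (F : M -> E -> R) x : R :=
  \int[leb]_s (ind t s * hop (D * (t - s)) (F s) x).

(** The mild formula with the nonlinearity frozen into a source [F]. The first components of both
    systems have this form, so the linear identities below serve both. *)
Definition Usol (D : R) g (F : M -> E -> R) (t : R) x : R := hop (D * t) g x + duh D t F x.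

(* With a = 1/delta, Sop is the part common to v_j and k_j * u, and Zop is the
   remainder, of size O(1/a) in L^p. *)
Definition Zop (a d D t : R) g x : R := \int[leb]_s (ind t s * (expR (- (a * (t - s))) *
  (D / d * (Qop d (a * d * (t - s) + D * s) g x - hop (a * d * (t - s) + D * s) g x)))).

Definition Sop (a d D t : R) g x : R := \int[leb]_s (ind t s * (expR (- (a * (t - s))) *
  (a * hop (a * d * (t - s) + D * s) g x))).

(** The mild formula for [v_j] with [a = 1 / delta], so that [a * d] is the diffusivity
    [d_j / delta]; the datum [Qop d 0 g] stands for [k_j * u0]. *)
Definition Vsol (a d D : R) g (F : M -> E -> R) (t : R) x : R :=
  expR (- (a * t)) * hop (a * d * t) (Qop d 0 g) x +
  \int[leb]_s (ind t s * (expR (- (a * (t - s))) * (a * hop (a * d * (t - s)) (Usol D g F s) x))).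

Lemma measurable_uncurry_comp dz (Z : measurableType dz) (F : M -> E -> R) (s : Z -> R) (y : Z -> E) :
  measurable_fun setT (fun z : M * E => F z.1 z.2) ->
  measurable_fun setT s -> measurable_fun setT y ->
  measurable_fun setT (fun z => F (s z) (y z)).
Proof.
move=> mF ms my.
have mp : measurable_fun setT (fun z => (s z : M, y z)) by apply/measurable_fun_pairP.
exact: (measurableT_comp mF mp).
Qed.

Lemma measurable_hopF dz (Z : measurableType dz) (F : M -> E -> R) (t s : Z -> R) (y : Z -> E) :
  measurable_fun setT (fun z : M * E => F z.1 z.2) ->
  measurable_fun setT t -> measurable_fun setT s -> measurable_fun setT y ->
  measurable_fun setT (fun z => hop (t z) (F (s z)) (y z)).
Proof.
move=> mF mt ms my; apply: (measurable_hop (g := fun z => F (s z))) => //.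
apply: (measurable_uncurry_comp mF); last exact: measurable_snd.
exact: (measurableT_comp ms measurable_fst).
Qed.

Lemma measurable_QopF dz (Z : measurableType dz) d (F : M -> E -> R) (t s : Z -> R) (y : Z -> E) :
  measurable_fun setT (fun z : M * E => F z.1 z.2) ->
  measurable_fun setT t -> measurable_fun setT s -> measurable_fun setT y ->
  measurable_fun setT (fun z => Qop d (t z) (F (s z)) (y z)).
Proof.
move=> mF mt ms my; apply: (measurable_Qop d (g := fun z => F (s z))) => //.
apply: (measurable_uncurry_comp mF); last exact: measurable_snd.
exact: (measurableT_comp ms measurable_fst).
Qed.

Lemma measurable_cstF g : measurable_fun setT g ->
  measurable_fun setT (fun z : M * E => (fun=> g) z.1 z.2).
Proof. by move=> mg; exact: (measurableT_comp mg measurable_snd). Qed.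

Lemma exp_le1 (a r : R) : 0 <= a -> 0 <= r -> expR (- (a * r)) <= 1.
Proof. by move=> a0 r0; rewrite -expR0 ler_expR oppr_le0 mulr_ge0. Qed.

Section bounded_source.
Variables (D : R) (g : E -> R) (F : M -> E -> R) (B : R).
Hypotheses (D0 : 0 < D) (mg : measurable_fun setT g) (gB : forall y, `|g y| <= B)
  (mF : measurable_fun setT (fun z : M * E => F z.1 z.2)) (FB : forall s y, `|F s y| <= B).

Let B0 : 0 <= B. Proof. exact: le_trans (gB 0). Qed.
Let mF1 s : measurable_fun setT (F s). Proof. exact: measurable_section1 mF. Qed.

Lemma measurable_duh dz (Z : measurableType dz) (t : Z -> R) (y : Z -> E) :
  measurable_fun setT t -> measurable_fun setT y ->
  measurable_fun setT (fun z => duh D (t z) F (y z)).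
Proof.
move=> mt my.
have mt' : measurable_fun setT (fun z : Z * M => t z.1) by exact: (measurableT_comp mt measurable_fst).
apply: (measurable_Rintegral_param leb (f := fun z s => ind (t z) s * hop (D * (t z - s)) (F s) (y z))).
apply: measurable_funM; first by mr.
by apply: (measurable_hopF mF); mr; exact: (measurableT_comp my measurable_fst).
Qed.

Lemma duh_bound t y : `|duh D t F y| <= `|t| * B.
Proof.
apply: Rintegral_weight_bound => //.
- exact: measurable_ind.
- by apply: (measurable_hopF mF); mr.
- by move=> s; exact: hop_bound.
- under eq_integral do rewrite ger0_norm ?ind_ge0//.
  exact: integral_ind_le.
Qed.

Lemma measurable_Usol dz (Z : measurableType dz) (t : Z -> R) (y : Z -> E) :
  measurable_fun setT t -> measurable_fun setT y ->
  measurable_fun setT (fun z => Usol D g F (t z) (y z)).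
Proof.
move=> mt my; apply: measurable_funD; last exact: measurable_duh.
by apply: (measurable_hopF (s := cst 0) (measurable_cstF mg)); mr.
Qed.

Lemma Usol_bound t y : `|Usol D g F t y| <= B + `|t| * B.
Proof.
apply: le_trans (ler_normD _ _) _.
by apply: lerD; [exact: hop_bound|exact: duh_bound].
Qed.

Lemma hop_Usol r s x : 0 < r -> 0 < s ->
  hop r (Usol D g F s) x = hop (r + D * s) g x +
    \int[leb]_q (ind s q * hop (r + D * (s - q)) (F q) x).
Proof.
move=> r0 s0; have m1 : measurable_fun setT (hop (D * s) g) by exact: measurable_hop1.
have m2 : measurable_fun setT (duh D s F) by apply: measurable_duh; mr.
have b1 y : `|hop (D * s) g y| <= B by exact: hop_bound.
have b2 y : `|duh D s F y| <= `|s| * B by exact: duh_bound.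
rewrite [LHS](hopD _ _ m1 m2 b1 b2); congr (_ + _).
  by rewrite (hop_hop _ r0 _ mg gB)// mulr_gt0.
rewrite (hop_Rintegral (m := leb) (w := ind s : M -> R) (G := fun (q : M) y => hop (D * (s - q)) (F q) y) (B := B)).
+ apply: eq_Rintegral => q _; rewrite indE; case: (boolP ((0 < q) && (q < s))) => [/andP[q0 qs]|]; last by rewrite !mul0r.
  by rewrite (hop_hop _ r0 _ (mF1 q) (FB q))// mulr_gt0// subr_gt0.
+ exact: integrable_ind.
+ by apply: (measurable_hopF mF); mr.
+ by move=> q y; apply: hop_bound.
Qed.

Lemma Qop0_Usol d t x : 0 < d -> 0 < t ->
  Qop d 0 (Usol D g F t) x = Qop d (D * t) g x +
    \int[leb]_q (ind t q * Qop d (D * (t - q)) (F q) x).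
Proof.
move=> d0 t0; have m1 : measurable_fun setT (hop (D * t) g) by exact: measurable_hop1.
have m2 : measurable_fun setT (duh D t F) by apply: measurable_duh; mr.
have b1 y : `|hop (D * t) g y| <= B by exact: hop_bound.
have b2 y : `|duh D t F y| <= `|t| * B by exact: duh_bound.
have e1 := QopD 0 x d0 m1 m2 b1 b2.
have e2 : Qop d 0 (hop (D * t) g) x = Qop d (D * t) g x.
  by apply: Qop0_hop mg gB; rewrite mulr_gt0.
have mG : measurable_fun setT (fun z : M * E => hop (D * (t - z.1)) (F z.1) z.2).
  by apply: (measurable_hopF mF); mr.
have GB (q : M) y : `|hop (D * (t - q)) (F q) y| <= B by exact: hop_bound.
have e3 := @Qop_Rintegral R n _ M leb d (ind t) (fun q y => hop (D * (t - q)) (F q) y) B 0 x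
  d0 (integrable_ind t) mG GB.
apply: (etrans e1); rewrite e2; congr (_ + _); apply: (etrans e3).
apply: eq_Rintegral => q _; rewrite indE; case: (boolP ((0 < q) && (q < t))) => [/andP[q0 qt]|]; last by rewrite !mul0r.
congr (_ * _); apply: (Qop0_hop _ _ _ (mF1 q) (FB q)); rewrite mulr_gt0// subr_gt0//.
Qed.

End bounded_source.

(** The resolvent identity for [Th r = hop r g x], its integrand being split into the small part
    [Zop] and the relaxation part [Sop]. *)
Lemma resolvent_hop a d D t g (B : R) x : 0 < a -> 0 < d -> 0 < D -> 0 < t ->
  measurable_fun setT g -> (forall y, `|g y| <= B) ->
  Qop d (D * t) g x - expR (- (a * t)) * Qop d (a * d * t) g x =
  Zop a d D t g x + Sop a d D t g x.
Proof.
move=> a0 d0 D0 t0 mg gB.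
have mh : measurable_fun setT (fun r : M => hop r g x).
  by apply: (measurable_hopF (s := cst 0) (measurable_cstF mg)); mr.
have hB r : `|hop r g x| <= B by exact: hop_bound.
have := @resolvent_identity R d (fun r => hop r g x) B d0 mh hB _ a D t a0 D0 t0.
move=> ->; last by move=> r r0; exact: continuous_hop_time gB.
have mp : measurable_fun setT (fun s : M => a * d * (t - s) + D * s) by mr.
have mQ : measurable_fun setT (fun s : M => Qop d (a * d * (t - s) + D * s) g x).
  by apply: (measurable_QopF d (s := cst 0) (measurable_cstF mg)); mr.
have mH : measurable_fun setT (fun s : M => hop (a * d * (t - s) + D * s) g x).
  by apply: (measurable_hopF (s := cst 0) (measurable_cstF mg)); mr.
have me : measurable_fun setT (fun s : M => expR (- (a * (t - s)))) by mr.
have B0 : 0 <= B by exact: le_trans (gB 0).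
rewrite (Rintegral_ind (g := fun s => expR (- (a * (t - s))) *
     (D / d * (Qop d (a * d * (t - s) + D * s) g x - hop (a * d * (t - s) + D * s) g x)
      + a * hop (a * d * (t - s) + D * s) g x)))//; last first.
  by apply: measurable_funM => //; apply: measurable_funD; apply: measurable_funM => //; exact: measurable_funB.
have e1 s : 0 < s < t -> expR (- (a * (t - s))) <= 1.
  by move=> /andP[_ st]; apply: exp_le1; rewrite ?subr_ge0 ltW.
rewrite /Zop /Sop -RintegralD//.
- by apply: eq_Rintegral => s _; rewrite -mulrDr -mulrDr.
- apply: (integrable_ind_bounded (C := 1 * (`|D / d| * (B + B)))).
    by apply: measurable_funM => //; apply: measurable_funM => //; exact: measurable_funB.
  move=> s st; rewrite normrM (ger0_norm (expR_ge0 _)).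
  apply: ler_pM; [exact: expR_ge0|exact: normr_ge0|exact: e1|].
  rewrite normrM ler_wpM2l//; apply: le_trans (ler_normB _ _) _.
  by apply: lerD => //; exact: Qop_bound.
- apply: (integrable_ind_bounded (C := 1 * (`|a| * B))).
    by apply: measurable_funM => //; exact: measurable_funM.
  move=> s st; rewrite normrM (ger0_norm (expR_ge0 _)).
  apply: ler_pM; [exact: expR_ge0|exact: normr_ge0|exact: e1|].
  by rewrite normrM ler_wpM2l.
Qed.

Section error_formula.
Variables (a d D : R) (g : E -> R) (F : M -> E -> R) (B : R).
Hypotheses (a0 : 0 < a) (d0 : 0 < d) (D0 : 0 < D).
Hypotheses (mg : measurable_fun setT g) (gB : forall y, `|g y| <= B)
  (mF : measurable_fun setT (fun z : M * E => F z.1 z.2)) (FB : forall s y, `|F s y| <= B).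

Let B0 : 0 <= B. Proof. exact: le_trans (gB 0). Qed.
Let mF1 s : measurable_fun setT (F s). Proof. exact: measurable_section1 mF. Qed.

Let e1 t s : 0 < s < t -> expR (- (a * (t - s))) <= 1.
Proof. by move=> /andP[_ st]; apply: exp_le1; rewrite ?subr_ge0 ltW. Qed.

Let relax_bound t s k C : 0 < s < t -> `|k| <= C -> `|expR (- (a * (t - s))) * k| <= C.
Proof.
move=> st kC; rewrite normrM (ger0_norm (expR_ge0 _)) -[leRHS]mul1r.
by apply: ler_pM; [exact: expR_ge0|exact: normr_ge0|exact: e1|].
Qed.

Let zop_bound t s r x (h : E -> R) : (forall y, `|h y| <= B) -> measurable_fun setT h -> 0 < s < t ->
  `|expR (- (a * (t - s))) * (D / d * (Qop d r h x - hop r h x))| <= D / d * (B + B).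
Proof.
move=> hB mh st; apply: relax_bound => //.
have Dd : 0 <= D / d by rewrite divr_ge0 ?ltW.
rewrite normrM (ger0_norm Dd); apply: (ler_wpM2l Dd); apply: le_trans (ler_normB _ _) _.
by apply: lerD; [exact: Qop_bound|exact: hop_bound].
Qed.

Let sop_bound t s r x (h : E -> R) : (forall y, `|h y| <= B) -> measurable_fun setT h -> 0 < s < t ->
  `|expR (- (a * (t - s))) * (a * hop r h x)| <= a * B.
Proof.
move=> hB mh st; apply: relax_bound => //.
by rewrite normrM (gtr0_norm a0); apply: (ler_wpM2l (ltW a0)); exact: hop_bound.
Qed.

Let mexp dz (Z : measurableType dz) (t : Z -> R) : measurable_fun setT t ->
  measurable_fun setT (fun z : Z * M => expR (- (a * (t z.1 - z.2)))).
Proof. by move=> mt; have := measurableT_comp mt (@measurable_fst _ _ Z M) => mt'; mr. Qed.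

Lemma measurable_Zop dz (Z : measurableType dz) (t s : Z -> R) (y : Z -> E) :
  measurable_fun setT t -> measurable_fun setT s -> measurable_fun setT y ->
  measurable_fun setT (fun z => Zop a d D (t z) (F (s z)) (y z)).
Proof.
move=> mt ms my.
have mt' : measurable_fun setT (fun z : Z * M => t z.1) by exact: (measurableT_comp mt measurable_fst).
have ms' : measurable_fun setT (fun z : Z * M => s z.1) by exact: (measurableT_comp ms measurable_fst).
have my' : measurable_fun setT (fun z : Z * M => y z.1) by exact: (measurableT_comp my measurable_fst).
apply: (measurable_Rintegral_param leb (f := fun z r => ind (t z) r * (expR (- (a * (t z - r))) *
  (D / d * (Qop d (a * d * (t z - r) + D * r) (F (s z)) (y z) - hop (a * d * (t z - r) + D * r) (F (s z)) (y z)))))).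
apply: measurable_funM; first by mr.
apply: measurable_funM; first exact: mexp.
apply: measurable_funM; first by mr.
by apply: measurable_funB; [apply: (measurable_QopF d mF)|apply: (measurable_hopF mF)]; mr.
Qed.

Lemma measurable_Sop dz (Z : measurableType dz) (t s : Z -> R) (y : Z -> E) :
  measurable_fun setT t -> measurable_fun setT s -> measurable_fun setT y ->
  measurable_fun setT (fun z => Sop a d D (t z) (F (s z)) (y z)).
Proof.
move=> mt ms my.
have mt' : measurable_fun setT (fun z : Z * M => t z.1) by exact: (measurableT_comp mt measurable_fst).
have ms' : measurable_fun setT (fun z : Z * M => s z.1) by exact: (measurableT_comp ms measurable_fst).
have my' : measurable_fun setT (fun z : Z * M => y z.1) by exact: (measurableT_comp my measurable_fst).
apply: (measurable_Rintegral_param leb (f := fun z r => ind (t z) r * (expR (- (a * (t z - r))) *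
  (a * hop (a * d * (t z - r) + D * r) (F (s z)) (y z))))).
apply: measurable_funM; first by mr.
apply: measurable_funM; first exact: mexp.
apply: measurable_funM; first by mr.
by apply: (measurable_hopF mF); mr.
Qed.

(** Relaxing the Duhamel part of [Usol] gives a double integral over [0 < q < s < t]. Integrating in
    [s] first, each slice [F q] is relaxed over the time [t - q] that has elapsed since [q], which
    is a term [Sop]. *)
Lemma relax_Usol t x : 0 < t ->
  \int[leb]_s (ind t s * (expR (- (a * (t - s))) * (a * hop (a * d * (t - s)) (Usol D g F s) x))) =
  Sop a d D t g x + \int[leb]_q (ind t q * Sop a d D (t - q) (F q) x).
Proof.
move=> t0.
pose H (s q : M) : R := a * hop (a * d * (t - s) + D * (s - q)) (F q) x.
have mH : measurable_fun setT (fun z : M * M => H z.1 z.2).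
  by apply: measurable_funM => //; apply: (measurable_hopF mF); mr.
have HB s q : `|H s q| <= a * B.
  by rewrite /H normrM (gtr0_norm a0); apply: (ler_wpM2l (ltW a0)); exact: hop_bound.
have aB : 0 <= a * B by rewrite mulr_ge0// ltW.
pose k (s : M) : R := \int[leb]_q (ind t q * (ind s q * H s q)).
have mk : measurable_fun setT k.
  apply: (measurable_Rintegral_param leb (f := fun s q : M => ind t q * (ind s q * H s q))).
  by apply: measurable_funM; [mr|apply: measurable_funM => //; mr].
have iHB s q : `|ind s q * H s q| <= a * B.
  by case: (indP s q) => [[_ ->]|->]; rewrite ?mul1r// mul0r normr0.
have miH s : measurable_fun setT (fun q : M => ind s q * H s q).
  by apply: measurable_funM; [mr|exact: measurable_section1 mH].
have kB s : `|k s| <= `|t| * (a * B).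
  by apply: Rintegral_ind_bound => // q _; exact: iHB.
(* Both indicators are kept in the integrand, so that the exchange takes place on the whole
   plane. *)
pose h (s q : M) : R := ind t s * ind s q * (expR (- (a * (t - s))) * H s q).
have mh : measurable_fun setT (fun z : M * M => h z.1 z.2).
  by apply: measurable_funM; [mr|apply: measurable_funM => //; mr].
have hB s q : `|h s q| <= (a * B) * ind t s * ind t q.
  rewrite /h; case: (indP t s) => [[st ->]|->]; last by rewrite !mul0r normr0 mulr0 mul0r.
  rewrite -(ind_mul q st) mul1r mulr1.
  case: (indP t q) => [[qt ->]|->]; last by rewrite !mul0r normr0 mulr0.
  rewrite mulr1 mul1r mulrCA; apply: relax_bound => //.
transitivity (\int[leb]_s (ind t s * (expR (- (a * (t - s))) *
    (a * hop (a * d * (t - s) + D * s) g x)) + ind t s * (expR (- (a * (t - s))) * k s))).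
  apply: eq_Rintegral => s _; rewrite -mulrDr -mulrDr.
  case: (indP t s) => [[st ->]|->]; last by rewrite !mul0r.
  have /andP[s0 ts] := st; congr (_ * (_ * _)).
  have ad : 0 < a * d * (t - s) by rewrite !mulr_gt0// subr_gt0.
  rewrite (hop_Usol D0 mg gB mF FB x ad s0) mulrDr; congr (_ + _).
  rewrite -RintegralZl//; last first.
    apply: (integrable_weight_bounded (B := B) (integrable_ind s)).
      by apply: (measurable_hopF mF); mr.
    by move=> q; exact: hop_bound.
  by apply: eq_Rintegral => q _; rewrite mulrCA [RHS]mulrA (ind_mul q st).
rewrite RintegralD//; last 2 first.
- apply: (integrable_ind_bounded (C := a * B)) => [|s st]; last exact: sop_bound.
  apply: measurable_funM; first by mr.
  by apply: measurable_funM => //; apply: (measurable_hopF (s := cst 0) (measurable_cstF mg)); mr.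
- apply: (integrable_ind_bounded (C := `|t| * (a * B))) => [|s st]; last exact: relax_bound.
  by apply: measurable_funM => //; mr.
congr (_ + _).
transitivity (\int[leb]_s \int[leb]_q h s q).
  apply: eq_Rintegral => s _; rewrite /k mulrA -RintegralZl//; last first.
    by apply: (integrable_weight_bounded (B := a * B) (integrable_ind t)).
  apply: eq_Rintegral => q _; rewrite /h.
  case: (indP t s) => [[st ->]|->]; last by rewrite !mul0r.
  by rewrite !mul1r [X in _ * X = _]mulrA (ind_mul q st) mulrCA.
rewrite (dominated_Rintegral_swap (k := fun s q : M => ind t q) (w := fun s : M => a * B * ind t s) (C := `|t|))//; last 5 first.
- by mr.
- rewrite (_ : EFin \o _ = EFin \o (fun s : M => ind t s * (a * B))); last by apply/funext => s /=; rewrite mulrC.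
  by apply: (integrable_ind_bounded (C := `|a * B|)).
- by move=> s; rewrite mulr_ge0 ?ind_ge0.
- by move=> s q; exact: ind_ge0.
- by move=> s; exact: integral_ind_le.
apply: eq_Rintegral => q _.
rewrite -RintegralZl//; last first.
  apply: (integrable_ind_bounded (C := a * B)) => [|s st]; last exact: sop_bound.
  apply: measurable_funM; first by mr.
  by apply: measurable_funM => //; apply: (measurable_hopF (s := cst 0) (measurable_cstF (mF1 q))); mr.
have mq : measurable_fun setT (fun s : M => h s q).
  exact: (measurable_section2 (f := h)).
(* Shifting [s] by [q] changes the heat time [a * d * (t - s) + D * (s - q)] into the one of [Sop]
   at time [t - q]. *)
rewrite -(Rintegral_translate_1d q mq).
apply: eq_Rintegral => s _; rewrite /h /H ind_shift -mulrA.
have -> : q + s - q = s by lra.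
by have -> : t - (q + s) = t - q - s by lra.
Qed.

Let int_ind t (k : M -> R) C : measurable_fun setT k -> 0 <= C ->
  (forall q, 0 < q < t -> `|k q| <= `|t - q| * C) ->
  leb.-integrable setT (EFin \o (fun q : M => ind t q * k q)).
Proof.
move=> mk C0 kC; apply: (integrable_ind_bounded (C := `|t| * C)) => // q qt.
apply: le_trans (kC q qt) _; rewrite ler_wpM2r//; case/andP: qt => q0 qt.
by rewrite !ger0_norm; lra.
Qed.

Lemma Zop_bound t (h : E -> R) x : (forall y, `|h y| <= B) -> measurable_fun setT h ->
  `|Zop a d D t h x| <= `|t| * (D / d * (B + B)).
Proof.
move=> hB mh; apply: Rintegral_ind_bound => //.
- apply: measurable_funM; first by mr.
  apply: measurable_funM => //.
  by apply: measurable_funB; [apply: (measurable_QopF d (s := cst 0) (measurable_cstF mh))|apply: (measurable_hopF (s := cst 0) (measurable_cstF mh))]; mr.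
- by rewrite mulr_ge0 ?addr_ge0// divr_ge0 ?ltW.
- by move=> s st; exact: zop_bound.
Qed.

Lemma Sop_bound t (h : E -> R) x : (forall y, `|h y| <= B) -> measurable_fun setT h ->
  `|Sop a d D t h x| <= `|t| * (a * B).
Proof.
move=> hB mh; apply: Rintegral_ind_bound => //.
- apply: measurable_funM; first by mr.
  by apply: measurable_funM => //; apply: (measurable_hopF (s := cst 0) (measurable_cstF mh)); mr.
- by rewrite mulr_ge0// ltW.
- by move=> s st; exact: sop_bound.
Qed.

(** [resolvent_hop] is applied to the datum over the time [t] and to every slice [F q] over the time
    [t - q]. All terms [Sop] cancel, and so does the initial layer of the datum, because [v_j]
    starts from [k_j * u0]. The slices have no such initial value to compensate them, which leaves
    the last exponential term. *)
Lemma Vsol_Qop_Usol t x : 0 < t ->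
  Vsol a d D g F t x - Qop d 0 (Usol D g F t) x =
  - (Zop a d D t g x + \int[leb]_q (ind t q *
     (Zop a d D (t - q) (F q) x + expR (- (a * (t - q))) * Qop d (a * d * (t - q)) (F q) x))).
Proof.
move=> t0; rewrite /Vsol relax_Usol//.
have adt : 0 < a * d * t by rewrite !mulr_gt0.
rewrite (Qop0_Usol D0 mg gB mF FB x d0 t0) (hop_Qop x d0 adt (lexx 0) mg gB) addr0.
have := resolvent_hop x a0 d0 D0 t0 mg gB => /(canRL (subrK _)) ->.
suff -> : \int[leb]_q (ind t q * Qop d (D * (t - q)) (F q) x) =
  \int[leb]_q (ind t q * Sop a d D (t - q) (F q) x) +
  \int[leb]_q (ind t q * (Zop a d D (t - q) (F q) x + expR (- (a * (t - q))) * Qop d (a * d * (t - q)) (F q) x)).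
  by ring.
rewrite -RintegralD//; last 2 first.
- apply: (int_ind (C := a * B)) => [||q _]; last exact: Sop_bound.
    by apply: measurable_Sop; mr.
  by rewrite mulr_ge0// ltW.
- apply: (integrable_ind_bounded (C := `|t| * (D / d * (B + B)) + B)).
    apply: measurable_funD; first by apply: measurable_Zop; mr.
    by apply: measurable_funM; [mr|apply: (measurable_QopF d mF); mr].
  move=> q qt; apply: le_trans (ler_normD _ _) _; apply: lerD.
    apply: le_trans (Zop_bound (t - q) x (FB q) (mF1 q)) _.
    apply: ler_wpM2r; first by rewrite mulr_ge0 ?addr_ge0// divr_ge0 ?ltW.
    by case/andP: qt => q0 qt; rewrite !ger0_norm; lra.
  by apply: relax_bound => //; exact: Qop_bound.
apply: eq_Rintegral => q _; rewrite !indE.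
case: (boolP ((0 < q) && (q < t))) => [/andP[q0 qt]|_]; last by rewrite !mul0r addr0.
have tq : 0 < t - q by rewrite subr_gt0.
have := resolvent_hop x a0 d0 D0 tq (mF1 q) (FB q) => /(canRL (subrK _)) ->.
by ring.
Qed.

End error_formula.

End variation_of_constants.

(** * L^p bounds *)

Section Lp_bounds.
Context (R : realType) (n : nat).
Local Notation E := ('rV[R]_n).
Local Notation mu := (lebesgue_rV R n).
Variable (p : \bar R).
Hypothesis p1 : (1 <= p)%E.
Implicit Types (f g : E -> R).

Lemma LpnormD f g (A B : R) : measurable_fun setT f -> measurable_fun setT g ->
  (Lpnorm p f <= A%:E)%E -> (Lpnorm p g <= B%:E)%E ->
  (Lpnorm p (fun x => f x + g x)%R <= (A + B)%:E)%E.
Proof.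
move=> mf mg fA gB; rewrite EFinD; apply: le_trans (leeD fA gB).
exact: (eminkowski mu mf mg p1).
Qed.

Lemma le_Lpnorm f g : measurable_fun setT f -> measurable_fun setT g ->
  (forall x, `|f x| <= `|g x|) -> (Lpnorm p f <= Lpnorm p g)%E.
Proof.
move=> mf mg fg; rewrite /Lpnorm unlock.
case: p p1 => [r| |]; last by [].
- rewrite lee_fin => r1; have r0 : 0 < r by exact: lt_le_trans r1.
  apply: gt0_ler_poweR; rewrite ?invr_ge0 ?(ltW r0)//.
  + by rewrite in_itv/= leey andbT integral_ge0// => x _; exact: poweR_ge0.
  + by rewrite in_itv/= leey andbT integral_ge0// => x _; exact: poweR_ge0.
  apply: ge0_le_integral => //=.
  + by apply/measurable_EFinP; apply: measurable_fun_powR => //; exact: measurableT_comp.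
  + by apply/measurable_EFinP; apply: measurable_fun_powR => //; exact: measurableT_comp.
  + by move=> x _; rewrite lee_fin; apply: ge0_ler_powR; rewrite ?nnegrE ?(ltW r0).
- move=> _; case: ifP => // _; apply: le_ess_sup; apply/nearW => x /=.
  by rewrite lee_fin.
Qed.

Lemma LpnormN f : Lpnorm p (fun x => - f x) = Lpnorm p f.
Proof. by rewrite /Lpnorm -[RHS]oppe_Lnorm; exact: eq_Lnorm. Qed.

Lemma LpnormB f g (A B : R) : measurable_fun setT f -> measurable_fun setT g ->
  (Lpnorm p f <= A%:E)%E -> (Lpnorm p g <= B%:E)%E ->
  (Lpnorm p (fun x => f x - g x)%R <= (A + B)%:E)%E.
Proof.
move=> mf mg fA gB; apply: LpnormD => //; first exact: measurable_funN.
by rewrite LpnormN.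
Qed.

Lemma LpnormZ c f (A : R) : measurable_fun setT f -> (Lpnorm p f <= A%:E)%E ->
  (Lpnorm p (fun x => c * f x)%R <= (`|c| * A)%:E)%E.
Proof.
move=> mf; rewrite /Lpnorm unlock.
case: p p1 => [r| |]; last by [].
- rewrite lee_fin => r1; have r0 : 0 < r by exact: lt_le_trans r1.
  move=> fA.
  have -> : (\int[mu]_x (`|(EFin \o (fun x => c * f x)%R) x| `^ r) =
      (`|c| `^ r)%:E * \int[mu]_x (`|(EFin \o f) x| `^ r))%E.
    rewrite -ge0_integralZl//.
    - by apply: eq_integral => x _ /=; rewrite -EFinM normrM powRM.
    - by apply/measurable_EFinP; apply: measurable_fun_powR => //; exact: measurableT_comp.
    - by move=> x _; exact: poweR_ge0.
  rewrite poweRM ?lee_fin ?powR_ge0//; last by apply: integral_ge0 => x _; exact: poweR_ge0.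
  rewrite poweR_EFin -powRrM mulfV ?gt_eqF// powRr1// EFinM.
  by apply: lee_wpmul2l fA; rewrite lee_fin.
- move=> _; case: ifPn => [mu0 /ess_supP fA|_ A0].
    apply/ess_supP; apply: filterS fA => x /=.
    by rewrite !lee_fin normrM => fA; rewrite ler_wpM2l.
  by rewrite lee_fin mulr_ge0.
Qed.

Lemma Lpnorm0 : Lpnorm p ((fun=> 0) : E -> R) = 0%E.
Proof.
rewrite -(Lnorm0 mu (p := p)); first exact: eq_Lnorm.
by case: p p1 => // r; rewrite lee_fin eqe => r1; rewrite gt_eqF// (lt_le_trans _ r1).
Qed.

(** The form in which Minkowski's inequality is used for all averages over space or time. The norm
    bound is asked only where the weight is nonzero, so that sources need to be controlled only on
    the time interval of interest. *)
Lemma Lpnorm_weight_le d (Z : measurableType d) (m : {sigma_finite_measure set Z -> \bar R})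
    (w : Z -> R) (G : Z -> E -> R) (C W : R) :
  measurable_fun setT w -> measurable_fun setT (fun z => G z.1 z.2) ->
  0 <= C -> 0 <= W ->
  (forall z, w z != 0 -> (Lpnorm p (G z) <= W%:E)%E) ->
  (\int[m]_z `|w z|%:E <= C%:E)%E ->
  (Lpnorm p (fun x => \int[m]_z (w z * G z x)%R)%R <= (C * W)%:E)%E.
Proof.
move=> mw mG C0 W0 GW wC; apply/lee_addgt0Pr => e e0.
have mwG z : measurable_fun setT (fun x => w z * G z x).
  by apply: measurable_funM => //; exact: measurable_section1 mG.
have C1 : 0 < C + 1 by rewrite ltr_wpDl.
(* If [W = 0], the majorant [|w z| * W] would vanish although [G z x] may be nonzero on a null set
   of [x]. Enlarging [W] by [e'] repairs this at a cost of at most [C * e'], which is at most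
   [e]. *)
set e' := e / (C + 1); have e'0 : 0 < e' by rewrite divr_gt0.
have mnw : measurable_fun setT (fun z => `|w z|) by exact: measurableT_comp.
rewrite -EFinD; apply: (Lnorm_Rintegral_le (G := fun z x => w z * G z x) (b := fun z => `|w z| * (W + e'))) => //.
- by apply: measurable_funM => //; exact: (measurableT_comp mw measurable_fst).
- exact: measurable_funM.
- by move=> z; rewrite mulr_ge0// addr_ge0// ltW.
- move=> z x /eqP; rewrite mulf_eq0 normr_eq0 (gt_eqF (ltr_wpDl W0 e'0)) orbF => /eqP ->.
  by rewrite mul0r.
- move=> z; have [wz0|wz0] := eqVneq (w z) 0.
    rewrite wz0 normr0 mul0r -[leRHS]/0%E -Lpnorm0; apply: le_Lpnorm.
    + by rewrite -wz0.
    + exact: measurable_cst.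
    + by move=> x; rewrite mul0r.
  apply: le_trans (LpnormZ (w z) _ (GW _ wz0)) _; first exact: measurable_section1 mG.
  by rewrite lee_fin ler_wpM2l// lerDl ltW.
- under eq_integral do rewrite EFinM muleC.
  rewrite ge0_integralZl//; last 2 first.
  + exact/measurable_EFinP.
  + by rewrite lee_fin addr_ge0// ltW.
  apply: le_trans (lee_wpmul2l _ wC) _; first by rewrite lee_fin addr_ge0// ltW.
  rewrite -EFinM lee_fin mulrDl mulrC lerD2l /e' -mulrA ler_piMr ?(ltW e0)//.
  by rewrite mulrC ler_pdivrMr// mul1r lerDl.
Qed.

Lemma Lpnorm_translate f (y : E) : measurable_fun setT f ->
  (Lpnorm p (fun x => f (x - y)%R) <= Lpnorm p f)%E.
Proof.
move=> mf; rewrite /Lpnorm unlock.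
case: p p1 => [r| |]; last by [].
- rewrite lee_fin => r1; have r0 : 0 < r by exact: lt_le_trans r1.
  rewrite (integral_rV_translate y (F := fun x => (`|(f x)%:E| `^ r)%E))//.
  by apply/measurable_EFinP; apply: measurable_fun_powR => //; exact: measurableT_comp.
- move=> _; case: ifPn => // mu0.
  apply/ess_supP; have := ess_sup_ge mu (abse \o (EFin \o f)).
  set s := ess_sup _ _.
  have mnf : measurable_fun setT (abse \o (EFin \o f)).
    by apply: measurableT_comp => //; exact/measurable_EFinP.
  (* The set where [|f|] exceeds its essential supremum is measurable and null, and translation
     invariance keeps its translate null. *)
  pose A := [set x : E | (s < `|(f x)%:E|)%E].
  have mA : measurable A.
    by have := emeasurable_fun_o_infty measurableT mnf s; rewrite setTI.
  move=> [N [mN N0 sN]]; exists ((fun x : E => x - y) @^-1` A); split.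
  + rewrite -[X in measurable X]setTI; apply: measurable_rV_sub => //.
  + have A0 : mu A = 0%E.
      apply/eqP; rewrite eq_le measure_ge0 andbT -N0; apply: le_measure; rewrite ?inE//.
      by move=> x Ax; apply: sN => /=; apply/negP; rewrite -ltNge.
    have mA' : measurable ((fun x : E => x - y) @^-1` A).
      by rewrite -[X in measurable X]setTI; apply: measurable_rV_sub => //.
    have iE B : measurable B -> (mu B = \int[mu]_x (\1_B x)%:E)%E.
      by move=> mB; rewrite integral_indic// setIT.
    apply: (etrans (iE _ mA')); rewrite -A0; apply: (etrans _ (esym (iE _ mA))).
    rewrite -(integral_rV_translate y (F := fun x => (\1_A x)%:E)).
      by apply: eq_integral => x _; rewrite /= !indicE.
    exact/measurable_EFinP.
  + by move=> x /= /negP; rewrite -ltNge.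
Qed.

(** Young's inequality for L^1 and L^p: after a reflection, the convolution is an average of
    translates of [f] with weight [k]. *)
Lemma Lpnorm_convolution (k f : E -> R) (C W : R) :
  measurable_fun setT k -> measurable_fun setT f -> 0 <= C -> 0 <= W ->
  (\int[mu]_y `|k y|%:E <= C%:E)%E -> (Lpnorm p f <= W%:E)%E ->
  (Lpnorm p (convolution k f) <= (C * W)%:E)%E.
Proof.
move=> mk mf C0 W0 kC fW.
have -> : convolution k f = fun x => \int[mu]_y (k y * f (x - y)).
  apply/funext => x; rewrite -[RHS](Rintegral_rV_reflect x)//.
    by apply: eq_Rintegral => y _; rewrite subKr.
  by apply: measurable_funM => //; apply: (measurableT_comp mf); exact: measurable_rV_sub.
apply: (Lpnorm_weight_le (m := mu) (w := k) (G := fun y x => f (x - y))) => //.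
  by apply: (measurableT_comp mf); apply: measurable_rV_sub.
by move=> y _; apply: le_trans fW; exact: Lpnorm_translate.
Qed.

Local Notation M := (measurableTypeR R).
Local Notation leb := (@lebesgue_measure R).

Lemma Lpnorm_hop t f (W : R) : measurable_fun setT f -> 0 <= W ->
  (Lpnorm p f <= W%:E)%E -> (Lpnorm p (hop t f) <= W%:E)%E.
Proof.
move=> mf W0 fW; rewrite -[W]mul1r; apply: Lpnorm_convolution => //.
  by apply: measurable_hk_comp.
by under eq_integral do rewrite ger0_norm ?hk_ge0//; exact: integral_hk_le1.
Qed.

Lemma Lpnorm_Qop d t f (W : R) : 0 < d -> measurable_fun setT f -> 0 <= W ->
  (Lpnorm p f <= W%:E)%E -> (Lpnorm p (Qop d t f) <= W%:E)%E.
Proof.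
move=> d0 mf W0 fW; rewrite -[W]mul1r.
apply: (Lpnorm_weight_le (m := leb) (w := rho d : M -> R) (G := fun (r : M) x => hop (t + r) f x)) => //.
- exact: measurable_rho.
- by apply: (measurable_hopF (s := cst 0) (measurable_cstF mf)); mr.
- by move=> r _; exact: Lpnorm_hop.
- by under eq_integral do rewrite ger0_norm ?rho_ge0//; exact: integral_rho_le1.
Qed.

(** The weight is dominated by [1/a] times the reversed exponential density of mean [1/a]. For
    [a = 1 / delta], this mass is the origin of the factor [delta] in the relaxation error. *)
Lemma integral_ind_exp (a t : R) : 0 < a ->
  (\int[leb]_s `|ind t s * expR (- (a * (t - s)))|%:E <= (a^-1)%:E)%E.
Proof.
move=> a0; have a'0 : 0 < a^-1 by rewrite invr_gt0.
have m1 : measurable_fun setT (fun s : M => (rho a^-1 s)%:E).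
  by apply/measurable_EFinP; exact: measurable_rho.
have m2 : measurable_fun setT (fun s : M => (rho a^-1 (t - s))%:E).
  by apply: (measurableT_comp m1); mr.
apply: (@le_trans _ _ (\int[leb]_s ((a^-1)%:E * (rho a^-1 (t - s))%:E))%E).
  apply: ge0_le_integral => //.
  - by apply/measurable_EFinP; apply: measurableT_comp => //; mr.
  - by apply: emeasurable_funM.
  - move=> s _; rewrite -EFinM lee_fin ger0_norm ?mulr_ge0 ?ind_ge0 ?expR_ge0//.
    case: (indP t s) => [[/andP[s0 st] ->]|->]; last first.
      by rewrite mul0r mulr_ge0 ?rho_ge0// ltW.
    by rewrite rho_gt0E ?subr_gt0// invrK mul1r mulrA mulVf ?gt_eqF// mul1r mulrC.
rewrite ge0_integralZl//; last 2 first.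
- by move=> s _; rewrite lee_fin rho_ge0.
- by rewrite lee_fin ltW.
rewrite (ge0_integral_reflect_1d t (F := fun s : M => (rho a^-1 s)%:E))//; last first.
  by move=> s; rewrite lee_fin rho_ge0.
rewrite -[leRHS]mule1; apply: lee_wpmul2l; first by rewrite lee_fin ltW.
exact: integral_rho_le1.
Qed.

(** Here [a] plays two roles below: the relaxation rate [1 / delta], and the exponent of the
    weighted norm in the Gronwall argument. *)
Lemma Lpnorm_ind_exp (a t W : R) (k : M -> E -> R) : 0 < a -> 0 <= W ->
  measurable_fun setT (fun z => k z.1 z.2) ->
  (forall s, 0 < s < t -> (Lpnorm p (k s) <= W%:E)%E) ->
  (Lpnorm p (fun x => \int[leb]_s (ind t s * (expR (- (a * (t - s))) * k s x))%R)%R <= (a^-1 * W)%:E)%E.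
Proof.
move=> a0 W0 mk kW.
have -> : (fun x => \int[leb]_s (ind t s * (expR (- (a * (t - s))) * k s x))) =
   (fun x => \int[leb]_s ((ind t s * expR (- (a * (t - s)))) * k s x)).
  by apply/funext => x; apply: eq_Rintegral => s _; rewrite mulrA.
apply: Lpnorm_weight_le => //.
- by mr.
- by rewrite invr_ge0 ltW.
- move=> s; case: (indP t s) => [[st _]|->]; last by rewrite mul0r eqxx.
  by move=> _; exact: kW.
- exact: integral_ind_exp.
Qed.

Lemma Lpnorm_ind (t W : R) (k : M -> E -> R) : 0 <= W ->
  measurable_fun setT (fun z => k z.1 z.2) ->
  (forall s, 0 < s < t -> (Lpnorm p (k s) <= W%:E)%E) ->
  (Lpnorm p (fun x => \int[leb]_s (ind t s * k s x)%R)%R <= (`|t| * W)%:E)%E.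
Proof.
move=> W0 mk kW; apply: Lpnorm_weight_le => //.
- by mr.
- move=> s; case: (indP t s) => [[st _]|->]; last by rewrite eqxx.
  by move=> _; exact: kW.
- by under eq_integral do rewrite ger0_norm ?ind_ge0//; exact: integral_ind_le.
Qed.


Lemma Lpnorm_Zop (a d D t W : R) (g : E -> R) : 0 < a -> 0 < d -> 0 < D -> 0 <= W ->
  measurable_fun setT g -> (Lpnorm p g <= W%:E)%E ->
  (Lpnorm p (Zop a d D t g) <= (a^-1 * (D / d * (W + W)))%:E)%E.
Proof.
move=> a0 d0 D0 W0 mg gW.
have Dd : 0 <= D / d by rewrite divr_ge0 ?ltW.
have mQ : measurable_fun setT (fun z : M * E => Qop d (a * d * (t - z.1) + D * z.1) g z.2).
  by apply: (measurable_QopF d (s := cst 0) (measurable_cstF mg)); mr.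
have mh : measurable_fun setT (fun z : M * E => hop (a * d * (t - z.1) + D * z.1) g z.2).
  by apply: (measurable_hopF (s := cst 0) (measurable_cstF mg)); mr.
apply: (Lpnorm_ind_exp (k := fun s x => D / d * (Qop d (a * d * (t - s) + D * s) g x -
   hop (a * d * (t - s) + D * s) g x))) => //.
- by rewrite mulr_ge0 ?addr_ge0.
- by apply: measurable_funM => //; exact: measurable_funB.
move=> s st.
have m1 : measurable_fun setT (Qop d (a * d * (t - s) + D * s) g).
  exact: (measurable_section1 (f := fun (s : M) x => Qop d (a * d * (t - s) + D * s) g x)).
have m2 : measurable_fun setT (hop (a * d * (t - s) + D * s) g).
  exact: (measurable_section1 (f := fun (s : M) x => hop (a * d * (t - s) + D * s) g x)).
rewrite -[X in (X * _)%:E](ger0_norm Dd); apply: LpnormZ.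
  exact: measurable_funB.
by apply: LpnormB => //; [exact: Lpnorm_Qop|exact: Lpnorm_hop].
Qed.

(** The three summands come from the datum, from the remainders [Zop] of the source slices
    accumulated over a time at most [T], and from the initial layers of the slices, whose
    exponential weight has mass at most [1/a] in [q]. *)
Lemma Lpnorm_Vsol_Qop_Usol (a d D t T U W B : R) (g : E -> R) (F : M -> E -> R) :
  0 < a -> 0 < d -> 0 < D -> 0 < t <= T -> 0 <= U -> 0 <= W ->
  measurable_fun setT g -> (forall y, `|g y| <= B) ->
  measurable_fun setT (fun z : M * E => F z.1 z.2) -> (forall s y, `|F s y| <= B) ->
  (Lpnorm p g <= U%:E)%E -> (forall s, 0 < s < t -> (Lpnorm p (F s) <= W%:E)%E) ->
  (Lpnorm p (fun x => Vsol a d D g F t x - Qop d 0 (Usol D g F t) x)%R <=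
    (a^-1 * (D / d * (U + U) + (T * (D / d * (W + W)) + W)))%:E)%E.
Proof.
move=> a0 d0 D0 /andP[t0 tT] U0 W0 mg gB mF FB gU FW.
have Dd : 0 <= D / d by rewrite divr_ge0 ?ltW.
have mF1 s : measurable_fun setT (F s) by exact: measurable_section1 mF.
have mZF : measurable_fun setT (fun z : M * E => Zop a d D (t - z.1) (F z.1) z.2).
  by apply: measurable_Zop; mr.
have mQF : measurable_fun setT (fun z : M * E => Qop d (a * d * (t - z.1)) (F z.1) z.2).
  by apply: (measurable_QopF d mF); mr.
have mZg : measurable_fun setT (Zop a d D t g).
  by apply: (measurable_Zop a d D (t := cst t) (s := cst 0) (measurable_cstF mg)); mr.
have B0 : 0 <= B by exact: le_trans (gB 0).
have -> : (fun x => Vsol a d D g F t x - Qop d 0 (Usol D g F t) x) =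
  (fun x => - (Zop a d D t g x +
     (\int[leb]_q (ind t q * Zop a d D (t - q) (F q) x) +
      \int[leb]_q (ind t q * (expR (- (a * (t - q))) * Qop d (a * d * (t - q)) (F q) x))))).
  apply/funext => x; rewrite (Vsol_Qop_Usol (B := B))//; congr (- (_ + _)).
  rewrite -RintegralD//.
  - by apply: eq_Rintegral => q _; rewrite mulrDr.
  - apply: (integrable_ind_bounded (C := `|t| * (D / d * (B + B)))).
      exact: (measurable_section2 (f := fun (q : M) (x : E) => Zop a d D (t - q) (F q) x)).
    move=> q /andP[q0 qt].
    apply: le_trans (Zop_bound a0 d0 D0 gB (t - q) x (FB q) (mF1 q)) _.
    apply: ler_wpM2r; first by rewrite mulr_ge0 ?addr_ge0.
    by rewrite !ger0_norm; lra.
  - apply: (integrable_ind_bounded (C := 1 * B)).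
      apply: measurable_funM; first by mr.
      exact: (measurable_section2 (f := fun (q : M) (x : E) => Qop d (a * d * (t - q)) (F q) x)).
    move=> q /andP[q0 qt]; rewrite normrM (ger0_norm (expR_ge0 _)).
    apply: ler_pM; [exact: expR_ge0|exact: normr_ge0| |exact: Qop_bound].
    by apply: exp_le1; rewrite ?subr_ge0 ltW.
rewrite LpnormN mulrDr; apply: LpnormD => //.
- apply: measurable_funD.
    by apply: (measurable_Rintegral_param leb (f := fun x q => ind t q * Zop a d D (t - q) (F q) x)); apply: measurable_funM; [mr|exact: (measurable_uncurry_swap (f := fun (q : M) (x : E) => Zop a d D (t - q) (F q) x))].
  apply: (measurable_Rintegral_param leb (f := fun x q => ind t q * (expR (- (a * (t - q))) * Qop d (a * d * (t - q)) (F q) x))).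
  apply: measurable_funM; first by mr.
  by apply: measurable_funM; [mr|exact: (measurable_uncurry_swap (f := fun (q : M) (x : E) => Qop d (a * d * (t - q)) (F q) x))].
- exact: Lpnorm_Zop.
rewrite mulrDr; apply: LpnormD.
- by apply: (measurable_Rintegral_param leb (f := fun x q => ind t q * Zop a d D (t - q) (F q) x)); apply: measurable_funM; [mr|exact: (measurable_uncurry_swap (f := fun (q : M) (x : E) => Zop a d D (t - q) (F q) x))].
- apply: (measurable_Rintegral_param leb (f := fun x q => ind t q * (expR (- (a * (t - q))) * Qop d (a * d * (t - q)) (F q) x))).
  apply: measurable_funM; first by mr.
  by apply: measurable_funM; [mr|exact: (measurable_uncurry_swap (f := fun (q : M) (x : E) => Qop d (a * d * (t - q)) (F q) x))].
- apply: (@le_trans _ _ (`|t| * (a^-1 * (D / d * (W + W))))%:E).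
    apply: (Lpnorm_ind (k := fun q x => Zop a d D (t - q) (F q) x)) => //.
      by apply: mulr_ge0; rewrite ?invr_ge0 ?(ltW a0)// mulr_ge0 ?addr_ge0.
    by move=> s st; apply: Lpnorm_Zop => //; exact: FW.
  rewrite lee_fin mulrCA; apply: ler_wpM2l; first by rewrite invr_ge0 ltW.
  apply: ler_wpM2r; first by rewrite mulr_ge0 ?addr_ge0.
  by rewrite gtr0_norm.
- apply: (Lpnorm_ind_exp (k := fun q x => Qop d (a * d * (t - q)) (F q) x)) => //.
  by move=> s st; apply: Lpnorm_Qop => //; exact: FW.
Qed.

End Lp_bounds.

(** * Approximation of radial kernels *)

Section step_polynomials.
Context (R : realType).

Lemma cvg_natr_expr (r : R) : 0 <= r < 1 -> n%:R * r ^+ n @[n --> \oo] --> (0 : R).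
Proof.
move=> /andP[r0 r1]; have [->|rn0] := eqVneq r 0.
  rewrite (_ : (fun n => _) = cst 0); first exact: cvg_cst.
  by apply/funext => -[|n] /=; rewrite ?mul0r// expr0n mulr0.
have rp : 0 < r by rewrite lt_neqAle eq_sym rn0.
(* With [s^2 = r], one factor [s^n] keeps [n s^n] bounded, by Bernoulli's inequality, and the other
   tends to 0. *)
set s := Num.sqrt r; have s0 : 0 < s by rewrite sqrtr_gt0.
have s1 : s < 1 by rewrite -(ger0_norm (ltW s0)) -sqrtr1 /s ger0_norm ?sqrtr_ge0// ltr_sqrt.
have rs : r = s * s by rewrite -expr2 sqr_sqrtr.
set c := s^-1 - 1; have c0 : 0 < c by rewrite subr_gt0 invf_gt1.
have bnd n : n%:R * s ^+ n <= c^-1.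
  have bern : 1 + c *+ n <= s ^- n.
    rewrite -exprVn (_ : s^-1 = 1 + c); last by rewrite addrC subrK.
    elim: n => [|k IH]; first by rewrite mulr0n addr0 expr0.
    rewrite exprS; apply: (@le_trans _ _ ((1 + c) * (1 + c *+ k))).
      rewrite mulrDl mul1r mulrDr mulr1 mulrS !addrA -subr_ge0.
      have ck : 0 <= c * (c *+ k) by rewrite mulr_ge0 ?mulrn_wge0// ltW.
      by lra.
    by rewrite ler_wpM2l// addr_ge0// ltW.
  rewrite -ler_pdivlMr ?exprn_gt0// -exprVn exprVn.
  rewrite ler_pdivlMl//; apply: le_trans bern.
  by rewrite mulr_natr lerDr.
apply: (@squeeze_cvgr _ _ _ _ (cst 0) (fun n => c^-1 * s ^+ n)).
- near=> n; rewrite mulr_ge0 ?exprn_ge0//= rs exprMn mulrA.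
  by rewrite ler_wpM2r// exprn_ge0// ltW.
- exact: cvg_cst.
- rewrite -[X in _ --> X](mulr0 c^-1); apply: cvgMr.
  by apply: cvg_expr; rewrite ger0_norm// ltW.
Unshelve. all: by end_near. Qed.

(* The exponent [n * c ^- n] makes [(1 - y ^ n) ^ N] tend to 1 for [y < c] and
   to 0 for [y >= c]. *)
Definition stepN (c : R) (n : nat) : nat := (Num.truncn (n%:R * c ^- n)).+1.

Definition stepP (c : R) (n : nat) : {poly R} := (1 - 'X^n) ^+ stepN c n.

Lemma horner_stepP c n y : (stepP c n).[y] = (1 - y ^+ n) ^+ stepN c n.
Proof. by rewrite /stepP !hornerE. Qed.

Lemma stepP_itv c n y : 0 <= y <= 1 -> 0 <= (stepP c n).[y] <= 1.
Proof.
move=> /andP[y0 y1]; rewrite horner_stepP.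
have yn1 : y ^+ n <= 1 by exact: exprn_ile1.
have yn0 : 0 <= y ^+ n by exact: exprn_ge0.
by rewrite exprn_ge0 ?exprn_ile1 ?subr_ge0// lerBlDr lerDl.
Qed.

Lemma bernoulli_le (x : R) k : 0 <= x <= 1 -> 1 - k%:R * x <= (1 - x) ^+ k.
Proof.
move=> /andP[x0 x1]; elim: k => [|k IH]; first by rewrite mul0r subr0 expr0.
rewrite exprS; apply: (@le_trans _ _ ((1 - x) * (1 - k%:R * x))).
  have : 0 <= x * (k%:R * x) by rewrite !mulr_ge0.
  by rewrite -natr1; lra.
by rewrite ler_wpM2l// subr_ge0.
Qed.

Lemma bernoulli_inv (x : R) k : 0 <= x <= 1 -> (1 - x) ^+ k * (1 + k%:R * x) <= 1.
Proof.
move=> /andP[x0 x1]; elim: k => [|k IH]; first by rewrite expr0 mul0r addr0 mulr1.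
apply: le_trans IH; rewrite exprSr -mulrA ler_wpM2l ?exprn_ge0 ?subr_ge0//.
have : 0 <= x * (k%:R * x) by rewrite !mulr_ge0.
have : 0 <= x * x by rewrite mulr_ge0.
by rewrite -natr1; lra.
Qed.

(** With [N = stepN c n], about [n c^(-n)]: for [y < c], Bernoulli gives the lower bound
    [1 - N y^n], and [N y^n] is about [n (y/c)^n], which vanishes; for [y >= c], [(1 - y^n)^N] is at
    most [1 / (1 + N y^n)], hence at most [1 / (1 + n)]. *)
Lemma stepP_cvg c y : 0 < c <= 1 -> 0 <= y <= 1 ->
  (stepP c n).[y] @[n --> \oo] --> ((y < c)%R%:R : R).
Proof.
move=> /andP[c0 c1] /andP[y0 y1].
have yn n : 0 <= y ^+ n <= 1 by rewrite exprn_ge0// exprn_ile1.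
have [yc|cy] := ltP y c.
  have y1' : y < 1 by exact: lt_le_trans c1.
  apply: (@squeeze_cvgr _ _ _ _ (fun n => 1 - (n%:R * (y / c) ^+ n + y ^+ n)) (cst 1)).
  - near=> n; rewrite (andP (stepP_itv _ _ _)).2 ?y0// andbT horner_stepP.
    apply: le_trans (bernoulli_le _ (yn n)); rewrite lerD2l lerN2.
    rewrite expr_div_n mulrA -[X in _ <= _ + X]mul1r mulrAC -mulrDl.
    apply: ler_wpM2r; first by case/andP: (yn n).
    by rewrite /stepN -natr1 lerD2r truncn_le mulr_ge0// invr_ge0 exprn_ge0// ltW.
  - rewrite -[X in _ --> X](subr0 (1 : R)); apply: cvgB; first exact: cvg_cst.
    rewrite -[X in _ --> X](addr0 (0 : R)); apply: cvgD.
      by apply: cvg_natr_expr; rewrite divr_ge0 ?(ltW c0)//= ltr_pdivrMr// mul1r.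
    by apply: cvg_expr; rewrite ger0_norm.
  - exact: cvg_cst.
apply: (@squeeze_cvgr _ _ _ _ (cst 0) (fun n => (n.+1%:R : R)^-1)).
- near=> n; rewrite (andP (stepP_itv _ _ _)).1 ?y0//= horner_stepP.
  rewrite -[leRHS]mul1r ler_pdivlMr//; apply: le_trans (bernoulli_inv (stepN c n) (yn n)).
  apply: ler_wpM2l; first by rewrite exprn_ge0// subr_ge0; case/andP: (yn n).
  rewrite -natr1 addrC lerD2l.
  apply: (@le_trans _ _ (n%:R * c ^- n * y ^+ n)).
    rewrite -mulrA ler_peMr// ler_pdivlMl ?exprn_gt0// mulr1.
    by apply: lerXn2r; rewrite ?nnegrE// ltW.
  by apply: ler_wpM2r; [case/andP: (yn n)|rewrite /stepN ltW// truncnS_gt].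
- exact: cvg_cst.
- exact: cvg_harmonic.
Unshelve. all: by end_near. Qed.

End step_polynomials.

Section weighted_approximation.
Context d (X : measurableType d) (R : realType) (m : {measure set X -> \bar R}).
Variables (z : X -> R) (comb : {poly R} -> X -> R).
Hypotheses (mz : measurable_fun setT z) (z0 : forall x, 0 <= z x).
Hypotheses (mcomb : forall P, measurable_fun setT (comb P))
  (combD : forall P Q x, comb (P + Q) x = comb P x + comb Q x)
  (combZ : forall c P x, comb (c *: P) x = c * comb P x).

Definition wdist (h k : X -> R) : \bar R := (\int[m]_x (`|h x - k x| * z x)%:E)%E.

(** The family [comb] is linear in its polynomial. There are two instances: polynomials in a
    function [z], with [z] itself as weight, and combinations of Green functions, with weight 1. *)
Definition wapprox (h : X -> R) := measurable_fun setT h /\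
  forall e, 0 < e -> exists P : {poly R}, (wdist h (comb P) <= e%:E)%E.

Lemma measurable_wdist (h k : X -> R) : measurable_fun setT h -> measurable_fun setT k ->
  measurable_fun setT (fun x => (`|h x - k x| * z x)%:E).
Proof.
move=> mh mk; apply/measurable_EFinP; apply: measurable_funM => //.
by apply: measurableT_comp => //; exact: measurable_funB.
Qed.

Lemma wdistE (h k : X -> R) : wdist h k = (\int[m]_x `|h x * z x - k x * z x|%:E)%E.
Proof. by apply: eq_integral => x _; rewrite -mulrBl normrM (ger0_norm (z0 x)). Qed.

Lemma wdist_add (h1 h2 k1 k2 : X -> R) : measurable_fun setT h1 -> measurable_fun setT h2 ->
  measurable_fun setT k1 -> measurable_fun setT k2 ->
  (wdist (fun x => h1 x + h2 x)%R (fun x => k1 x + k2 x)%R <= wdist h1 k1 + wdist h2 k2)%E.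
Proof.
move=> mh1 mh2 mk1 mk2; rewrite /wdist -ge0_integralD//; try exact: measurable_wdist.
- apply: ge0_le_integral => //.
  + by move=> x _; rewrite lee_fin mulr_ge0.
  + by apply: measurable_wdist; exact: measurable_funD.
  + by apply: emeasurable_funD; exact: measurable_wdist.
  + move=> x _; rewrite -EFinD lee_fin -mulrDl; apply: ler_wpM2r => //.
    by rewrite opprD addrACA ler_normD.
- by move=> x _; rewrite lee_fin mulr_ge0.
- by move=> x _; rewrite lee_fin mulr_ge0.
Qed.

Lemma wdist_triangle (h k l : X -> R) : measurable_fun setT h -> measurable_fun setT k ->
  measurable_fun setT l -> (wdist h l <= wdist h k + wdist k l)%E.
Proof.
move=> mh mk ml; rewrite /wdist -ge0_integralD//; try exact: measurable_wdist.
- apply: ge0_le_integral => //.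
  + by move=> x _; rewrite lee_fin mulr_ge0.
  + exact: measurable_wdist.
  + by apply: emeasurable_funD; exact: measurable_wdist.
  + move=> x _; rewrite -EFinD lee_fin -mulrDl; apply: ler_wpM2r => //.
    exact: ler_distD.
- by move=> x _; rewrite lee_fin mulr_ge0.
- by move=> x _; rewrite lee_fin mulr_ge0.
Qed.

Lemma eq_wapprox (h k : X -> R) : h =1 k -> wapprox h -> wapprox k.
Proof. by move=> /funext ->. Qed.

Lemma wapprox_comb (P : {poly R}) : wapprox (comb P).
Proof.
split; first exact: mcomb.
move=> e e0; exists P; rewrite /wdist.
under eq_integral do rewrite subrr normr0 mul0r.
by rewrite integral0 lee_fin ltW.
Qed.

Lemma wapproxD (h k : X -> R) : wapprox h -> wapprox k -> wapprox (fun x => h x + k x).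
Proof.
move=> [mh ah] [mk ak]; split; first exact: measurable_funD.
move=> e e0; have e20 : 0 < e / 2 by rewrite divr_gt0.
have [P hP] := ah _ e20; have [Q kQ] := ak _ e20; exists (P + Q).
rewrite (funext (combD P Q)).
apply: le_trans (wdist_add _ _ _ _) _ => //.
by rewrite [e in leRHS]splitr EFinD; exact: leeD.
Qed.

Lemma wapproxZ c (h : X -> R) : wapprox h -> wapprox (fun x => c * h x).
Proof.
move=> [mh ah]; split; first exact: measurable_funM.
move=> e e0; have c1 : 0 < `|c| + 1 by rewrite ltr_wpDl.
have [P hP] := ah (e / (`|c| + 1)) (divr_gt0 e0 c1); exists (c *: P).
have -> : wdist (fun x => c * h x) (comb (c *: P)) = (`|c|%:E * wdist h (comb P))%E.
  rewrite /wdist -ge0_integralZl//.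
  - by apply: eq_integral => x _; rewrite -EFinM combZ -mulrBr normrM mulrA.
  - exact: measurable_wdist.
  - by move=> x _; rewrite lee_fin mulr_ge0.
apply: le_trans (lee_wpmul2l _ hP) _; first by rewrite lee_fin.
by rewrite -EFinM lee_fin mulrCA ler_piMr ?(ltW e0)// ler_pdivrMr// mul1r lerDl.
Qed.

Lemma wapprox0 : wapprox (fun=> 0).
Proof.
apply: eq_wapprox (wapprox_comb 0) => x.
by rewrite -[RHS](mul0r (comb 0 x)) -combZ scale0r.
Qed.

Lemma wapprox_sum (I : Type) (r : seq I) (h : I -> X -> R) :
  (forall i, wapprox (h i)) -> wapprox (fun x => \sum_(i <- r) h i x).
Proof.
move=> ah; elim: r => [|i r IH].
  by apply: eq_wapprox wapprox0 => x; rewrite big_nil.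
by apply: eq_wapprox (wapproxD (ah i) IH) => x; rewrite big_cons.
Qed.

Lemma wapprox_close (h : X -> R) : measurable_fun setT h ->
  (forall e, 0 < e -> exists2 k, wapprox k & (wdist h k <= e%:E)%E) -> wapprox h.
Proof.
move=> mh hk; split => // e e0; have e20 : 0 < e / 2 by rewrite divr_gt0.
have [k [mk ak] hke] := hk _ e20; have [P kP] := ak _ e20; exists P.
apply: le_trans (wdist_triangle mh mk (mcomb P)) _.
by rewrite [e in leRHS]splitr EFinD; exact: leeD.
Qed.

End weighted_approximation.

(** * Density of the polynomials in [z] among the functions of [z], for the weight [z] *)

Section polynomial_density.
Context d (X : measurableType d) (R : realType) (m : {measure set X -> \bar R}).
Variable z : X -> R.
Hypotheses (mz : measurable_fun setT z) (z01 : forall x, 0 <= z x <= 1)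
  (iz : m.-integrable setT (EFin \o z)).

Let comb (P : {poly R}) x := P.[z x].
Local Notation papprox := (wapprox m z comb).

Let z0 x : 0 <= z x. Proof. by case/andP: (z01 x). Qed.

Lemma measurable_horner (P : {poly R}) : measurable_fun setT (fun x => P.[z x]).
Proof.
under eq_fun do rewrite horner_coef.
by apply: measurable_sum => i; apply: measurable_funM => //; exact: measurable_funX.
Qed.

Let combD P Q x : comb (P + Q) x = comb P x + comb Q x. Proof. exact: hornerD. Qed.
Let combZ c P x : comb (c *: P) x = c * comb P x. Proof. exact: hornerZ. Qed.

Let papprox_horner P : papprox (fun x => P.[z x]).
Proof. exact: (wapprox_comb m z measurable_horner). Qed.
Let papproxD h k : papprox h -> papprox k -> papprox (fun x => h x + k x).
Proof. exact: (wapproxD mz z0 measurable_horner combD). Qed.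
Let papproxZ c h : papprox h -> papprox (fun x => c * h x).
Proof. exact: (wapproxZ mz z0 measurable_horner combZ). Qed.
Let papprox_sum I (r : seq I) h : (forall i, papprox (h i)) -> papprox (fun x => \sum_(i <- r) h i x).
Proof. exact: (wapprox_sum mz z0 measurable_horner combD combZ). Qed.

(** Dominated convergence for the products with [z]; where [z] vanishes these products are 0, so
    nothing is asked of the limit there. *)
Lemma papprox_lim (h_ : nat -> X -> R) (h w : X -> R) :
  (forall n, papprox (h_ n)) -> measurable_fun setT h ->
  (forall x, z x != 0 -> h_ n x @[n --> \oo] --> h x) ->
  m.-integrable setT (EFin \o w) ->
  (forall n x, `|h_ n x| * z x <= w x) -> papprox h.
Proof.
move=> ah mh hh iw hw; apply: (wapprox_close mz z0 measurable_horner) => // e e0.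
have mh_ n : measurable_fun setT (h_ n) by case: (ah n).
have mhz (k : X -> R) : measurable_fun setT k -> measurable_fun setT (fun x => (k x * z x)%:E).
  by move=> mk; apply/measurable_EFinP; exact: measurable_funM.
have hz x : h_ n x * z x @[n --> \oo] --> h x * z x.
  have [zx|zx] := eqVneq (z x) 0.
    by rewrite zx; under eq_fun do rewrite mulr0; rewrite mulr0; exact: cvg_cst.
  by apply: cvgMl; exact: hh.
have whz x n : (`|(h_ n x * z x)%:E| <= (EFin \o w) x)%E.
  by rewrite /= lee_fin normrM (ger0_norm (z0 x)).
have hae : {ae m, forall x, setT x -> (h_ n x * z x)%:E @[n --> \oo] --> (h x * z x)%:E}.
  by apply: aeW => x _; apply: cvg_EFin; [exact: nearW|exact: hz].
have [_ /fine_cvgP[fin cv] _] := @dominated_convergence _ X R m setT measurableT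
  (fun n x => (h_ n x * z x)%:E) (fun x => (h x * z x)%:E) (EFin \o w)
  (fun n => mhz _ (mh_ n)) (mhz _ mh)
  hae iw (aeW _ (fun x n _ => whz x n)).
have /cvgrPdist_lt/(_ _ e0) cv' := cv.
have [n _ nP] := filterI fin cv'.
have [fn en] := nP n (leqnn n).
exists (h_ n) => //; have -> : wdist m z h (h_ n) = (\int[m]_x `|(h_ n x * z x)%:E - (h x * z x)%:E|)%E.
  apply: eq_integral => x _; rewrite -EFinB/= -mulrBl normrM (ger0_norm (z0 x)).
  by rewrite distrC.
move: en; rewrite sub0r normrN /= => en.
by apply: (@le_trans _ _ (fine _)%:E); [rewrite fineK|rewrite lee_fin; apply: le_trans (ltW en); exact: ler_norm].
Qed.

Lemma papprox_ray c : papprox (fun x => (z x < c)%R%:R).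
Proof.
have [c0|c0] := leP c 0.
  apply: eq_wapprox (papprox_horner 0) => x; rewrite horner0.
  by rewrite ltNge (le_trans c0 (z0 x)).
have [c1|c1] := leP c 1; last first.
  apply: eq_wapprox (papprox_horner 1) => x; rewrite hornerC.
  by case/andP: (z01 x) => _ z1; rewrite (le_lt_trans z1 c1).
have c01 : 0 < c <= 1 by rewrite c0.
apply: (papprox_lim (h_ := fun n x => (stepP c n).[z x]) (w := z)) => //.
- rewrite (_ : (fun x => _) = fun x => if z x < c then 1 else 0).
    by apply: measurable_fun_ifT => //; exact: measurable_fun_ltr.
  by apply/funext => x; case: (z x < c).
- by move=> x _; exact: stepP_cvg.
- move=> n x; have /andP[s0 s1] := stepP_itv c n (z01 x).
  by rewrite ger0_norm// ler_piMl.
Qed.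

Lemma sum_indic_trivIset (T : Type) (F : (set T)^nat) y n : trivIset setT F ->
  \sum_(i <- index_iota 0 n) \1_(F i) y = (`[< exists2 k, (k < n)%N & F k y >])%:R :> R.
Proof.
move=> tF; case: asboolP => [[k kn Fk]|nF]; last first.
  rewrite big_nat_cond big1// => i /andP[/andP[_ iN] _]; rewrite indicE memNset// => Fi.
  by apply: nF; exists i.
rewrite (bigD1_seq k)//= ?mem_index_iota ?iota_uniq// indicE mem_set// big1 ?addr0// => i ik.
rewrite indicE memNset// => Fi; move/eqP: ik; apply.
by apply: tF => //; exists y.
Qed.

(** Open rays are stable under intersection and generate the Borel sets, and the sets whose
    indicator is approximable form a Dynkin system: complements by linearity, disjoint unions by
    [papprox_lim]. *)
Lemma papprox_set (A : set (measurableTypeR R)) : measurable A -> papprox (fun x => \1_A (z x)).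
Proof.
pose G := [set A : set (measurableTypeR R) | exists c, A = `]-oo, c[%classic].
have mG : (@measurable _ (measurableTypeR R)) = <<s G >> by exact: RGenInftyO.measurableE.
rewrite mG; move: A.
apply: (dynkin_induction (P := fun A => papprox (fun x => \1_A (z x)))) => //.
- move=> _ _ [a ->] [b ->]; exists (Num.min a b).
  by apply/seteqP; split => x /=; rewrite !in_itv/= lt_min => /andP.
- by apply: eq_wapprox (papprox_horner 1) => x; rewrite hornerC indicT.
- move=> _ [c ->]; apply: eq_wapprox (papprox_ray c) => x.
  by rewrite indicE mem_setE in_itv.
- move=> A mA aA; apply: eq_wapprox (papproxD (papprox_horner 1) (papproxZ (-1) aA)) => x.
  by rewrite hornerC !indicE in_setC; case: (_ \in A); rewrite ?mulr1 ?mulr0 ?addr0 ?subrr.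
- move=> F mF tF aF.
  apply: (papprox_lim (h_ := fun n x => \sum_(i <- index_iota 0 n) \1_(F i) (z x)) (w := z)) => //.
  + by move=> n; exact: papprox_sum.
  + apply: measurableT_comp => //; apply: measurable_indic; exact: bigcup_measurable.
  + move=> x _; have [[k _ Fk]|nF] := pselect ((\bigcup_k F k) (z x)).
      rewrite [X in _ --> X](_ : _ = 1); last by rewrite indicE mem_set//; exists k.
      apply: (@cvg_near_cst); exists k.+1 => // n /= kn.
      by rewrite sum_indic_trivIset// asboolT//; exists k.
    rewrite [X in _ --> X](_ : _ = 0); last by rewrite indicE memNset.
    apply: cvg_near_cst; apply: nearW => n.
    by rewrite sum_indic_trivIset// asboolF// => -[k _ Fk]; apply: nF; exists k.
  + by move=> n x; rewrite sum_indic_trivIset//; case: asbool; rewrite ?normr1 ?mul1r ?normr0 ?mul0r.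
Qed.

Import HBNNSimple.

(** The usual passage from indicators to simple functions, then by monotone approximation to
    nonnegative functions, then to differences. The product with [z] is dominated throughout by
    [|h (z x)| * z x]. *)
Lemma papprox_comp (h : R -> R) : measurable_fun setT (h : measurableTypeR R -> R) ->
  m.-integrable setT (EFin \o (fun x => h (z x) * z x)) -> papprox (h \o z).
Proof.
pose M := measurableTypeR R.
have pos (k : M -> R) : measurable_fun setT k -> (forall y, 0 <= k y) ->
    m.-integrable setT (EFin \o (fun x => k (z x) * z x)) -> papprox (k \o z).
  move=> mk k0 ik.
  have mk' : measurable_fun setT (EFin \o k) by exact/measurable_EFinP.
  pose g n : {nnsfun M >-> R} := nnsfun_approx measurableT mk' n.
  have gk n y : g n y <= k y.
    rewrite -lee_fin /g nnsfun_approxE; apply: le_approx => // x _.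
    by rewrite lee_fin.
  apply: (papprox_lim (h_ := fun n x => g n (z x)) (w := fun x => k (z x) * z x)) => //.
  - move=> n; under eq_fun do rewrite fimfunEord.
    apply: papprox_sum => i; apply: papproxZ; apply: papprox_set.
    by apply: measurable_funPTI; exact: measurable_set1.
  - exact: measurableT_comp.
  - move=> x _.
    have : (EFin \o g^~ (z x)) n @[n --> \oo] --> (k (z x))%:E.
      by apply: (@cvg_nnsfun_approx _ M R setT measurableT _ mk') => // y _; rewrite lee_fin.
    by move/fine_cvgP => -[].
  - by move=> n x; rewrite ger0_norm// ler_wpM2r.
move=> mh ih.
have mhM : measurable_fun setT (h : M -> R) by [].
have part (k : M -> R) : measurable_fun setT k -> (forall y, 0 <= k y <= `|h y|) -> papprox (k \o z).
  move=> mk kh; apply: pos => //; first by move=> y; case/andP: (kh y).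
  apply: le_integrable ih => //.
    apply/measurable_EFinP; apply: measurable_funM => //; exact: (measurableT_comp mk mz).
  move=> x _; have /andP[k0 kx] := kh (z x).
  by rewrite /= lee_fin !normrM ler_wpM2r// ger0_norm.
have p1 : papprox ((fun y => Num.max (h y) 0) \o z).
  apply: part; first exact: measurable_maxr.
  by move=> y; rewrite le_max lexx orbT/= ge_max normr_ge0 andbT ler_norm.
have p2 : papprox ((fun y => Num.max (- h y) 0) \o z).
  apply: part; first by apply: measurable_maxr => //; exact: measurable_funN.
  by move=> y; rewrite le_max lexx orbT/= ge_max normr_ge0 andbT -normrN ler_norm.
apply: eq_wapprox (papproxD p1 (papproxZ (-1) p2)) => x /=.
have [hz|hz] := lerP (h (z x)) 0.
  by rewrite max_l ?oppr_ge0//; lra.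
by rewrite max_r ?oppr_le0 ?(ltW hz)//; lra.
Qed.

End polynomial_density.

(** * Density of the Green functions in the radial L^1 kernels *)

Section green_density.
Context (R : realType) (n : nat).
Local Notation E := ('rV[R]_n).
Local Notation mu := (lebesgue_rV R n).
Local Notation M := (measurableTypeR R).
Local Notation leb := (@lebesgue_measure R).

Let e1 : (1 <= 1 :> \bar R)%E. Proof. exact: lexx. Qed.

Definition mixh (psi : M -> R) (x : E) : R := \int[leb]_r (psi r * hk r x).

Lemma L1normE (h : E -> R) : Lpnorm 1 h = (\int[mu]_x `|h x|%:E)%E.
Proof. by rewrite /Lpnorm Lnorm1; apply: eq_integral. Qed.

Lemma measurable_mixh psi : measurable_fun setT psi -> measurable_fun setT (mixh psi).
Proof.
move=> mpsi; apply: (measurable_Rintegral_param leb (f := fun x r => psi r * hk r x)).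
apply: measurable_funM; first exact: (measurableT_comp mpsi measurable_snd).
by apply: measurable_hk_comp; [exact: measurable_snd|exact: measurable_fst].
Qed.

(** The mixture may diverge at some points, for instance at the origin, where [Rintegral] returns a
    default value. Identities between mixtures therefore hold only almost everywhere and are stated
    in L^1. *)
Lemma mixh_ae_integrable psi : leb.-integrable setT (EFin \o psi) ->
  {ae mu, forall x, leb.-integrable setT (EFin \o (fun r => psi r * hk r x))}.
Proof.
move=> ipsi; have mpsi : measurable_fun setT psi by apply/measurable_EFinP; exact: (measurable_int _ ipsi).
have mf : measurable_fun setT (fun z : M * E => psi z.1 * hk z.1 z.2).
  apply: measurable_funM; first exact: (measurableT_comp mpsi measurable_fst).
  by apply: measurable_hk_comp; [exact: measurable_fst|exact: measurable_snd].
have /ae_integrable2 : (leb \x mu)%E.-integrable setT (fun z : M * E => (psi z.1 * hk z.1 z.2)%:E).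
  apply/integrable12ltyP; first exact/measurable_EFinP.
  apply: (dominated_integral_lty (f := fun r x => psi r * hk r x) (k := fun r x => hk r x)
    (w := fun r => `|psi r|) (C := 1)) => //.
  - by apply: measurable_hk_comp; [exact: measurable_fst|exact: measurable_snd].
  - exact: (integrable_abse ipsi).
  - by move=> r x; exact: hk_ge0.
  - by move=> r; exact: integral_hk_le1.
  - by move=> r x; rewrite normrM (ger0_norm (hk_ge0 _ _)).
done.
Qed.

(** Heat kernels have mass at most one, so mixing is a contraction from densities in time to kernels
    in L^1; approximating a kernel reduces to approximating its density on the half-line. *)
Lemma L1_mixh_sub (psi1 psi2 : M -> R) (C : R) :
  leb.-integrable setT (EFin \o psi1) -> leb.-integrable setT (EFin \o psi2) ->
  (\int[leb]_r `|psi1 r - psi2 r|%:E <= C%:E)%E -> 0 <= C ->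
  (Lpnorm 1 (fun x => mixh psi1 x - mixh psi2 x)%R <= C%:E)%E.
Proof.
move=> i1 i2 dC C0.
have m1 : measurable_fun setT psi1 by apply/measurable_EFinP; exact: (measurable_int _ i1).
have m2 : measurable_fun setT psi2 by apply/measurable_EFinP; exact: (measurable_int _ i2).
have -> : Lpnorm 1 (fun x : E => mixh psi1 x - mixh psi2 x) =
   Lpnorm 1 (fun x : E => \int[leb]_r ((psi1 r - psi2 r) * hk r x)).
  rewrite !L1normE; apply: ae_eq_integral => //.
  - apply/measurable_EFinP; apply: measurableT_comp => //.
    by apply: measurable_funB; exact: measurable_mixh.
  - apply/measurable_EFinP; apply: measurableT_comp => //.
    by apply: measurable_mixh; exact: measurable_funB.
  apply: filterS2 (mixh_ae_integrable i1) (mixh_ae_integrable i2) => x j1 j2 _.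
  rewrite /mixh -RintegralB//; congr (`|_|%:E).
  by apply: eq_Rintegral => r _; rewrite mulrBl.
rewrite -[C]mulr1; apply: (Lpnorm_weight_le e1 (m := leb) (w := fun r => psi1 r - psi2 r) (G := fun (r : M) x => hk r x)) => //.
- exact: measurable_funB.
- by apply: measurable_hk_comp; [exact: measurable_fst|exact: measurable_snd].
- move=> r _; rewrite L1normE; under eq_integral do rewrite ger0_norm ?hk_ge0//.
  exact: integral_hk_le1.
Qed.

Lemma L1_mixh_linear c (psi1 psi2 : M -> R) :
  leb.-integrable setT (EFin \o psi1) -> leb.-integrable setT (EFin \o psi2) ->
  (Lpnorm 1 (fun x => mixh (fun r => c * psi1 r + psi2 r) x - (c * mixh psi1 x + mixh psi2 x))%R = 0)%E.
Proof.
move=> i1 i2.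
have m1 : measurable_fun setT psi1 by apply/measurable_EFinP; exact: (measurable_int _ i1).
have m2 : measurable_fun setT psi2 by apply/measurable_EFinP; exact: (measurable_int _ i2).
rewrite L1normE -[RHS](integral0 mu setT); apply: ae_eq_integral => //.
  apply/measurable_EFinP; apply: measurableT_comp => //.
  apply: measurable_funB.
    by apply: measurable_mixh; apply: measurable_funD => //; exact: measurable_funM.
  apply: measurable_funD; last exact: measurable_mixh.
  by apply: measurable_funM => //; exact: measurable_mixh.
apply: filterS2 (mixh_ae_integrable i1) (mixh_ae_integrable i2) => x j1 j2 _.
rewrite /mixh -RintegralZl// -RintegralD//; last first.
  by apply: eq_integrable (integrableZl measurableT c j1).
under eq_Rintegral do rewrite mulrDl -mulrA.
by rewrite subrr normr0.
Qed.

(** The coefficient of degree [j] goes with the diffusivity [1/(j+1)], whose mixing density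
    [(j+1) exp(- (j+1) r)] is a multiple of the power [j + 1] of [exp(- r)]. *)
Definition gmcomb (P : {poly R}) (x : E) : R := \sum_(j < size P) P`_j * gm (j.+1%:R^-1) x.

Lemma gmcomb_widen (P : {poly R}) N x : (size P <= N)%N ->
  gmcomb P x = \sum_(j < N) P`_j * gm (j.+1%:R^-1) x.
Proof.
move=> PN; rewrite /gmcomb (big_ord_widen _ (fun j => P`_j * gm (j.+1%:R^-1) x) PN).
rewrite [RHS](bigID (fun j : 'I_N => j < size P)%N)/= [X in _ + X]big1 ?addr0// => j.
by rewrite -leqNgt => Pj; rewrite nth_default// mul0r.
Qed.

Lemma gmcombD P Q x : gmcomb (P + Q) x = gmcomb P x + gmcomb Q x.
Proof.
pose N := maxn (size P) (size Q).
rewrite (@gmcomb_widen (P + Q) N)// ?(leq_trans (size_polyD _ _))//.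
rewrite (@gmcomb_widen P N) ?leq_maxl// (@gmcomb_widen Q N) ?leq_maxr//.
by rewrite -big_split/=; apply: eq_bigr => j _; rewrite coefD mulrDl.
Qed.

Lemma gmcombZ c P x : gmcomb (c *: P) x = c * gmcomb P x.
Proof.
rewrite (@gmcomb_widen (c *: P) (size P)) ?size_scale_leq//.
by rewrite mulr_sumr; apply: eq_bigr => j _; rewrite coefZ mulrA.
Qed.

Lemma measurable_gmcomb P : measurable_fun setT (gmcomb P).
Proof.
by apply: measurable_sum => j; apply: measurable_funM => //; exact: measurable_gm.
Qed.

Local Notation gapprox := (wapprox mu (fun=> 1) gmcomb).

Let one0 (x : E) : 0 <= 1 :> R. Proof. exact: ler01. Qed.
Let m1 : measurable_fun setT ((fun=> 1) : E -> R). Proof. exact: measurable_cst. Qed.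

Lemma wdist1 (h k : E -> R) : wdist mu (fun=> 1) h k = Lpnorm 1 (fun x => h x - k x).
Proof. by rewrite L1normE; apply: eq_integral => x _; rewrite mulr1. Qed.

Let gapproxD h k : gapprox h -> gapprox k -> gapprox (fun x => h x + k x).
Proof. exact: (wapproxD m1 one0 measurable_gmcomb gmcombD). Qed.
Let gapproxZ c h : gapprox h -> gapprox (fun x => c * h x).
Proof. exact: (wapproxZ m1 one0 measurable_gmcomb gmcombZ). Qed.
Let gapprox_sum I (r : seq I) h : (forall i, gapprox (h i)) -> gapprox (fun x => \sum_(i <- r) h i x).
Proof. exact: (wapprox_sum m1 one0 measurable_gmcomb gmcombD gmcombZ). Qed.

Lemma gapprox_gm j : gapprox (gm (j.+1%:R^-1)).
Proof.
apply: eq_wapprox (wapprox_comb mu (fun=> 1) measurable_gmcomb 'X^j) => x.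
rewrite (@gmcomb_widen _ j.+1) ?size_polyXn// (bigD1 ord_max)//= coefXn eqxx mul1r.
rewrite big1 ?addr0// => i ij; rewrite coefXn; case: eqP => [e|_]; last by rewrite mul0r.
by move/negP: ij; case; apply/eqP; exact: val_inj.
Qed.

Lemma gapprox_close (h : E -> R) : measurable_fun setT h ->
  (forall e, 0 < e -> exists2 k, gapprox k & (Lpnorm 1 (fun x => h x - k x)%R <= e%:E)%E) -> gapprox h.
Proof.
move=> mh hk; apply: (wapprox_close m1 one0 measurable_gmcomb) => // e /hk[k ak kh].
by exists k => //; rewrite wdist1.
Qed.

Lemma integrable_rho_sum (I : Type) (s : seq I) (c : I -> R) (j : I -> nat) :
  leb.-integrable setT (EFin \o (fun r : M => \sum_(i <- s) c i * rho ((j i).+1%:R^-1) r)).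
Proof.
have i0 i : leb.-integrable setT (EFin \o (fun r : M => c i * rho ((j i).+1%:R^-1) r)).
  rewrite (_ : _ \o _ = (fun r => (c i)%:E * (rho ((j i).+1%:R^-1) r)%:E)%E)//.
  by apply: integrableZl => //; apply: integrable_rho; rewrite invr_gt0.
elim: s => [|i s IH].
  rewrite (_ : _ \o _ = cst 0%E); first exact: integrable0.
  by apply/funext => r /=; rewrite big_nil.
apply: eq_integrable (integrableD measurableT (i0 i) IH) => // r _.
by rewrite /= big_cons.
Qed.

(** Each step uses an approximant at L^1 distance 0 instead of an equality of functions, mixing
    being linear only almost everywhere. *)
Lemma gapprox_mixh_sum (I : Type) (s : seq I) (c : I -> R) (j : I -> nat) :
  gapprox (mixh (fun r => \sum_(i <- s) c i * rho ((j i).+1%:R^-1) r)).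
Proof.
elim: s => [|i s IH].
  apply: eq_wapprox (gapproxZ 0 (gapprox_gm 0)) => x; rewrite mul0r /mixh.
  by under eq_Rintegral do rewrite big_nil mul0r; rewrite Rintegral_cst ?mul0r.
apply: gapprox_close => [|e e0].
  by apply: measurable_mixh; apply/measurable_EFinP; exact: (measurable_int _ (integrable_rho_sum _ _ _)).
exists (fun x => c i * gm ((j i).+1%:R^-1) x + mixh (fun r => \sum_(k <- s) c k * rho ((j k).+1%:R^-1) r) x).
  by apply: gapproxD => //; apply: gapproxZ; exact: gapprox_gm.
have -> : mixh (fun r => \sum_(k <- i :: s) c k * rho ((j k).+1%:R^-1) r) =
   mixh (fun r => c i * rho ((j i).+1%:R^-1) r + \sum_(k <- s) c k * rho ((j k).+1%:R^-1) r).
  by congr mixh; apply/funext => r; rewrite big_cons.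
rewrite /gm L1_mixh_linear//; first by rewrite lee_fin ltW.
  by apply: integrable_rho; rewrite invr_gt0.
exact: integrable_rho_sum.
Qed.

Lemma Rintegral_ind1 t : 0 <= t -> \int[leb]_s ind t s = t.
Proof.
move=> t0; have mc : measurable_fun setT (cst 1 : M -> R) by [].
transitivity (\int[leb]_s (ind t s * 1)); first by apply: eq_Rintegral => s _; rewrite mulr1.
rewrite -(Rintegral_ind (f := cst 1) mc) //.
have mi : measurable (`[0, t]%classic : set M) by exact: measurable_itv.
rewrite (Rintegral_cst leb mi) mul1r.
by rewrite [X in fine X]lebesgue_measure_itv/= lte_fin; case: ltP => [_|t0']; rewrite ?oppr0 ?adde0//=; lra.
Qed.

(** Since [t0 / t <= 1], its power [n / 2] is at least its power [n], to which Bernoulli's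
    inequality applies. *)
Lemma powR_near1 (t0 t : R) : 0 < t0 -> t0 <= t -> 1 - (t0 / t) `^ (n%:R / 2) <= n%:R * ((t - t0) / t0).
Proof.
move=> t00 t0t; have tp : 0 < t by exact: lt_le_trans t0t.
set s := t0 / t; have s01 : 0 <= s <= 1.
  by rewrite divr_ge0 ?(ltW t00) ?(ltW tp)//= ler_pdivrMr// mul1r.
have sn : s ^+ n <= s `^ (n%:R / 2).
  rewrite -powR_mulrn; last by case/andP: s01.
  have sp : 0 < s <= 1 by rewrite divr_gt0//=; case/andP: s01.
  apply: ger_powR => //; have : 0 <= n%:R :> R by [].
  by lra.
have b : 1 - n%:R * (1 - s) <= s ^+ n.
  have := @bernoulli_le _ (1 - s) n; rewrite subKr; apply.
  by case/andP: s01 => s0 s1; apply/andP; split; lra.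
have : n%:R * (1 - s) <= n%:R * ((t - t0) / t0).
  apply: ler_wpM2l => //; rewrite /s.
  have -> : 1 - t0 / t = (t - t0) / t by field; rewrite gt_eqF.
  by apply: ler_wpM2l; rewrite ?subr_ge0// lef_pV2.
by lra.
Qed.

(** The Dirac mass at [t0] is first spread into a uniform density [phi] on a short interval, which
    [hk_L1_dist] makes harmless; [phi] is then approximated by combinations of exponentials, that
    is, by polynomials in [exp(- r)]. *)
Lemma gapprox_hk t0 : 0 < t0 -> gapprox (hk t0).
Proof.
move=> t00; have mhk t : measurable_fun setT (hk t : E -> R) by exact: measurable_hk_comp.
apply: gapprox_close => // e e0.
(* The L^1 distance between the kernels at [t0] and at a time within [eta] is at most
   [2 n eta / t0], hence at most [e / 2]. *)
pose eta := e * t0 / (4 * n.+1%:R).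
have eta0 : 0 < eta by rewrite divr_gt0// mulr_gt0.
pose phi (r : M) : R := eta^-1 * (ind (t0 + eta) r - ind t0 r).
have mphi : measurable_fun setT phi by apply: measurable_funM => //; mr.
have phi01 r : ind (t0 + eta) r - ind t0 r = ((t0 <= r) && (r < t0 + eta))%:R.
  rewrite !indE; case: (leP t0 r) => [tr|rt].
    by rewrite andbF subr0 (lt_le_trans t00 tr).
  by rewrite andbT (lt_trans rt) ?ltrDl// andbT subrr.
have phi0 r : 0 <= phi r by rewrite mulr_ge0 ?invr_ge0 ?(ltW eta0)// phi01.
have idiff : leb.-integrable setT (EFin \o (fun r => ind (t0 + eta) r - ind t0 r)).
  apply: eq_integrable (integrableB measurableT (integrable_ind (t0 + eta)) (integrable_ind t0)) => //.
have phi1 : \int[leb]_r phi r = 1.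
  rewrite RintegralZl// RintegralB//; try exact: integrable_ind.
  by rewrite !Rintegral_ind1 ?addr_ge0 ?(ltW t00) ?(ltW eta0)// addrAC subrr add0r mulVf// gt_eqF.
have iphi : leb.-integrable setT (EFin \o phi).
  apply: eq_integrable (integrableZl measurableT eta^-1 idiff) => //.
have phin : (\int[leb]_r `|phi r|%:E <= 1)%E.
  under eq_integral do rewrite ger0_norm//.
  rewrite -[leRHS]/(1%:E) -phi1 /Rintegral fineK//.
  exact: integrable_fin_num iphi.
have phisupp r : phi r != 0 -> t0 <= r < t0 + eta.
  by rewrite /phi phi01 mulf_eq0 negb_or pnatr_eq0 eqb0 negbK => /andP[].
have near r : phi r != 0 -> (Lpnorm 1 (fun x : E => hk t0 x - hk r x)%R <= (e / 2)%:E)%E.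
  move=> /phisupp/andP[t0r rt].
  rewrite L1normE; under eq_integral do rewrite distrC.
  apply: (le_trans (hk_L1_dist n t00 t0r)); rewrite lee_fin.
  have := powR_near1 t00 t0r.
  have : n%:R * ((r - t0) / t0) <= e / 4.
    apply: (@le_trans _ _ (n%:R * (eta / t0))).
      apply: ler_wpM2l => //; apply: ler_wpM2r; first by rewrite invr_ge0 ltW.
      by lra.
    have -> : n%:R * (eta / t0) = e / 4 * (n%:R / n.+1%:R).
      have : n.+1%:R != 0 :> R by rewrite pnatr_eq0.
      by rewrite /eta; move: (n.+1%:R) => N N0; field; rewrite N0 gt_eqF.
    by rewrite ler_piMr ?divr_ge0 ?(ltW e0)// ler_pdivrMr// mul1r ler_nat.
  by lra.
exists (mixh phi); last first.
  have -> : Lpnorm 1 (fun x : E => hk t0 x - mixh phi x) =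
     Lpnorm 1 (fun x : E => \int[leb]_r (phi r * (hk t0 x - hk r x))).
    rewrite !L1normE; apply: ae_eq_integral => //.
    - apply/measurable_EFinP; apply: measurableT_comp => //.
      by apply: measurable_funB => //; exact: measurable_mixh.
    - apply/measurable_EFinP; apply: measurableT_comp => //.
      apply: (measurable_Rintegral_param leb (f := fun x r => phi r * (hk t0 x - hk r x))).
      apply: measurable_funM; first exact: (measurableT_comp mphi measurable_snd).
      apply: measurable_funB; first by apply: measurable_hk_comp => //; exact: measurable_fst.
      by apply: measurable_hk_comp; [exact: measurable_snd|exact: measurable_fst].
    apply: filterS (mixh_ae_integrable iphi) => x jx _; congr (`|_|%:E).
    have ic : leb.-integrable setT (EFin \o (fun r => phi r * hk t0 x)).
      apply: eq_integrable (integrableZr measurableT (hk t0 x) iphi) => // r _.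
    transitivity (\int[leb]_r (phi r * hk t0 x) - mixh phi x).
      by rewrite RintegralZr// phi1 mul1r.
    rewrite -RintegralB//.
    by apply: eq_Rintegral => r _; rewrite mulrBr.
  apply: (@le_trans _ _ (1 * (e / 2))%:E); last by rewrite lee_fin mul1r; lra.
  apply: (Lpnorm_weight_le e1 (m := leb) (w := phi) (G := fun (r : M) x => hk t0 x - hk r x)) => //.
  - apply: measurable_funB; first by apply: measurable_hk_comp => //; exact: measurable_snd.
    by apply: measurable_hk_comp; [exact: measurable_fst|exact: measurable_snd].
  - by rewrite divr_ge0// ltW.
pose z (r : M) : R := if 0 < r then expR (- r) else 0.
have mz : measurable_fun setT z.
  by apply: measurable_fun_ifT => //; [exact: measurable_gt0|mr].
have z01 r : 0 <= z r <= 1.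
  by rewrite /z; case: ltP => r0; rewrite ?lexx ?ler01// expR_ge0/= -expR0 ler_expR oppr_le0 ltW.
have zrho r : z r = rho 1 r.
  rewrite /z; case: ifP => r0; last by rewrite /rho r0.
  by rewrite rho_gt0E// invr1 mul1r mulr1.
have iz : leb.-integrable setT (EFin \o z).
  by rewrite (funext zrho); apply: integrable_rho.
(* Chosen so that [h] evaluated at [z], times the weight [z], is [phi]; the integrability required
   by [papprox_comp] is then that of [phi]. *)
pose h (y : R) := phi (- ln y) * expR (- ln y).
have hz r : h (z r) * z r = phi r.
  rewrite /h /z; case: ltP => r0.
    by rewrite expRK opprK -mulrA -expRD subrr expR0 mulr1.
  rewrite mulr0; apply/esym/eqP; apply: contraT => /phisupp/andP[tr _].
  by move: (lt_le_trans t00 tr); rewrite ltNge r0.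
have mln : measurable_fun setT (fun y : M => - ln y) by apply: measurable_funN; exact: measurable_ln.
have mh : measurable_fun setT (h : M -> R).
  apply: measurable_funM; first exact: (measurableT_comp mphi mln).
  exact: (measurableT_comp (@measurable_expR R) mln).
have ih : leb.-integrable setT (EFin \o (fun r => h (z r) * z r)).
  by under eq_fun do rewrite hz.
have [mhz ah] := papprox_comp mz z01 iz mh ih.
have mphi' : measurable_fun setT (mixh phi) by exact: measurable_mixh.
apply: gapprox_close => // e' e'0; have [P hP] := ah _ e'0.
(* The coefficient [1/(j+1)] removes the normalisation of the exponential density, so that [psi] is
   the approximating polynomial in [z], times the weight [z]. *)
pose psi (r : M) := \sum_(j <- index_enum 'I_(size P)) (P`_j / j.+1%:R) * rho (j.+1%:R^-1) r.
have psiE r : psi r = P.[z r] * z r.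
  rewrite /psi horner_coef mulr_suml; apply: eq_bigr => j _.
  rewrite -mulrA -mulrA; congr (_ * _).
  have [r0|r0] := ltP 0 r; last by rewrite /rho /z ltNge r0 /= !mulr0.
  rewrite rho_gt0E// invrK mulrA mulVf// mul1r -exprSr /z r0 -expRM_natl.
  by congr (expR _); rewrite mulrN mulrC.
exists (mixh psi); first exact: gapprox_mixh_sum.
apply: L1_mixh_sub => //; last exact: ltW.
  exact: integrable_rho_sum.
apply: le_trans hP; rewrite wdistE; last by move=> r; case/andP: (z01 r).
by under [X in (_ <= X)%E]eq_integral do rewrite /= hz -psiE.
Qed.

(** A radial [K] is a function of [z = exp(- |x|^2)], to which [papprox_comp] applies. A polynomial
    in [z] times the weight [z] involves only powers [z^(k+1)], which are multiples of heat kernels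
    at the times [1 / (4 (k+1))]. *)
Lemma gapprox_radial (K : E -> R) : (0 < n)%N -> mu.-integrable setT (EFin \o K) -> radial K ->
  gapprox K.
Proof.
move=> n0 iK rK.
have mK : measurable_fun setT K by apply/measurable_EFinP; exact: (measurable_int _ iK).
pose z (x : E) : R := expR (- enorm x ^+ 2).
have mz : measurable_fun setT z.
  apply: (measurableT_comp (@measurable_expR R)); apply: measurable_funN.
  exact: measurable_enorm_sqr.
have z01 x : 0 <= z x <= 1.
  by rewrite expR_ge0/= -expR0 ler_expR oppr_le0 sqr_ge0.
have zhk k x : z x ^+ k.+1 = (4 * pi * (4 * k.+1%:R)^-1) `^ (n%:R / 2) * hk ((4 * k.+1%:R)^-1) x.
  have k0 : 0 < (4 * k.+1%:R)^-1 :> R by rewrite invr_gt0 mulr_gt0.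
  rewrite /hk k0 /heat !mulr1 powRN mulrA mulfV ?mul1r; last first.
    by rewrite gt_eqF// powR_gt0// mulr_gt0// mulr_gt0// pi_gt0.
  rewrite /z -expRM_natl; congr (expR _).
  by rewrite mulrN; congr (- _); field; rewrite addrC natr1 pnatr_eq0.
have iz : mu.-integrable setT (EFin \o z).
  rewrite (_ : z = fun x => (4 * pi * (4 * 1)^-1) `^ (n%:R / 2) * hk ((4 * 1)^-1) x); last first.
    by apply/funext => x; rewrite -(zhk 0%N) expr1.
  have ih : mu.-integrable setT (EFin \o (hk ((4 * 1)^-1) : E -> R)).
    apply/integrableP; split; first by apply/measurable_EFinP; exact: measurable_hk_comp.
    under eq_integral do rewrite /= ger0_norm ?hk_ge0//.
    by apply: le_lt_trans (integral_hk_le1 _ _) _; rewrite ltry.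
  by apply: eq_integrable (integrableZl measurableT _ ih).
(* The value of [K] on the first coordinate axis at the radius [|x|] recovered from [y], divided by
   [y] to compensate the weight; positive dimension provides the axis. *)
pose h (y : R) := K (\row_(i < n) (if i == Ordinal n0 then Num.sqrt (- ln y) else 0)) * expR (- ln y).
have hz x : h (z x) * z x = K x.
  rewrite /h /z expRK opprK -mulrA -expRD subrr expR0 mulr1; apply: rK.
  have : 0 <= enorm x by exact: sqrtr_ge0.
  move: (enorm x) => s s0; rewrite /enorm (bigD1 (Ordinal n0))//= big1 ?addr0; last first.
    by move=> i /negbTE i0; rewrite mxE i0 expr0n.
  by rewrite mxE eqxx sqr_sqrtr ?sqr_ge0// sqrtr_sqr ger0_norm.
have mln : measurable_fun setT (fun y : M => - ln y) by apply: measurable_funN; exact: measurable_ln.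
have msqrt : measurable_fun setT (Num.sqrt : M -> R).
  by apply: continuous_measurable_fun; exact: sqrt_continuous.
have mh : measurable_fun setT (h : M -> R).
  apply: measurable_funM; last exact: (measurableT_comp (@measurable_expR R) mln).
  apply: (measurableT_comp mK); apply: measurable_fun_rVP => i.
  under eq_fun do rewrite mxE; case: eqP => _; last exact: measurable_cst.
  exact: (measurableT_comp msqrt mln).
have ih : mu.-integrable setT (EFin \o (fun x => h (z x) * z x)).
  by under eq_fun do rewrite hz.
have [mhz ah] := papprox_comp mz z01 iz mh ih.
apply: gapprox_close => // e e0; have [P hP] := ah _ e0.
exists (fun x => \sum_(j <- index_enum 'I_(size P)) (P`_j * (4 * pi * (4 * j.+1%:R)^-1) `^ (n%:R / 2)) * hk ((4 * j.+1%:R)^-1) x).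
  by apply: gapprox_sum => j; apply: gapproxZ; apply: gapprox_hk; rewrite invr_gt0 mulr_gt0.
rewrite L1normE; apply: le_trans hP; rewrite wdistE; last by move=> x; case/andP: (z01 x).
under [X in (_ <= X)%E]eq_integral do rewrite /= hz.
rewrite le_eqVlt; apply/orP; left; apply/eqP; apply: eq_integral => x _.
congr (`|_ - _|%:E); rewrite horner_coef mulr_suml; apply: eq_bigr => j _.
by rewrite -[RHS]mulrA -exprSr zhk mulrA.
Qed.

Lemma gm_approximation (K : E -> R) (e : R) : (0 < n)%N -> mu.-integrable setT (EFin \o K) ->
  radial K -> 0 < e -> exists N (alpha : 'I_N -> R), (0 < N)%N /\
  (Lpnorm 1 (fun x => K x - \sum_j alpha j * gm (j.+1%:R^-1) x)%R <= e%:E)%E.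
Proof.
move=> n0 iK rK e0; have [_ /(_ _ e0)[P hP]] := gapprox_radial n0 iK rK.
(* One more coefficient than the size of [P], which keeps [N] positive even when [P = 0]. *)
exists (size P).+1, (fun j => P`_j); split => //; rewrite -wdist1.
by under [X in wdist _ _ _ X]eq_fun do rewrite -(@gmcomb_widen P (size P).+1)//.
Qed.

End green_density.

(** * Mild solutions *)

Section mild_solutions.
Context (R : realType) (n : nat).
Local Notation E := ('rV[R]_n).
Local Notation mu := (lebesgue_rV R n).
Local Notation M := (measurableTypeR R).
Local Notation leb := (@lebesgue_measure R).
Implicit Types (g : E -> R) (w : R -> E -> R) (p : \bar R).

Lemma supnorm_ge g x : (`|g x|%:E <= supnorm g)%E.
Proof. by apply: ereal_sup_ubound; exists x. Qed.

Lemma supnorm_ge0 g : (0 <= supnorm g)%E.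
Proof. by apply: le_trans (supnorm_ge g 0); rewrite lee_fin. Qed.

Lemma supnorm_le_BC p g : (supnorm g <= BC_Lp_norm p g)%E.
Proof. by rewrite /BC_Lp_norm leeDl// Lnorm_ge0. Qed.

Lemma Lpnorm_le_BC p g : (Lpnorm p g <= BC_Lp_norm p g)%E.
Proof. by rewrite /BC_Lp_norm leeDr// supnorm_ge0. Qed.

(** Clamping the time to [[0, T]] is 1-Lipschitz, and the supremum norm dominates the value at [y].
    Only positive [s] are covered, because curves need not be norm-continuous at 0. *)
Lemma BC_Lp_curve_continuous p (T : R) w y (s : R) : 0 < T -> BC_Lp_curve p T w -> 0 < s ->
  {for s, continuous (fun r : R => w (Num.max 0 (Num.min r T)) y)}.
Proof.
move=> T0 [_ _ cw] s0.
have st : 0 < Num.min s T <= T by rewrite lt_min s0 T0 ge_min lexx orbT.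
have wc : w r y @[r --> within `[0, T] (nbhs (Num.min s T))] --> w (Num.min s T) y.
  apply/cvgrPdist_lt => e e0.
  have /fine_cvgP[fin /cvgrPdist_lt/(_ _ e0) cv] := cw _ st.
  near=> r; rewrite distrC.
  have fr : BC_Lp_norm p (w r \- w (Num.min s T)) \is a fin_num by near: r.
  have er : `|0 - fine (BC_Lp_norm p (w r \- w (Num.min s T)))| < e by near: r; exact: cv.
  apply: le_lt_trans er; rewrite sub0r normrN; apply: le_trans (ler_norm _).
  rewrite -lee_fin fineK//; apply: le_trans (supnorm_le_BC _ _).
  exact: (supnorm_ge (w r \- w (Num.min s T)) y).
have mm r : 0 <= r -> Num.max 0 (Num.min r T) = Num.min r T.
  by move=> r0; rewrite max_r// le_min r0 ltW.
rewrite /prop_for /continuous_at mm ?(ltW s0)//; apply: cvg_comp wc => A [e /= e0 eA].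
have h : \forall r \near s, `|s - r| < e.
  by have /cvgrPdist_lt/(_ _ e0) := @cvg_id _ (nbhs s).
change (\forall r \near s, A (Num.max 0 (Num.min r T))).
near=> r; have r0 : 0 < r by near: r; exact: lt_nbhsr.
rewrite mm ?(ltW r0)//; apply: eA.
  apply: (@le_lt_trans _ _ `|s - r|); last by near: r; exact: h.
  rewrite /= /Num.min; case: ifPn => sT; case: ifPn => rT //; rewrite -?leNgt in sT rT.
  - by rewrite !ler0_norm; lra.
  - by rewrite !ger0_norm; lra.
  - by rewrite subrr normr0.
by rewrite /= in_itv/= ge_min lexx orbT andbT le_min (ltW T0) andbT ltW.
Unshelve. all: by end_near. Qed.

(** Replaces a curve known on [[0, T]] by a globally defined, jointly measurable and bounded
    function, as the lemmas on sources require; joint measurability comes from continuity in time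
    and in space separately. *)
Lemma BC_Lp_curve_extension p (T : R) w : 0 < T -> BC_Lp_curve p T w ->
  exists (W : M -> E -> R) (B : R),
  [/\ 0 <= B, measurable_fun setT (fun z : M * E => W z.1 z.2), forall s y, `|W s y| <= B,
      forall s, 0 < s <= T -> W s = w s &
      forall s, 0 < s <= T -> (Lpnorm p (w s) <= B%:E)%E].
Proof.
move=> T0 cw; have [bc [B0 B0P] _] := cw.
pose B := Num.max B0 0.
exists (fun s y => if 0 < s then w (Num.max 0 (Num.min s T)) y else 0), B.
have minT s : 0 <= Num.max 0 (Num.min s T) <= T.
  by rewrite le_max lexx/= ge_max (ltW T0)/= ge_min lexx orbT.
have BP t : 0 <= t <= T -> (BC_Lp_norm p (w t) <= B%:E)%E.
  by move=> tT; apply: le_trans (B0P _ tT) _; rewrite lee_fin le_max lexx.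
split.
- by rewrite le_max lexx orbT.
- apply: (measurable_cont_param_gt0 (g := fun s y => w (Num.max 0 (Num.min s T)) y)).
    move=> s; apply: continuous_measurable_rV; case: (bc (Num.max 0 (Num.min s T))) => //.
  by move=> y s s0; exact: (BC_Lp_curve_continuous T0 cw s0).
- move=> s y; case: ifPn => s0; last by rewrite normr0 le_max lexx orbT.
  rewrite -lee_fin; apply: le_trans (BP _ (minT s)).
  by apply: le_trans (supnorm_le_BC _ _); exact: supnorm_ge.
- move=> s /andP[s0 sT]; apply/funext => y; rewrite s0.
  by rewrite min_l// max_r// ltW.
- move=> s /andP[s0 sT]; apply: le_trans (BP _ _); first exact: Lpnorm_le_BC.
  by rewrite (ltW s0).
Qed.

Lemma BC_Lp_bound p g : BC_Lp p g -> exists2 B, 0 <= B & forall y, `|g y| <= B.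
Proof.
move=> [_ sg _]; have sfin : supnorm g \is a fin_num by rewrite ge0_fin_numE// supnorm_ge0.
exists (fine (supnorm g)); first by rewrite fine_ge0// supnorm_ge0.
by move=> y; rewrite -lee_fin fineK//; exact: supnorm_ge.
Qed.

Lemma measurable_convolution dz (Z : measurableType dz) (K : E -> R) (W : Z -> E -> R) (s : Z -> E) :
  measurable_fun setT K -> measurable_fun setT (fun z : Z * E => W z.1 z.2) ->
  measurable_fun setT s -> measurable_fun setT (fun z => convolution K (W z) (s z)).
Proof.
move=> mK mW ms.
apply: (measurable_Rintegral_param mu (f := fun z y => K (s z - y) * W z y)).
apply: measurable_funM => //; apply: (measurableT_comp mK); apply: measurable_rV_sub => //.
exact: (measurableT_comp ms measurable_fst).
Qed.

Lemma convolution_bound (K g : E -> R) (C B : R) x : measurable_fun setT K -> measurable_fun setT g ->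
  (\int[mu]_y `|K y|%:E <= C%:E)%E -> (forall y, `|g y| <= B) -> `|convolution K g x| <= C * B.
Proof.
move=> mK mg KC gB; apply: Rintegral_weight_bound => //.
- by apply: (measurableT_comp mK); exact: measurable_rV_sub.
- exact: le_trans (gB 0).
- rewrite (integral_rV_reflect x (F := fun y => `|K y|%:E))//.
  by apply/measurable_EFinP; exact: measurableT_comp.
Qed.

Lemma convolution_heat (t D : R) g : (0 < n)%N -> 0 < D -> 0 < t ->
  convolution (heat t D) g = hop (D * t) g.
Proof. by move=> n0 D0 t0; apply/funext => x; rewrite /hop -heat_hk// ltW. Qed.

Lemma duhamel_duh (D t : R) (G : R -> E -> R) (F : M -> E -> R) x : (0 < n)%N -> 0 < D ->
  measurable_fun setT (fun z : M * E => F z.1 z.2) -> (forall s, 0 < s < t -> G s = F s) ->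
  duhamel D G t x = duh D t F x.
Proof.
move=> n0 D0 mF GF; rewrite /duhamel /duh (Rintegral_ind (g := fun s => hop (D * (t - s)) (F s) x))//.
  by apply: (measurable_hopF mF); mr.
by move=> s st; rewrite GF// convolution_heat// subr_gt0; case/andP: st.
Qed.

Section source.
Variables (f : R -> R -> R) (Cf : R).
Hypotheses (f0 : f 0 0 = 0) (Cf0 : 0 < Cf)
  (fLip : forall u1 v1 u2 v2, `|f u1 v1 - f u2 v2| <= Cf * (`|u1 - u2| + `|v1 - v2|)).

Lemma lipschitz_bound u v : `|f u v| <= Cf * (`|u| + `|v|).
Proof. by have := fLip u v 0 0; rewrite f0 !subr0. Qed.

Lemma lipschitz_continuous (h : R -> R) : (forall a b, `|h a - h b| <= Cf * `|a - b|) -> continuous h.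
Proof.
move=> hL a; apply/cvgrPdist_lt => e e0.
have eC : 0 < e / Cf by rewrite divr_gt0.
have /cvgrPdist_lt/(_ _ eC) nearb := @cvg_id _ (nbhs a).
apply: filterS nearb => b ab; apply: le_lt_trans (hL _ _) _.
by rewrite mulrC -ltr_pdivlMr.
Qed.

Lemma measurable_lipschitz2 dz (Z : measurableType dz) (u v : Z -> R) :
  measurable_fun setT u -> measurable_fun setT v -> measurable_fun setT (fun z => f (u z) (v z)).
Proof.
move=> mu' mv.
have mf : measurable_fun setT (fun z : M * M => f z.1 z.2).
  apply: (measurable_cont_param (g := f : R -> M -> R)) => [s|z].
    apply: continuous_measurable_fun; apply: lipschitz_continuous => a b.
    by apply: le_trans (fLip _ _ _ _) _; rewrite subrr normr0 add0r.
  apply: lipschitz_continuous => a b.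
  by apply: le_trans (fLip _ _ _ _) _; rewrite subrr normr0 addr0.
have muv : measurable_fun setT (fun z => (u z : M, v z : M)) by apply/measurable_fun_pairP.
exact: (measurableT_comp mf muv).
Qed.

(** The nonlinearity is evaluated on the global extensions [U] and [V], which makes the source [F]
    measurable and bounded for all times; the Duhamel integral at [t <= T] sees it only where it
    agrees with the original one. *)
Lemma mild_source (D B0 T : R) u0 u (v : R -> E -> R) (U V : M -> E -> R) (BU BV : R) :
  (0 < n)%N -> 0 < D -> (forall y, `|u0 y| <= B0) ->
  measurable_fun setT (fun z : M * E => U z.1 z.2) -> (forall s y, `|U s y| <= BU) ->
  measurable_fun setT (fun z : M * E => V z.1 z.2) -> (forall s y, `|V s y| <= BV) ->
  (forall s, 0 < s <= T -> U s = u s /\ V s = v s) ->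
  (forall t x, 0 < t <= T -> u t x = convolution (heat t D) u0 x +
     duhamel D (fun s y => f (u s y) (v s y)) t x) ->
  exists (F : M -> E -> R) (B : R),
  [/\ measurable_fun setT (fun z : M * E => F z.1 z.2), (forall s y, `|F s y| <= B),
      (forall y, `|u0 y| <= B),
      (forall s, 0 < s <= T -> F s = fun y => f (u s y) (v s y)) &
      forall t, 0 < t <= T -> u t = Usol D u0 F t].
Proof.
move=> n0 D0 u0B mU UB mV VB UV ut.
exists (fun s y => f (U s y) (V s y)), (Num.max B0 (Cf * (BU + BV))).
have mF : measurable_fun setT (fun z : M * E => f (U z.1 z.2) (V z.1 z.2)).
  exact: measurable_lipschitz2.
have Fs s : 0 < s <= T -> (fun y => f (U s y) (V s y)) = (fun y => f (u s y) (v s y)).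
  by move=> /UV[-> ->].
split => //.
- move=> s y; rewrite le_max; apply/orP; right.
  apply: le_trans (lipschitz_bound _ _) _; apply: (ler_wpM2l (ltW Cf0)).
  by apply: lerD; [exact: UB|exact: VB].
- by move=> y; rewrite le_max u0B.
- move=> t /[dup] tT /andP[t0 tT']; apply/funext => x; rewrite ut// convolution_heat//.
  congr (_ + _); apply: duhamel_duh => // s /andP[s0 st].
  by rewrite Fs// s0 (le_trans (ltW st)).
Qed.

Lemma mild_NP_Usol (D T kappa : R) (K u0 : E -> R) p u : (0 < n)%N -> 0 < D -> 0 < T ->
  measurable_fun setT K -> (\int[mu]_y `|K y|%:E <= kappa%:E)%E -> BC_Lp p u0 ->
  mild_NP D f K u0 p T u ->
  exists (F : M -> E -> R) (B : R),
  [/\ measurable_fun setT (fun z : M * E => F z.1 z.2), (forall s y, `|F s y| <= B),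
      (forall y, `|u0 y| <= B),
      (forall s, 0 < s <= T -> F s = fun y => f (u s y) (convolution K (u s) y)) &
      forall t, 0 < t <= T -> u t = Usol D u0 F t].
Proof.
move=> n0 D0 T0 mK Kk bu0 [cu _ eq_u].
have [B0 _ u0B] := BC_Lp_bound bu0.
have [U [BU [BU0 mU UB Uu _]]] := BC_Lp_curve_extension T0 cu.
have mV : measurable_fun setT (fun z : M * E => convolution K (U z.1) z.2).
  apply: (measurable_convolution (W := fun z : M * E => U z.1)) => //.
  by apply: (measurable_uncurry_comp mU); [exact: (measurableT_comp measurable_fst measurable_fst)|].
apply: (mild_source (V := fun s => convolution K (U s)) (v := fun s => convolution K (u s)) n0 D0 u0B mU UB mV (BV := kappa * BU)) => //.
- move=> s y; apply: convolution_bound => //; exact: measurable_section1 mU.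
- by move=> s sT; rewrite Uu.
Qed.

Lemma mild_RD_Usol (D T delta : R) N (alpha d : 'I_N -> R) u0 p u v :
  (0 < n)%N -> 0 < D -> 0 < T -> BC_Lp p u0 ->
  mild_RD D f delta alpha d u0 (fun j => convolution (green (d j)) u0) p T u v ->
  exists (F : M -> E -> R) (B : R),
  [/\ measurable_fun setT (fun z : M * E => F z.1 z.2), (forall s y, `|F s y| <= B),
      (forall y, `|u0 y| <= B),
      (forall s, 0 < s <= T -> F s = fun y => f (u s y) (\sum_j alpha j * v j s y)) &
      forall t, 0 < t <= T -> u t = Usol D u0 F t].
Proof.
move=> n0 D0 T0 bu0 [[cu _] cv eq_u _].
have [B0 _ u0B] := BC_Lp_bound bu0.
have [U [BU [BU0 mU UB Uu _]]] := BC_Lp_curve_extension T0 cu.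
have /choice[V VP] j := BC_Lp_curve_extension T0 (cv j).1.
have {VP} /choice[BV VP] := VP.
have mV : measurable_fun setT (fun z : M * E => \sum_j alpha j * V j z.1 z.2).
  by apply: measurable_sum => j; apply: measurable_funM => //; case: (VP j).
apply: (mild_source (V := fun s y => \sum_j alpha j * V j s y) (v := fun s y => \sum_j alpha j * v j s y) n0 D0 u0B mU UB mV (BV := \sum_j `|alpha j| * BV j)) => //.
- move=> s y; apply: le_trans (ler_norm_sum _ _ _) _; apply: ler_sum => j _.
  by rewrite normrM ler_wpM2l//; case: (VP j).
- move=> s sT; split; first exact: Uu.
  by apply/funext => y; apply: eq_bigr => j _; case: (VP j) => _ _ _ ->.
Qed.

End source.

Lemma mild_RD_Vsol (D T delta dj B : R) (u0 : E -> R) u (v : R -> E -> R) (F : M -> E -> R) :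
  (0 < n)%N -> 0 < D -> 0 < delta -> 0 < dj -> measurable_fun setT u0 ->
  (forall y, `|u0 y| <= B) -> measurable_fun setT (fun z : M * E => F z.1 z.2) ->
  (forall s y, `|F s y| <= B) ->
  (forall t, 0 < t <= T -> u t = Usol D u0 F t) ->
  (forall t x, 0 < t <= T -> v t x = expR (- (t / delta)) *
     convolution (heat t (dj / delta)) (convolution (green dj) u0) x
     + delta^-1 * \int[leb]_(s in `[0, t])
        (expR (- ((t - s) / delta)) * convolution (heat (t - s) (dj / delta)) (u s) x)) ->
  forall t, 0 < t <= T -> v t = Vsol delta^-1 dj D u0 F t.
Proof.
move=> n0 D0 de0 dj0 mu0 u0B mF FB uU vt t /[dup] tT /andP[t0 tT']; apply/funext => x.
have B0 : 0 <= B by exact: le_trans (u0B 0).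
have a0 : 0 < delta^-1 by rewrite invr_gt0.
rewrite vt// /Vsol convolution_heat ?divr_gt0//; congr (_ + _).
  rewrite mulrC (mulrC t) (mulrC dj) (mulrC (expR _)).
  have -> // : convolution (green dj) u0 = Qop dj 0 u0.
  by apply/funext => y; exact: convolution_green u0B.
have mU : measurable_fun setT (fun z : M * E => Usol D u0 F z.1 z.2).
  exact: (measurable_Usol D mu0 mF).
have mk : measurable_fun setT (fun s : M => expR (- (delta^-1 * (t - s))) * hop (delta^-1 * dj * (t - s)) (Usol D u0 F s) x).
  by apply: measurable_funM; [mr|apply: (measurable_hopF mU); mr].
rewrite (Rintegral_ind (g := fun s => expR (- (delta^-1 * (t - s))) * hop (delta^-1 * dj * (t - s)) (Usol D u0 F s) x))//; last first.
  move=> s /andP[s0 st]; have dd : 0 < dj / delta by rewrite divr_gt0.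
  have ts : 0 < t - s by rewrite subr_gt0.
  have sT : 0 < s <= T by rewrite s0 (le_trans (ltW st)).
  by rewrite (uU _ sT) (convolution_heat _ n0 dd ts) (mulrC (t - s)) (mulrC dj).
rewrite -RintegralZl//; last first.
  apply: (integrable_ind_bounded (C := 1 * (B + `|t| * B))) => // s /andP[s0 st].
  rewrite normrM (ger0_norm (expR_ge0 _)); apply: ler_pM; [exact: expR_ge0|exact: normr_ge0| |].
    by apply: exp_le1; rewrite ?subr_ge0 ltW.
  apply: hop_bound; first exact: measurable_section1 mU.
  move=> y; apply: le_trans (Usol_bound D mu0 u0B mF FB s y) _.
  by rewrite lerD2l ler_wpM2r// !gtr0_norm// ltW.
by apply: eq_Rintegral => s _; rewrite mulrCA; congr (_ * _); rewrite mulrCA.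
Qed.

End mild_solutions.

(** * Comparison of the two systems *)

(** Absorption in the weighted norm, without forming the supremum: starting from the crude constant
    [B], the [k]-th pass yields [2 * c + B / 2 ^+ k], and [2 * c] is the fixed point of
    [c + Phi / 2]. The bound [B] leaves no trace in the conclusion. *)
Lemma halving_bound (R : realType) (I : Type) (S : I -> Prop) (X : I -> \bar R) (w : I -> R) (c B : R) :
  (forall i, 0 <= w i) -> 0 <= c -> 0 <= B ->
  (forall i, S i -> (X i <= (B * w i)%:E)%E) ->
  (forall Phi, 0 <= Phi -> (forall i, S i -> (X i <= (Phi * w i)%:E)%E) ->
    forall i, S i -> (X i <= ((c + Phi / 2) * w i)%:E)%E) ->
  forall i, S i -> (X i <= (2 * c * w i)%:E)%E.
Proof.
move=> w0 c0 B0 XB step.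
have bnd k i : S i -> (X i <= ((2 * c + B / 2 ^+ k) * w i)%:E)%E.
  elim: k i => [|k IH] i Si.
    apply: le_trans (XB i Si) _; rewrite lee_fin ler_wpM2r// expr0 divr1 lerDr.
    by rewrite mulr_ge0.
  have P0 : 0 <= 2 * c + B / 2 ^+ k by rewrite addr_ge0 ?mulr_ge0// invr_ge0 exprn_ge0.
  apply: le_trans (step _ P0 IH i Si) _; rewrite lee_fin ler_wpM2r//.
  have -> : 2 * c + B / 2 ^+ k.+1 = c + (2 * c + B / 2 ^+ k) / 2.
    by rewrite exprS; field; rewrite expf_neq0.
  by [].
move=> i Si; apply/lee_addgt0Pr => e e0.
have [k hk] : exists k, B / 2 ^+ k * w i <= e.
  have : B * w i / 2 ^+ k @[k --> \oo] --> 0.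
    rewrite -(mulr0 (B * w i)); apply: cvgMr.
    under eq_fun do rewrite -exprVn.
    by apply: cvg_expr; rewrite ger0_norm ?invr_ge0// invf_lt1// ltr1n.
  move=> /cvgrPdist_lt/(_ _ e0)[k _ /(_ k (leqnn _))] /= h; exists k.
  move: h; rewrite sub0r normrN => h; rewrite mulrAC.
  by apply: le_trans (ltW h); exact: ler_norm.
apply: le_trans (bnd k i Si) _; rewrite -EFinD lee_fin mulrDl lerD2l.
exact: hk.
Qed.

Lemma exp_ge1 (R : realType) (x : R) : 0 <= x -> 1 <= expR x.
Proof. by move=> x0; rewrite -[leLHS]expR0 ler_expR. Qed.

Section estimates.
Context (R : realType) (n : nat).
Local Notation E := ('rV[R]_n).
Local Notation mu := (lebesgue_rV R n).
Local Notation M := (measurableTypeR R).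
Local Notation leb := (@lebesgue_measure R).
Variable (p : \bar R).
Hypothesis p1 : (1 <= p)%E.
Local Opaque hop Qop.

(** Inserting [expR (- (la * (t - s)))] and its inverse leaves slices of norm at most
    [b * expR (la * t)], integrated against a weight of mass at most [1 / la]. *)
Lemma Lpnorm_duh (D t la b : R) (F : M -> E -> R) : 0 < la -> 0 <= b ->
  measurable_fun setT (fun z : M * E => F z.1 z.2) ->
  (forall s, 0 < s < t -> (Lpnorm p (F s) <= (b * expR (la * s))%:E)%E) ->
  (Lpnorm p (duh D t F) <= (la^-1 * (b * expR (la * t)))%:E)%E.
Proof.
move=> la0 b0 mF Fb.
have -> : duh D t F = fun x => \int[leb]_s (ind t s * (expR (- (la * (t - s))) *
    (expR (la * (t - s)) * hop (D * (t - s)) (F s) x))).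
  apply/funext => x; apply: eq_Rintegral => s _; congr (_ * _).
  by rewrite mulrA -expRD addNr expR0 mul1r.
have mh : measurable_fun setT (fun z : M * E => hop (D * (t - z.1)) (F z.1) z.2).
  by apply: (measurable_hopF mF); mr.
apply: (Lpnorm_ind_exp p1 (k := fun s x => expR (la * (t - s)) * hop (D * (t - s)) (F s) x)) => //.
- by rewrite mulr_ge0// expR_ge0.
- by apply: measurable_funM => //; mr.
move=> s st.
have -> : b * expR (la * t) = `|expR (la * (t - s))| * (b * expR (la * s)).
  by rewrite ger0_norm ?expR_ge0// mulrCA -expRD; congr (_ * expR _); ring.
apply: LpnormZ => //; first exact: (measurable_section1 (f := fun (s : M) x => hop (D * (t - s)) (F s) x)).
apply: Lpnorm_hop => //; last exact: Fb.
  exact: measurable_section1 mF.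
by rewrite mulr_ge0// expR_ge0.
Qed.

Lemma Lpnorm_Usol (D t la b U : R) (g : E -> R) (F : M -> E -> R) : 0 < la -> 0 <= b -> 0 <= U ->
  measurable_fun setT g -> (Lpnorm p g <= U%:E)%E ->
  measurable_fun setT (fun z : M * E => F z.1 z.2) ->
  (forall s, 0 < s < t -> (Lpnorm p (F s) <= (b * expR (la * s))%:E)%E) ->
  (Lpnorm p (Usol D g F t) <= (U + la^-1 * (b * expR (la * t)))%:E)%E.
Proof.
move=> la0 b0 U0 mg gU mF Fb; apply: LpnormD => //.
- exact: measurable_hop1.
- by apply: (measurable_duh D (t := fun=> t) (y := id) mF).
- exact: Lpnorm_hop.
- exact: Lpnorm_duh.
Qed.

Lemma measurable_Vsol (a d D t : R) (g : E -> R) (F : M -> E -> R) :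
  measurable_fun setT g -> measurable_fun setT (fun z : M * E => F z.1 z.2) ->
  measurable_fun setT (Vsol a d D g F t).
Proof.
move=> mg mF.
have mU : measurable_fun setT (fun z : M * E => Usol D g F z.1 z.2).
  exact: (measurable_Usol D mg mF).
have mh : measurable_fun setT (fun z : M * E => hop (a * d * (t - z.1)) (Usol D g F z.1) z.2).
  by apply: (measurable_hopF mU); mr.
apply: measurable_funD.
  by apply: measurable_funM => //; apply: measurable_hop1; exact: measurable_Qop1.
apply: (measurable_Rintegral_param leb (f := fun x s => ind t s * (expR (- (a * (t - s))) * (a * hop (a * d * (t - s)) (Usol D g F s) x)))).
apply: measurable_funM; first by mr.
apply: measurable_funM; first by mr.
apply: measurable_funM => //.
exact: (measurable_uncurry_swap (f := fun (s : M) (x : E) => hop (a * d * (t - s)) (Usol D g F s) x)).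
Qed.

(** The factor [a] in front of the source compensates the mass [1/a] of the relaxation weight, so
    the bound is uniform in [a], that is, in [delta]. *)
Lemma Lpnorm_Vsol (a d D t la Phi U : R) (g : E -> R) (F : M -> E -> R) :
  0 < a -> 0 < d -> 0 < t -> 0 <= la -> 0 <= Phi -> 0 <= U ->
  measurable_fun setT g -> (Lpnorm p g <= U%:E)%E ->
  measurable_fun setT (fun z : M * E => F z.1 z.2) ->
  (forall s, 0 < s < t -> (Lpnorm p (Usol D g F s) <= (Phi * expR (la * s))%:E)%E) ->
  (Lpnorm p (Vsol a d D g F t) <= (U + Phi * expR (la * t))%:E)%E.
Proof.
move=> a0 d0 t0 la0 P0 U0 mg gU mF UP.
have mU : measurable_fun setT (fun z : M * E => Usol D g F z.1 z.2).
  exact: (measurable_Usol D mg mF).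
have mQ : measurable_fun setT (Qop d 0 g) by exact: measurable_Qop1.
have mh : measurable_fun setT (fun z : M * E => hop (a * d * (t - z.1)) (Usol D g F z.1) z.2).
  by apply: (measurable_hopF mU); mr.
have mhQ : measurable_fun setT (hop (a * d * t) (Qop d 0 g)) by exact: measurable_hop1.
have Pt : 0 <= Phi * expR (la * t) by rewrite mulr_ge0// expR_ge0.
apply: (LpnormD p1).
- exact: measurable_funM.
- apply: (measurable_Rintegral_param leb (f := fun x s => ind t s * (expR (- (a * (t - s))) * (a * hop (a * d * (t - s)) (Usol D g F s) x)))).
  apply: measurable_funM; first by mr.
  apply: measurable_funM; first by mr.
  apply: measurable_funM => //.
  exact: (measurable_uncurry_swap (f := fun (s : M) (x : E) => hop (a * d * (t - s)) (Usol D g F s) x)).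
- apply: le_trans (LpnormZ p1 _ mhQ (Lpnorm_hop p1 _ mQ U0 (Lpnorm_Qop p1 _ d0 mg U0 gU))) _.
  by rewrite lee_fin ger0_norm ?expR_ge0// ler_piMl// exp_le1// ltW.
- have -> : Phi * expR (la * t) = a^-1 * (a * (Phi * expR (la * t))).
    by rewrite mulKf// gt_eqF.
  apply: (Lpnorm_ind_exp p1 (k := fun s x => a * hop (a * d * (t - s)) (Usol D g F s) x)) => //.
  + by rewrite mulr_ge0// ltW.
  + exact: measurable_funM.
  move=> s /andP[s0 st]; rewrite -[X in (X * _)%:E](gtr0_norm a0).
  have mhs : measurable_fun setT (hop (a * d * (t - s)) (Usol D g F s)).
    exact: (measurable_section1 (f := fun (s : M) x => hop (a * d * (t - s)) (Usol D g F s) x)).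
  have mUs : measurable_fun setT (Usol D g F s) by exact: measurable_section1 mU.
  have Us : (Lpnorm p (Usol D g F s) <= (Phi * expR (la * t))%:E)%E.
    apply: le_trans (UP s _) _; first by rewrite s0.
    by rewrite lee_fin ler_wpM2l// ler_expR ler_wpM2l// ltW.
  exact: (LpnormZ p1 a mhs (Lpnorm_hop p1 _ mUs Pt Us)).
Qed.

Lemma Lpnorm_lipschitz (h a b : E -> R) (C A B : R) : 0 <= C ->
  measurable_fun setT h -> measurable_fun setT a -> measurable_fun setT b ->
  (forall x, `|h x| <= C * (`|a x| + `|b x|)) ->
  (Lpnorm p a <= A%:E)%E -> (Lpnorm p b <= B%:E)%E ->
  (Lpnorm p h <= (C * (A + B))%:E)%E.
Proof.
move=> C0 mh ma mb hab aA bB.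
have mna : measurable_fun setT (fun x => `|a x|) by exact: measurableT_comp.
have mnb : measurable_fun setT (fun x => `|b x|) by exact: measurableT_comp.
have naA : (Lpnorm p (fun x => `|a x|)%R <= A%:E)%E.
  by apply: le_trans aA; apply: le_Lpnorm => // x; rewrite normr_id.
have nbB : (Lpnorm p (fun x => `|b x|)%R <= B%:E)%E.
  by apply: le_trans bB; apply: le_Lpnorm => // x; rewrite normr_id.
have mab : measurable_fun setT (fun x => `|a x| + `|b x|) by exact: measurable_funD.
apply: (@le_trans _ _ (Lpnorm p (fun x => C * (`|a x| + `|b x|))%R)).
  apply: le_Lpnorm => //; first exact: measurable_funM.
  by move=> x; apply: le_trans (hab x) _; exact: ler_norm.
rewrite -[X in (X * _)%:E](ger0_norm C0); apply: LpnormZ => //.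
exact: LpnormD.
Qed.

Lemma Lpnorm_sum (I : Type) (r : seq I) (c : I -> R) (h : I -> E -> R) (W : R) :
  (forall i, measurable_fun setT (h i)) -> (forall i, (Lpnorm p (h i) <= W%:E)%E) ->
  (Lpnorm p (fun x => \sum_(i <- r) c i * h i x)%R <= ((\sum_(i <- r) `|c i|) * W)%:E)%E.
Proof.
move=> mh hW; elim: r => [|i r IH].
  under eq_fun do rewrite big_nil.
  by rewrite big_nil mul0r Lpnorm0.
under eq_fun do rewrite big_cons.
rewrite big_cons mulrDl; apply: LpnormD => //.
- exact: measurable_funM.
- by apply: measurable_sum => j; exact: measurable_funM.
- exact: LpnormZ.
Qed.

(** With the exponent [2 * La], a source of rate [La] is multiplied by [La / (2 * La) = 1/2] in
    [Lpnorm_duh]; the part [c] contributes [c / (2 * La)]. The bound [B] only starts the iteration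
    of [halving_bound]. *)
Lemma Usol_Lp_growth (D T La c U B : R) (g : E -> R) (F : M -> E -> R) :
  0 < La -> 0 <= c -> 0 <= U -> 0 <= B -> measurable_fun setT g -> (Lpnorm p g <= U%:E)%E ->
  measurable_fun setT (fun z : M * E => F z.1 z.2) ->
  (forall s, 0 < s <= T -> (Lpnorm p (Usol D g F s) <= B%:E)%E) ->
  (forall Phi, 0 <= Phi ->
    (forall s, 0 < s <= T -> (Lpnorm p (Usol D g F s) <= (Phi * expR (2 * La * s))%:E)%E) ->
    forall s, 0 < s <= T -> (Lpnorm p (F s) <= ((La * Phi + c) * expR (2 * La * s))%:E)%E) ->
  forall s, 0 < s <= T ->
    (Lpnorm p (Usol D g F s) <= (2 * (U + c / (2 * La)) * expR (2 * La * s))%:E)%E.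
Proof.
move=> La0 c0 U0 B0 mg gU mF UB step.
have La20 : 0 < 2 * La by rewrite mulr_gt0.
apply: (halving_bound (S := fun s => 0 < s <= T) (w := fun s => expR (2 * La * s)) (B := B)).
- by move=> s; exact: expR_ge0.
- by rewrite addr_ge0// divr_ge0// ltW.
- exact: B0.
- move=> s /[dup] sT /andP[s0 _]; apply: le_trans (UB s sT) _.
  by rewrite lee_fin ler_peMr// exp_ge1// mulr_ge0 ?ltW.
- move=> Phi P0 UPhi s /andP[s0 sT].
  have b0 : 0 <= La * Phi + c by rewrite addr_ge0// mulr_ge0// ltW.
  apply: (le_trans (Lpnorm_Usol D La20 b0 U0 mg gU mF _)).
    by move=> r /andP[r0 rs]; apply: (step _ P0 UPhi); rewrite r0 (le_trans (ltW rs)).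
  have e1 : 1 <= expR (2 * La * s) by rewrite exp_ge1// mulr_ge0 ?ltW.
  rewrite lee_fin; have -> : (U + c / (2 * La) + Phi / 2) * expR (2 * La * s) =
      U * expR (2 * La * s) + (2 * La)^-1 * ((La * Phi + c) * expR (2 * La * s)).
    by field; rewrite gt_eqF.
  by rewrite lerD2r ler_peMr.
Qed.

End estimates.

Section convolution_linear.
Context (R : realType) (n : nat).
Local Notation E := ('rV[R]_n).
Local Notation mu := (lebesgue_rV R n).
Implicit Types (k g : E -> R).

Lemma integrable_L1 k (C : R) : measurable_fun setT k -> (Lpnorm 1 k <= C%:E)%E ->
  mu.-integrable setT (EFin \o k).
Proof.
move=> mk kC; apply/integrableP; split; first exact/measurable_EFinP.
by rewrite -L1normE; apply: le_lt_trans kC _; rewrite ltry.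
Qed.

Lemma integrable_convolution k g (B : R) x : mu.-integrable setT (EFin \o k) ->
  measurable_fun setT g -> (forall y, `|g y| <= B) ->
  mu.-integrable setT (EFin \o (fun y => k (x - y) * g y)).
Proof.
move=> /integrableP[mk koo] mg gB; apply: (integrable_weight_bounded (B := B)) => //.
have mk' : measurable_fun setT (fun y : E => (k (x - y))%:E).
  by apply: (measurableT_comp mk); exact: measurable_rV_sub.
apply/integrableP; split => //.
by rewrite (integral_rV_reflect x (F := fun y => `|(k y)%:E|%E))//; exact: measurableT_comp.
Qed.

Lemma convolutionD k1 k2 g (B : R) x : mu.-integrable setT (EFin \o k1) ->
  mu.-integrable setT (EFin \o k2) -> measurable_fun setT g -> (forall y, `|g y| <= B) ->
  convolution (fun y => k1 y + k2 y) g x = convolution k1 g x + convolution k2 g x.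
Proof.
move=> i1 i2 mg gB; rewrite /convolution -RintegralD//.
- by apply: eq_Rintegral => y _; rewrite mulrDl.
- exact: integrable_convolution gB.
- exact: integrable_convolution gB.
Qed.

Lemma convolutionZ c k g (B : R) x : mu.-integrable setT (EFin \o k) ->
  measurable_fun setT g -> (forall y, `|g y| <= B) ->
  convolution (fun y => c * k y) g x = c * convolution k g x.
Proof.
move=> ik mg gB; rewrite /convolution -RintegralZl//.
- by apply: eq_Rintegral => y _; rewrite mulrA.
- exact: integrable_convolution gB.
Qed.

Lemma Lpnorm_gm d : 0 < d -> (Lpnorm 1 (gm d : E -> R) <= 1%:E)%E.
Proof.
move=> d0; rewrite -[X in (_ <= X%:E)%E]mulr1.
apply: (Lpnorm_weight_le (lexx 1%E) (m := @lebesgue_measure R) (w := rho d) (G := fun r x => hk r x)) => //.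
- exact: measurable_rho.
- by apply: measurable_hk_comp; [exact: measurable_fst|exact: measurable_snd].
- move=> r _; rewrite L1normE; under eq_integral do rewrite ger0_norm ?hk_ge0//.
  exact: integral_hk_le1.
- by under eq_integral do rewrite ger0_norm ?rho_ge0//; exact: integral_rho_le1.
Qed.

Lemma convolution_gm_sum (I : Type) (r : seq I) (c d : I -> R) g (B : R) x : (forall i, 0 < d i) ->
  measurable_fun setT g -> (forall y, `|g y| <= B) ->
  convolution (fun y => \sum_(i <- r) c i * gm (d i) y) g x = \sum_(i <- r) c i * Qop (d i) 0 g x.
Proof.
move=> d0 mg gB.
have ig i : mu.-integrable setT (EFin \o (gm (d i) : E -> R)).
  apply: integrable_L1; [exact: measurable_gm|exact: Lpnorm_gm].
have icg i : mu.-integrable setT (EFin \o (fun y : E => c i * gm (d i) y)).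
  by apply: eq_integrable (integrableZl measurableT (c i) (ig i)).
have is' s : mu.-integrable setT (EFin \o (fun y : E => \sum_(i <- s) c i * gm (d i) y)).
  elim: s => [|i s IH].
    rewrite (_ : _ \o _ = cst 0%E); first exact: integrable0.
    by apply/funext => y /=; rewrite big_nil.
  apply: eq_integrable (integrableD measurableT (icg i) IH) => // y _.
  by rewrite /= big_cons.
elim: r => [|i r IH].
  rewrite big_nil /convolution; under eq_Rintegral do rewrite big_nil mul0r.
  by rewrite Rintegral_cst ?mul0r.
under [X in convolution X]eq_fun do rewrite big_cons.
rewrite (convolutionD _ (icg i) (is' r) mg gB) big_cons IH; congr (_ + _).
by rewrite (convolutionZ _ _ (ig i) mg gB) (convolution_gm _ (d0 i) mg gB).
Qed.

End convolution_linear.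

Ltac nonneg := first
  [ assumption | apply: ltW; assumption | exact: ler01 | exact: ler0n | exact: expR_ge0
  | apply: mulr_ge0; nonneg | apply: addr_ge0; nonneg | (rewrite invr_ge0; nonneg) ].

(** * Estimates with explicit constants for one pair of solutions *)

Section main_estimate.
Context (R : realType).
Local Notation M := (measurableTypeR R).

Definition growth (Cf A T : R) : R := expR (2 * (Cf * (1 + A)) * T).

(** Bound for the source of the relaxed system relative to [u0]: the rate [Cf * (1 + A)] applied to
    the growth bound [4] for [u^delta], plus [Cf * A] from the initial values of the [v_j]. *)
Definition source_const (Cf T A : R) : R := (4 * (Cf * (1 + A)) + Cf * A) * growth Cf A T.

(** The bracket of [Lpnorm_Vsol_Qop_Usol] with [U = 1] and [W = Fb]; summing over [j] dominates
    every single component. *)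
Definition relax_const (Cf D T : R) (m : nat) (alpha d : 'I_m -> R) : R :=
  let Fb := source_const Cf T (\sum_j `|alpha j|) in
  \sum_j (D / d j * (1 + 1) + (T * (D / d j * (Fb + Fb)) + Fb)).

(** [relax_const] alone accounts for [v_j - k_j * u^delta], and its product with [A * growth] for
    [u^delta - u]; the final 1 keeps the constant positive even if the sums vanish. *)
Definition delta_const (Cf D T : R) (m : nat) (alpha d : 'I_m -> R) : R :=
  let A := \sum_j `|alpha j| in
  relax_const Cf D T alpha d * (1 + A * growth Cf A T) + 1.

(** The first growth bounds [u] relative to [u0]; the second is the Gronwall factor of the
    difference, whose kernel has L^1 norm at most [1 + kappa]. No coefficient [alpha_j] occurs. *)
Definition eps_const (Cf kappa T : R) : R := 2 * growth Cf kappa T * growth Cf (1 + kappa) T.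

Context (n : nat).
Local Notation E := ('rV[R]_n).
Local Notation mu := (lebesgue_rV R n).
Variables (p : \bar R) (D T delta Cf kappa e1 L0 U : R) (f : R -> R -> R) (m : nat) (alpha d : 'I_m -> R).
Variables (K u0 : E -> R) (u ud : R -> E -> R) (v : 'I_m -> R -> E -> R).
Let A := \sum_j `|alpha j|.
Let KN (x : E) := \sum_j alpha j * gm (d j) x.
Hypotheses (p1 : (1 <= p)%E) (D0 : 0 < D) (T0 : 0 < T) (delta0 : 0 < delta) (Cf0 : 0 < Cf)
  (f0 : f 0 0 = 0)
  (fLip : forall u1 v1 u2 v2, `|f u1 v1 - f u2 v2| <= Cf * (`|u1 - u2| + `|v1 - v2|))
  (d0 : forall j, 0 < d j).
Hypotheses (mK : measurable_fun setT K) (Kk : (Lpnorm 1 K <= kappa%:E)%E) (kappa0 : 0 <= kappa)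
  (e10 : 0 <= e1) (KKN : (Lpnorm 1 (fun x => K x - KN x)%R <= e1%:E)%E)
  (L00 : 0 <= L0) (KNL : (Lpnorm 1 KN <= L0%:E)%E) (L0A : L0 <= A) (L0k : L0 <= 1 + kappa).
Variables (F Fd : M -> E -> R) (B Bd Bu : R).
Hypotheses (U0 : 0 <= U) (mu0 : measurable_fun setT u0) (u0U : (Lpnorm p u0 <= U%:E)%E).
Hypotheses (mF : measurable_fun setT (fun z : M * E => F z.1 z.2)) (FB : forall s y, `|F s y| <= B)
  (u0B : forall y, `|u0 y| <= B)
  (Fu : forall s, 0 < s <= T -> F s = fun y => f (u s y) (convolution K (u s) y))
  (uE : forall t, 0 < t <= T -> u t = Usol D u0 F t).
Hypotheses (mFd : measurable_fun setT (fun z : M * E => Fd z.1 z.2)) (FdB : forall s y, `|Fd s y| <= Bd)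
  (u0Bd : forall y, `|u0 y| <= Bd)
  (Fud : forall s, 0 < s <= T -> Fd s = fun y => f (ud s y) (\sum_j alpha j * v j s y))
  (udE : forall t, 0 < t <= T -> ud t = Usol D u0 Fd t)
  (vE : forall j t, 0 < t <= T -> v j t = Vsol delta^-1 (d j) D u0 Fd t).
Hypotheses (Bu0 : 0 <= Bu) (uBu : forall t, 0 < t <= T -> (Lpnorm p (u t) <= Bu%:E)%E)
  (udBu : forall t, 0 < t <= T -> (Lpnorm p (ud t) <= Bu%:E)%E).
Local Opaque hop Qop.

Let A0 : 0 <= A. Proof. by apply: sumr_ge0. Qed.

Let m_u t : 0 < t <= T -> measurable_fun setT (u t).
Proof. by move=> tT; rewrite uE//; apply: (measurable_Usol D mu0 mF (t := fun=> t) (y := id)). Qed.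

Let m_ud t : 0 < t <= T -> measurable_fun setT (ud t).
Proof. by move=> tT; rewrite udE//; apply: (measurable_Usol D mu0 mFd (t := fun=> t) (y := id)). Qed.

Let m_v j t : 0 < t <= T -> measurable_fun setT (v j t).
Proof.
by move=> tT; rewrite vE//; exact: measurable_Vsol. Qed.

Let mF1 s : measurable_fun setT (F s). Proof. exact: measurable_section1 mF. Qed.
Let mFd1 s : measurable_fun setT (Fd s). Proof. exact: measurable_section1 mFd. Qed.

Let La := Cf * (1 + A).
Let La0 : 0 < La. Proof. by rewrite mulr_gt0// ltr_wpDr. Qed.

Let Fd_growth Phi : 0 <= Phi ->
  (forall s, 0 < s <= T -> (Lpnorm p (ud s) <= (Phi * expR (2 * La * s))%:E)%E) ->
  forall s, 0 < s <= T ->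
    (Lpnorm p (Fd s) <= ((La * Phi + Cf * A * U) * expR (2 * La * s))%:E)%E.
Proof.
move=> P0 uP s /[dup] sT /andP[s0 sT'].
have la0 : 0 <= 2 * La by rewrite mulr_ge0// ltW.
have vs j : (Lpnorm p (v j s) <= (U + Phi * expR (2 * La * s))%:E)%E.
  rewrite vE//; apply: (Lpnorm_Vsol p1) => //; first by rewrite invr_gt0.
  move=> r /andP[r0 rs]; have rT : 0 < r <= T by rewrite r0 (le_trans (ltW rs)).
  by rewrite -udE//; exact: uP.
have svs : (Lpnorm p (fun y => \sum_j alpha j * v j s y)%R <= (A * (U + Phi * expR (2 * La * s)))%:E)%E.
  by apply: (Lpnorm_sum p1) => // j; exact: m_v.
have ms : measurable_fun setT (fun y => \sum_j alpha j * v j s y).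
  by apply: measurable_sum => j; apply: measurable_funM => //; exact: m_v.
have lip x : `|Fd s x| <= Cf * (`|ud s x| + `|\sum_j alpha j * v j s x|).
  by rewrite Fud//; exact: lipschitz_bound.
apply: le_trans (Lpnorm_lipschitz p1 (ltW Cf0) (mFd1 s) (m_ud sT) ms lip (uP s sT) svs) _.
rewrite lee_fin /La; set X := expR _.
have X1 : 1 <= X by exact: exp_ge1 (mulr_ge0 la0 (ltW s0)).
have -> : (Cf * (1 + A) * Phi + Cf * A * U) * X = Cf * (Phi * X + A * (U * X + Phi * X)) by ring.
apply: ler_wpM2l; first exact: ltW.
by rewrite lerD2l; apply: ler_wpM2l => //; rewrite lerD2r ler_peMr.
Qed.

Let ud_growth s : 0 < s <= T -> (Lpnorm p (ud s) <= (4 * U * expR (2 * La * s))%:E)%E.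
Proof.
move=> sT; rewrite udE//.
have c0 : 0 <= Cf * A * U by rewrite !mulr_ge0// ltW.
apply: le_trans (Usol_Lp_growth p1 La0 c0 U0 Bu0 mu0 u0U mFd (T := T) _ _ sT) _.
- by move=> r rT; rewrite -udE//; exact: udBu.
- move=> Phi P0 uP; apply: Fd_growth => // r rT.
  by rewrite udE//; exact: uP.
rewrite lee_fin; apply: ler_wpM2r; first exact: expR_ge0.
(* The 4 arises because [Cf * A] is at most [2 * La], so the contribution of the initial values is
   at most [U]. *)
have -> : 4 * U = 2 * (U + U) by ring.
have La2 : 0 < 2 * La by rewrite mulr_gt0.
rewrite ler_pM2l// lerD2l ler_pdivrMr// -subr_ge0.
have -> : U * (2 * La) - Cf * A * U = Cf * U * (2 + A) by rewrite /La; ring.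
by nonneg.
Qed.

Let Fd_bound s : 0 < s <= T -> (Lpnorm p (Fd s) <= (source_const Cf T A * U)%:E)%E.
Proof.
move=> /[dup] sT /andP[s0 sT']; have U40 : 0 <= 4 * U by rewrite mulr_ge0.
apply: le_trans (Fd_growth U40 ud_growth sT) _; rewrite lee_fin /source_const.
have -> : La * (4 * U) + Cf * A * U = (4 * La + Cf * A) * U by ring.
rewrite mulrAC; apply: ler_wpM2r => //; apply: ler_wpM2l.
  by nonneg.
by rewrite ler_expR; apply: ler_wpM2l => //; nonneg.
Qed.

Let Fb := source_const Cf T A.
Let Fb0 : 0 <= Fb.
Proof.
by rewrite /Fb /source_const /growth; nonneg.
Qed.

Let Om := relax_const Cf D T alpha d.
Let term j := D / d j * (1 + 1) + (T * (D / d j * (Fb + Fb)) + Fb).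
Let term_ge0 j : 0 <= term j.
Proof.
have Dd : 0 <= D / d j by rewrite divr_ge0 ?ltW.
by rewrite /term; nonneg.
Qed.
Let Om_ge j : term j <= Om.
Proof.
have -> : Om = \sum_j term j by [].
by rewrite (bigD1 j)//= lerDl sumr_ge0.
Qed.
Let Om0 : 0 <= Om. Proof. by apply: sumr_ge0 => j _; exact: term_ge0. Qed.

Let w_bound j t : 0 < t <= T ->
  (Lpnorm p (fun x => v j t x - Qop (d j) 0 (ud t) x)%R <= (delta * Om * U)%:E)%E.
Proof.
move=> tT; have [t0 tT'] := andP tT; rewrite vE// udE//.
have a0 : 0 < delta^-1 by rewrite invr_gt0.
have W0 : 0 <= Fb * U by rewrite mulr_ge0.
apply: le_trans (Lpnorm_Vsol_Qop_Usol p1 a0 (d0 j) D0 tT U0 W0 mu0 u0Bd mFd FdB u0U _) _.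
  by move=> s /andP[s0 st]; apply: Fd_bound; rewrite s0 (le_trans (ltW st)).
rewrite lee_fin invrK.
have -> : delta * (D / d j * (U + U) + (T * (D / d j * (Fb * U + Fb * U)) + Fb * U)) = delta * term j * U.
  by rewrite /term; ring.
apply: ler_wpM2r => //; apply: ler_wpM2l; last exact: Om_ge.
exact: ltW.
Qed.

Let Ka := Cf * (1 + kappa).
Let Ka0 : 0 < Ka. Proof. by rewrite mulr_gt0// ltr_wpDr. Qed.

Let Lpnorm_conv (k g : E -> R) (C W : R) : measurable_fun setT k -> measurable_fun setT g ->
  0 <= C -> 0 <= W -> (Lpnorm 1 k <= C%:E)%E -> (Lpnorm p g <= W%:E)%E ->
  (Lpnorm p (convolution k g) <= (C * W)%:E)%E.
Proof. by move=> mk mg C0 W0; rewrite L1normE; exact: Lpnorm_convolution. Qed.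

Let m_conv (k g : E -> R) : measurable_fun setT k -> measurable_fun setT g ->
  measurable_fun setT (convolution k g).
Proof.
move=> mk mg; apply: (measurable_convolution (W := fun=> g) (s := id)) => //.
exact: (measurableT_comp mg measurable_snd).
Qed.

Let u_growth s : 0 < s <= T -> (Lpnorm p (u s) <= (2 * U * expR (2 * Ka * s))%:E)%E.
Proof.
move=> sT; rewrite uE//.
apply: le_trans (Usol_Lp_growth p1 Ka0 (lexx 0) U0 Bu0 mu0 u0U mF (T := T) _ _ sT) _.
- by move=> r rT; rewrite -uE//; exact: uBu.
- move=> Phi P0 uP r rT; rewrite addr0.
  have ur : (Lpnorm p (u r) <= (Phi * expR (2 * Ka * r))%:E)%E by rewrite uE//; exact: uP.
  have Pr : 0 <= Phi * expR (2 * Ka * r) by rewrite mulr_ge0// expR_ge0.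
  have cr := Lpnorm_conv mK (m_u rT) kappa0 Pr Kk ur.
  have lip x : `|F r x| <= Cf * (`|u r x| + `|convolution K (u r) x|).
    by rewrite Fu//; exact: lipschitz_bound.
  apply: le_trans (Lpnorm_lipschitz p1 (ltW Cf0) (mF1 r) (m_u rT) (m_conv mK (m_u rT)) lip ur cr) _.
  by rewrite lee_fin /Ka le_eqVlt; apply/orP; left; apply/eqP; ring.
by rewrite mul0r addr0.
Qed.

Let S1 := 2 * growth Cf kappa T.
Let S10 : 0 <= S1. Proof. by rewrite mulr_ge0// expR_ge0. Qed.

Let u_bound s : 0 < s <= T -> (Lpnorm p (u s) <= (S1 * U)%:E)%E.
Proof.
move=> sT; apply: le_trans (u_growth sT) _; rewrite lee_fin /S1 mulrAC ler_wpM2r//.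
rewrite ler_pM2l// ler_expR; apply: ler_wpM2l; first by nonneg.
by case/andP: sT.
Qed.

Let u_bnd t : 0 < t <= T -> exists b, forall y, `|u t y| <= b.
Proof. by move=> tT; rewrite uE//; exists (B + `|t| * B) => y; exact: Usol_bound. Qed.
Let ud_bnd t : 0 < t <= T -> exists b, forall y, `|ud t y| <= b.
Proof. by move=> tT; rewrite udE//; exists (Bd + `|t| * Bd) => y; exact: Usol_bound. Qed.

Let m_KN : measurable_fun setT KN.
Proof. by apply: measurable_sum => j; apply: measurable_funM => //; exact: measurable_gm. Qed.

Let KNE (g : E -> R) b x : measurable_fun setT g -> (forall y, `|g y| <= b) ->
  convolution KN g x = \sum_j alpha j * Qop (d j) 0 g x.
Proof. by move=> mg gb; rewrite -(convolution_gm_sum _ alpha x d0 mg gb). Qed.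

Let QopB d' (g1 g2 : E -> R) b1 b2 x : 0 < d' -> measurable_fun setT g1 -> measurable_fun setT g2 ->
  (forall y, `|g1 y| <= b1) -> (forall y, `|g2 y| <= b2) ->
  Qop d' 0 (fun y => g1 y - g2 y) x = Qop d' 0 g1 x - Qop d' 0 g2 x.
Proof.
move=> d'0 m1 m2 h1 h2.
have m2' : measurable_fun setT (fun y => - g2 y) by exact: measurable_funN.
have h2' y : `|- g2 y| <= b2 by rewrite normrN.
have mD : measurable_fun setT (fun y => g1 y - g2 y) by exact: measurable_funB.
have hD y : `|g1 y - g2 y| <= b1 + b2 by apply: le_trans (ler_normB _ _) _; exact: lerD.
have e : g1 = fun y => (g1 y - g2 y) + g2 y by apply/funext => y; rewrite subrK.
by rewrite [in RHS]e (QopD 0 x d'0 mD m2 hD h2) addrK.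
Qed.

(** The regrouping that keeps [A] away from [eps]: the first sum is of order [delta], the second
    term involves the difference only through the L^1 norm of [KN], and the third is controlled by
    [e1] and the bound on [u]. Applying norms to the individual [v_j - k_j * u] instead would bring
    [A] into the rate. *)
Let coupling s x : 0 < s <= T ->
  \sum_j alpha j * v j s x - convolution K (u s) x =
  \sum_j alpha j * (v j s x - Qop (d j) 0 (ud s) x) +
   (convolution KN (fun y => ud s y - u s y) x - convolution (fun y => K y - KN y) (u s) x).
Proof.
move=> sT; have [b1 h1] := ud_bnd sT; have [b2 h2] := u_bnd sT.
have mD : measurable_fun setT (fun y => ud s y - u s y) by apply: measurable_funB; [exact: m_ud|exact: m_u].
have hD y : `|ud s y - u s y| <= b1 + b2 by apply: le_trans (ler_normB _ _) _; exact: lerD.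
have iKN : mu.-integrable setT (EFin \o KN) by exact: integrable_L1 KNL.
have iKKN : mu.-integrable setT (EFin \o (fun y => K y - KN y)).
  by apply: integrable_L1 KKN; exact: measurable_funB.
have -> : convolution K (u s) x = convolution (fun y => K y - KN y) (u s) x + convolution KN (u s) x.
  rewrite -(convolutionD x iKKN iKN (m_u sT) h2); congr (convolution _ _ _).
  by apply/funext => y; rewrite subrK.
rewrite (KNE _ mD hD) (KNE _ (m_u sT) h2).
have -> : \sum_j alpha j * Qop (d j) 0 (fun y => ud s y - u s y) x =
  \sum_j alpha j * Qop (d j) 0 (ud s) x - \sum_j alpha j * Qop (d j) 0 (u s) x.
  rewrite -sumrB; apply: eq_bigr => j _.
  by rewrite (QopB x (d0 j) (m_ud sT) (m_u sT) h1 h2) mulrBr.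
have -> : \sum_j alpha j * (v j s x - Qop (d j) 0 (ud s) x) =
  \sum_j alpha j * v j s x - \sum_j alpha j * Qop (d j) 0 (ud s) x.
  by rewrite -sumrB; apply: eq_bigr => j _; rewrite mulrBr.
ring.
Qed.

Let Lb := Cf * (1 + L0).
Let Lb0 : 0 < Lb. Proof. by rewrite mulr_gt0// ltr_wpDr. Qed.

Let diff_source s y := Fd s y - F s y.
Let m_diff : measurable_fun setT (fun z : M * E => diff_source z.1 z.2).
Proof. exact: measurable_funB. Qed.

(** The common initial datum cancels, so [Usol_Lp_growth] is used with zero datum and the whole
    error sits in the source. *)
Let diff_Usol t : 0 < t <= T -> (fun x => ud t x - u t x) = Usol D (fun=> 0) diff_source t.
Proof.
move=> tT; apply/funext => x; rewrite uE// udE// /Usol.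
have -> : hop (D * t) (fun=> 0) x = 0.
  apply/eqP; rewrite -normr_le0; apply: hop_bound => //.
  by move=> y; rewrite normr0.
rewrite add0r opprD addrACA subrr add0r /duh -RintegralB//.
- apply: eq_Rintegral => s _; rewrite -mulrBr; congr (_ * _).
  have hD y : `|diff_source s y| <= Bd + B.
    by apply: le_trans (ler_normB _ _) _; apply: lerD; [exact: FdB|exact: FB].
  have mdr : measurable_fun setT (diff_source s) by exact: measurable_section1 m_diff.
  have e : Fd s = fun y => diff_source s y + F s y by apply/funext => y; rewrite /diff_source subrK.
  by rewrite [in LHS]e (hopD _ x mdr (mF1 s) hD (FB s)) addrK.
- apply: (integrable_weight_bounded (B := Bd) (integrable_ind t)).
    by apply: (measurable_hopF mFd); mr.
  by move=> s; apply: hop_bound; [exact: measurable_section1 mFd|exact: FdB].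
- apply: (integrable_weight_bounded (B := B) (integrable_ind t)).
    by apply: (measurable_hopF mF); mr.
  by move=> s; apply: hop_bound; [exact: measurable_section1 mF|exact: FB].
Qed.

Let err := Cf * (A * (delta * Om * U) + e1 * (S1 * U)).
Let err0 : 0 <= err.
Proof. by rewrite /err; nonneg. Qed.

Let diff_growth s : 0 < s <= T ->
  (Lpnorm p (fun x => ud s x - u s x)%R <= (2 * (0 + err / (2 * Lb)) * expR (2 * Lb * s))%:E)%E.
Proof.
move=> sT; rewrite diff_Usol//.
have m0 : measurable_fun setT ((fun=> 0) : E -> R) by exact: measurable_cst.
have z0 : (Lpnorm p ((fun=> 0%R) : E -> R) <= 0%:E)%E by rewrite Lpnorm0.
have BB : 0 <= Bu + Bu by rewrite addr_ge0.
apply: (Usol_Lp_growth p1 Lb0 err0 (lexx 0) BB m0 z0 m_diff (T := T)) => //.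
- move=> r rT; rewrite -diff_Usol//; apply: LpnormB => //; [exact: m_ud|exact: m_u|exact: udBu|exact: uBu].
move=> Phi P0 uP r rT; have [r0 rT'] := andP rT.
have er : (Lpnorm p (fun x => ud r x - u r x)%R <= (Phi * expR (2 * Lb * r))%:E)%E.
  by rewrite diff_Usol//; exact: uP.
have Pr : 0 <= Phi * expR (2 * Lb * r) by rewrite mulr_ge0// expR_ge0.
have m1 : measurable_fun setT (fun y => ud r y - u r y) by apply: measurable_funB; [exact: m_ud|exact: m_u].
have mKK : measurable_fun setT (fun y => K y - KN y) by exact: measurable_funB.
have mw j : measurable_fun setT (fun x => v j r x - Qop (d j) 0 (ud r) x).
  by apply: measurable_funB; [exact: m_v|apply: measurable_Qop1; exact: m_ud].
have c1 : (Lpnorm p (fun x => \sum_j alpha j * (v j r x - Qop (d j) 0 (ud r) x))%R <= (A * (delta * Om * U))%:E)%E.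
  by apply: (Lpnorm_sum p1) => // j; exact: w_bound.
have c2 := Lpnorm_conv m_KN m1 L00 Pr KNL er.
have Su0 : 0 <= S1 * U by rewrite mulr_ge0.
have c3 := Lpnorm_conv mKK (m_u rT) e10 Su0 KKN (u_bound rT).
have mc2 := m_conv m_KN m1.
have mc3 := m_conv mKK (m_u rT).
have c23 := LpnormB p1 mc2 mc3 c2 c3.
have ms : measurable_fun setT (fun x => \sum_j alpha j * (v j r x - Qop (d j) 0 (ud r) x)).
  by apply: measurable_sum => j; exact: measurable_funM.
have c := LpnormD p1 ms (measurable_funB mc2 mc3) c1 c23.
have mdr : measurable_fun setT (diff_source r) by exact: measurable_section1 m_diff.
have lip x : `|diff_source r x| <= Cf * (`|ud r x - u r x| +
    `|\sum_j alpha j * (v j r x - Qop (d j) 0 (ud r) x) +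
   (convolution KN (fun y => ud r y - u r y) x - convolution (fun y => K y - KN y) (u r) x)|).
  by rewrite /diff_source Fu// Fud// -coupling//; exact: fLip.
apply: le_trans (Lpnorm_lipschitz p1 (ltW Cf0) mdr m1 (measurable_funD ms (measurable_funB mc2 mc3)) lip er c) _.
rewrite lee_fin /Lb /err; set X := expR _.
have X1 : 1 <= X by rewrite exp_ge1// !mulr_ge0 ?addr_ge0// ltW.
have -> : (Cf * (1 + L0) * Phi + Cf * (A * (delta * Om * U) + e1 * (S1 * U))) * X =
  Cf * (Phi * X + L0 * (Phi * X) + (A * (delta * Om * U) + e1 * (S1 * U)) * X) by ring.
apply: ler_wpM2l; first exact: ltW.
have : (A * (delta * Om * U) + e1 * (S1 * U)) <= (A * (delta * Om * U) + e1 * (S1 * U)) * X.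
  by rewrite ler_peMr//; nonneg.
by lra.
Qed.

(** The single factor [expR (2 * Lb * T)] is bounded twice: with [L0 <= A] in the [delta] term and
    with [L0 <= 1 + kappa] in the [eps] term. Dividing [err] by [Lb] removes its factor [Cf]. *)
Let diff_bound s : 0 < s <= T ->
  (Lpnorm p (fun x => ud s x - u s x)%R <=
    ((A * Om * growth Cf A T * delta + eps_const Cf kappa T * e1) * U)%:E)%E.
Proof.
move=> sT; have [s0 sT'] := andP sT; apply: le_trans (diff_growth sT) _.
rewrite lee_fin add0r.
have -> : 2 * (err / (2 * Lb)) = err / Lb by field; rewrite gt_eqF.
have eL : err / Lb <= A * (delta * Om * U) + e1 * (S1 * U).
  rewrite ler_pdivrMr// /err mulrC; apply: ler_wpM2l.
    by nonneg.
  by rewrite /Lb ler_peMr ?(ltW Cf0)// lerDl.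
apply: (@le_trans _ _ ((A * (delta * Om * U) + e1 * (S1 * U)) * expR (2 * Lb * T))).
  apply: ler_pM; [by nonneg|exact: expR_ge0|exact: eL|].
  by rewrite ler_expR; apply: ler_wpM2l => //; nonneg.
have gA : expR (2 * Lb * T) <= growth Cf A T.
  by rewrite ler_expR ler_wpM2r ?(ltW T0)// ler_pM2l// /Lb ler_pM2l// lerD2l.
have gk : expR (2 * Lb * T) <= growth Cf (1 + kappa) T.
  by rewrite ler_expR ler_wpM2r ?(ltW T0)// ler_pM2l// /Lb ler_pM2l// lerD2l.
have -> : (A * Om * growth Cf A T * delta + eps_const Cf kappa T * e1) * U =
  A * (delta * Om * U) * growth Cf A T + e1 * (S1 * U) * growth Cf (1 + kappa) T.
  by rewrite /eps_const /S1; ring.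
rewrite mulrDl; apply: lerD; apply: ler_wpM2l => //; nonneg.
Qed.

Lemma main_estimate_u s : 0 < s <= T ->
  (Lpnorm p (fun x => ud s x - u s x)%R <=
    ((delta_const Cf D T alpha d * delta + eps_const Cf kappa T * e1) * U)%:E)%E.
Proof.
move=> sT; apply: le_trans (diff_bound sT) _; rewrite lee_fin ler_wpM2r// lerD2r ler_wpM2r ?(ltW delta0)//.
rewrite /delta_const -/A -/Om -subr_ge0.
have -> : Om * (1 + A * growth Cf A T) + 1 - A * Om * growth Cf A T = Om + 1 by ring.
by rewrite addr_ge0.
Qed.

Lemma main_estimate_v j s : 0 < s <= T ->
  (Lpnorm p (fun x => v j s x - Qop (d j) 0 (u s) x)%R <=
    ((delta_const Cf D T alpha d * delta + eps_const Cf kappa T * e1) * U)%:E)%E.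
Proof.
move=> sT; have [b1 h1] := ud_bnd sT; have [b2 h2] := u_bnd sT.
set W := (A * Om * growth Cf A T * delta + eps_const Cf kappa T * e1) * U.
have W0 : 0 <= W.
  by rewrite /W /eps_const /growth; nonneg.
have m1 : measurable_fun setT (fun y => ud s y - u s y) by apply: measurable_funB; [exact: m_ud|exact: m_u].
have mw : measurable_fun setT (fun x => v j s x - Qop (d j) 0 (ud s) x).
  by apply: measurable_funB; [exact: m_v|apply: measurable_Qop1; exact: m_ud].
have mQ : measurable_fun setT (Qop (d j) 0 (fun y => ud s y - u s y)) by exact: measurable_Qop1.
(* The relaxation error is separated from [k_j * (u^delta - u)], which [Lpnorm_Qop] bounds by the
   first estimate. *)
have -> : (fun x => v j s x - Qop (d j) 0 (u s) x) =
   (fun x => (v j s x - Qop (d j) 0 (ud s) x) + Qop (d j) 0 (fun y => ud s y - u s y) x).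
  apply/funext => x; rewrite (QopB x (d0 j) (m_ud sT) (m_u sT) h1 h2).
  by rewrite addrA subrK.
apply: le_trans (LpnormD p1 mw mQ (w_bound j sT) (Lpnorm_Qop p1 _ (d0 j) m1 W0 (diff_bound sT))) _.
rewrite lee_fin /W /delta_const -/A -/Om -subr_ge0.
set g := growth _ _ _; set h := eps_const _ _ _.
have -> : ((Om * (1 + A * g) + 1) * delta + h * e1) * U -
  (delta * Om * U + (A * Om * g * delta + h * e1) * U) = delta * U by ring.
by rewrite mulr_ge0// ltW.
Qed.

End main_estimate.

Lemma relax_const_ge0 (R : realType) (Cf D T : R) m (alpha d : 'I_m -> R) :
  0 < Cf -> 0 < D -> 0 < T -> (forall j, 0 < d j) -> 0 <= relax_const Cf D T alpha d.
Proof.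
move=> Cf0 D0 T0 d0; apply: sumr_ge0 => j _.
have A0 : 0 <= \sum_j `|alpha j| by apply: sumr_ge0.
have Dd : 0 <= D / d j by rewrite divr_ge0 ?ltW.
rewrite /source_const /growth; move: (\sum_j _) A0 (D / d j) Dd => A A0 c c0.
by nonneg.
Qed.

Lemma delta_const_gt0 (R : realType) (Cf D T : R) m (alpha d : 'I_m -> R) :
  0 < Cf -> 0 < D -> 0 < T -> (forall j, 0 < d j) -> 0 < delta_const Cf D T alpha d.
Proof.
move=> Cf0 D0 T0 d0; have := relax_const_ge0 alpha Cf0 D0 T0 d0.
have A0 : 0 <= \sum_j `|alpha j| by apply: sumr_ge0.
rewrite /delta_const /growth; move: (relax_const _ _ _ _ _) (\sum_j _) A0 => r A A0 r0.
by rewrite ltr_wpDl//; nonneg.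
Qed.

Lemma eps_const_gt0 (R : realType) (Cf kappa T : R) : 0 < eps_const Cf kappa T.
Proof. by rewrite /eps_const /growth !mulr_gt0// expR_gt0. Qed.

Section assembly.
Context (R : realType) (n : nat).
Local Notation E := ('rV[R]_n).

Lemma sup_Lpnorm_le (p : \bar R) (T : R) (w : R -> E -> R) (C : \bar R) : (1 <= p)%E ->
  w 0 = (fun=> 0) -> (0 <= C)%E -> (forall t, 0 < t <= T -> (Lpnorm p (w t) <= C)%E) ->
  (sup_Lpnorm p T w <= C)%E.
Proof.
move=> p1 w0 C0 wC; apply: ub_ereal_sup => _ [t tT <-].
have : 0 <= t <= T by move: tT; rewrite /= in_itv.
move=> /andP[t0 tT']; have [->|tn0] := eqVneq t 0; first by rewrite w0 Lpnorm0.
by apply: wC; rewrite tT' andbT lt_neqAle eq_sym tn0.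
Qed.

(** A choice of Lipschitz constant determined by [f] alone, so that [C1] and [C3] are functions of
    [f]; the default 1 is taken when there is none. *)
Definition lipschitz_const (f : R -> R -> R) : R :=
  xget 1 [set C | 0 < C /\ forall u1 v1 u2 v2, `|f u1 v1 - f u2 v2| <= C * (`|u1 - u2| + `|v1 - v2|)].

Lemma lipschitz_constP (f : R -> R -> R) :
  (exists2 C, 0 < C & forall u1 v1 u2 v2, `|f u1 v1 - f u2 v2| <= C * (`|u1 - u2| + `|v1 - v2|)) ->
  0 < lipschitz_const f /\ forall u1 v1 u2 v2,
    `|f u1 v1 - f u2 v2| <= lipschitz_const f * (`|u1 - u2| + `|v1 - v2|).
Proof.
move=> [C C0 fC]; rewrite /lipschitz_const; case: xgetP => [y -> //|/(_ C)]; by case.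
Qed.

End assembly.

(* N, alpha, d depend only on K and eps; C1 only on f, D, alpha, d and T;
   C3 only on f, K and T (everything may depend on the dimension n). *)
Theorem theorem6 (R : realType) (n : nat) (n_gt0 : (0 < n)%N) :
  exists (N : ('rV[R]_n -> R) -> R -> nat)
    (alpha d : forall (K : 'rV[R]_n -> R) (eps : R), 'I_(N K eps) -> R)
    (C1 : (R -> R -> R) -> R ->
          forall m : nat, ('I_m -> R) -> ('I_m -> R) -> R -> R)
    (C3 : (R -> R -> R) -> ('rV[R]_n -> R) -> R -> R),
  forall (D : R) (f : R -> R -> R) (K : 'rV[R]_n -> R) (eps delta T : R),
    0 < D ->
    f 0 0 = 0 ->
    (exists2 Cf : R, 0 < Cf & forall u1 v1 u2 v2 : R,
       `|f u1 v1 - f u2 v2| <= Cf * (`|u1 - u2| + `|v1 - v2|)) ->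
    (lebesgue_rV R n).-integrable setT (EFin \o K) -> radial K -> 0 < eps -> 0 < delta -> 0 < T ->
    let c1 := C1 f D (N K eps) (alpha K eps) (d K eps) T in
    let c3 := C3 f K T in
    [/\ (0 < N K eps)%N, (forall j, 0 < d K eps j), 0 < c1, 0 < c3 &
      forall (p : \bar R) (u0 : 'rV[R]_n -> R) (u udelta : R -> 'rV[R]_n -> R)
        (vdelta : 'I_(N K eps) -> R -> 'rV[R]_n -> R),
        (1 <= p)%E -> BC_Lp p u0 ->
        mild_NP D f K u0 p T u ->
        mild_RD D f delta (alpha K eps) (d K eps) u0
          (fun j => convolution (green (d K eps j)) u0) p T udelta vdelta ->
        (sup_Lpnorm p T (fun t => (udelta t \- u t)%R)
           <= (c1 * delta + c3 * eps)%:E * Lpnorm p u0)%E /\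
        (forall j,
          sup_Lpnorm p T (fun t => (vdelta j t \- convolution (green (d K eps j)) (u t))%R)
            <= (c1 * delta + c3 * eps)%:E * Lpnorm p u0)%E].
Proof.
pose mu := lebesgue_rV R n.
(* Choosing over pairs of a kernel and a tolerance makes [N] and [alpha] functions of [K] and [eps]
   only. The tolerance is capped at 1, which bounds the L^1 norm of the approximant by [1 + kappa]
   for every [eps]. *)
have /choice[pick pickP] : forall Ke : ('rV[R]_n -> R) * R, exists q : {N : nat & 'I_N -> R},
    mu.-integrable setT (EFin \o Ke.1) -> radial Ke.1 -> 0 < Ke.2 ->
    (0 < tag q)%N /\ (Lpnorm 1 (fun x => Ke.1 x -
       \sum_j tagged q j * gm (j.+1%:R^-1) x)%R <= (Num.min Ke.2 1)%:E)%E.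
  move=> [K e] /=.
  have [[iK [rK e0]]|nh] := pselect (mu.-integrable setT (EFin \o K) /\ radial K /\ 0 < e).
    have m0 : 0 < Num.min e 1 by rewrite lt_min e0/=.
    have [N [alpha [N0 aN]]] := gm_approximation n_gt0 iK rK m0.
    by exists (existT _ N alpha).
  (* A default choice where the hypotheses on the kernel or the tolerance fail. *)
  by exists (existT _ 0%N (fun=> 0)) => iK rK e0; exfalso; apply: nh.
exists (fun K eps => tag (pick (K, eps))), (fun K eps => tagged (pick (K, eps))),
  (fun K eps j => j.+1%:R^-1), (fun f D m alpha d T => delta_const (lipschitz_const f) D T alpha d),
  (fun f K T => eps_const (lipschitz_const f) (fine (Lpnorm 1 K)) T).
move=> D f K eps delta T D0 f0 /lipschitz_constP[Cf0 fLip] iK rK eps0 delta0 T0 c1 c3.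
have [/= N0 KKN] := pickP (K, eps) iK rK eps0.
pose alpha := tagged (pick (K, eps)).
have d0 (j : 'I_(tag (pick (K, eps)))) : 0 < j.+1%:R^-1 :> R by rewrite invr_gt0.
have c10 : 0 < c1 by exact: delta_const_gt0.
have c30 : 0 < c3 by exact: eps_const_gt0.
split => // p u0 u ud v p1 bu0 hu hud.
have [cu0 _ Lu0] := bu0.
have U0f : Lpnorm p u0 \is a fin_num by rewrite ge0_fin_numE// Lnorm_ge0.
have mK : measurable_fun setT K by apply/measurable_EFinP; exact: (measurable_int _ iK).
have KL : (Lpnorm 1 K < +oo)%E by rewrite L1normE; case/integrableP: iK.
have Kf : Lpnorm 1 K \is a fin_num by rewrite ge0_fin_numE// Lnorm_ge0.
set kappa := fine (Lpnorm 1 K).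
have Kk : (Lpnorm 1 K <= kappa%:E)%E by rewrite /kappa fineK.
have kappa0 : 0 <= kappa by rewrite fine_ge0// Lnorm_ge0.
have KI : (\int[mu]_y `|K y|%:E <= kappa%:E)%E by rewrite -L1normE.
have mu0 : measurable_fun setT u0 by exact: continuous_measurable_rV.
set U := fine (Lpnorm p u0).
have U0 : 0 <= U by rewrite fine_ge0// Lnorm_ge0.
have u0U : (Lpnorm p u0 <= U%:E)%E by rewrite /U fineK.
have [F [B [mF FB u0B Fu uE]]] := mild_NP_Usol f0 Cf0 fLip n_gt0 D0 T0 mK KI bu0 hu.
have [Fd [Bd [mFd FdB u0Bd Fud udE]]] := mild_RD_Usol f0 Cf0 fLip n_gt0 D0 T0 bu0 hud.
have [cu u00 _] := hu; have [[cud ud00] cv _ vt] := hud.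
have vE j t : 0 < t <= T -> v j t = Vsol delta^-1 (j.+1%:R^-1) D u0 Fd t.
  move=> tT; apply: (mild_RD_Vsol n_gt0 D0 delta0 (d0 j) mu0 u0Bd mFd FdB udE _ tT).
  by move=> t' x t'T; exact: vt.
have [_ [B1 [B10 _ _ _ uB1]]] := BC_Lp_curve_extension T0 cu.
have [_ [B2 [B20 _ _ _ udB2]]] := BC_Lp_curve_extension T0 cud.
have B120 : 0 <= B1 + B2 by rewrite addr_ge0.
have uB t : 0 < t <= T -> (Lpnorm p (u t) <= (B1 + B2)%:E)%E.
  by move=> tT; apply: le_trans (uB1 t tT) _; rewrite lee_fin lerDl.
have udB t : 0 < t <= T -> (Lpnorm p (ud t) <= (B1 + B2)%:E)%E.
  by move=> tT; apply: le_trans (udB2 t tT) _; rewrite lee_fin lerDr.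
pose e1 := Num.min eps 1.
have e10 : 0 <= e1 by rewrite le_min ler01 ltW.
have e1eps : e1 <= eps by rewrite ge_min lexx.
have e11 : e1 <= 1 by rewrite ge_min lexx orbT.
pose A := \sum_j `|alpha j|.
(* The bound by [A] holds since each Green function has mass at most one, the other by comparison
   with [K]. *)
pose L0 := Num.min A (1 + kappa).
have A0 : 0 <= A by apply: sumr_ge0.
have L00 : 0 <= L0 by rewrite le_min A0 addr_ge0.
have L0A : L0 <= A by rewrite ge_min lexx.
have L0k : L0 <= 1 + kappa by rewrite ge_min lexx orbT.
have one : (1 <= 1 :> \bar R)%E by [].
pose KN (x : 'rV[R]_n) := \sum_j alpha j * gm (j.+1%:R^-1) x.
have mKN : measurable_fun setT KN.
  by apply: measurable_sum => j; apply: measurable_funM => //; exact: measurable_gm.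
have KKN' : (Lpnorm 1 (fun x => K x - KN x)%R <= e1%:E)%E by [].
have KNL : (Lpnorm 1 KN <= L0%:E)%E.
  rewrite /L0 /Num.min; case: ifPn => _.
    rewrite -[A]mulr1; apply: Lpnorm_sum => // j; first exact: measurable_gm.
    exact: Lpnorm_gm.
  have -> : KN = fun x => K x - (K x - KN x) by apply/funext => x; rewrite subKr.
  apply: le_trans (LpnormB one mK (measurable_funB mK mKN) Kk KKN') _.
  by rewrite lee_fin addrC lerD2r.
have cc0 : (0 <= (c1 * delta + c3 * eps)%:E * Lpnorm p u0)%E.
  by rewrite mule_ge0 ?Lnorm_ge0// lee_fin addr_ge0// mulr_ge0// ltW.
have le_c : ((c1 * delta + c3 * e1) * U)%:E = ((c1 * delta + c3 * e1)%:E * Lpnorm p u0)%E.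
  by rewrite EFinM /U fineK.
have cc : ((c1 * delta + c3 * e1)%:E * Lpnorm p u0 <= (c1 * delta + c3 * eps)%:E * Lpnorm p u0)%E.
  by apply: lee_wpmul2r; rewrite ?Lnorm_ge0// lee_fin lerD2l ler_wpM2l// ltW.
have mainu := main_estimate_u p1 D0 T0 delta0 Cf0 f0 fLip d0 mK Kk kappa0 e10 KKN' L00 KNL L0A L0k
  U0 mu0 u0U mF FB u0B Fu uE mFd FdB u0Bd Fud udE vE B120 uB udB.
have mainv := main_estimate_v p1 D0 T0 delta0 Cf0 f0 fLip d0 mK Kk kappa0 e10 KKN' L00 KNL L0A L0k
  U0 mu0 u0U mF FB u0B Fu uE mFd FdB u0Bd Fud udE vE B120 uB udB.
split=> [|j]; apply: sup_Lpnorm_le => //.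
- by rewrite ud00 u00; apply/funext => x /=; rewrite subrr.
- move=> t tT; apply: le_trans cc; rewrite -le_c; exact: mainu.
- by rewrite (cv j).2 u00; apply/funext => x /=; rewrite subrr.
- move=> t tT; apply: le_trans cc; rewrite -le_c.
  (* The estimates are stated with [Qop]; boundedness of [u t] allows the return to the Green
     function. *)
  have -> : convolution (green (j.+1%:R^-1)) (u t) = Qop (j.+1%:R^-1) 0 (u t).
    apply/funext => x; apply: (convolution_green (B := B + `|t| * B)) => //.
      by rewrite uE//; apply: (measurable_Usol D mu0 mF (t := fun=> t) (y := id)).
    by move=> y; rewrite uE//; exact: Usol_bound.
  exact: mainv.
Qed.
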